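(* Let $(A_n)_{n\in\mathbb{N}}$ be a sequence of nonunital $\mathrm{C}^*$-algebras, infinitely many of which are projectionless. Then the corona algebra $\mathcal{Q}(\bigoplus_n A_n)$ is not countably quantifier-free saturated. In particular, there is a sequence of simple separable $\mathrm{C}^*$-algebras $A_n$ such that $\mathcal{Q}(\bigoplus_n A_n)$ is not countably quantifier-free saturated.
   Context: A $\mathrm{C}^*$-algebra is projectionless if it has no projections other than $0$ and (possibly) $1$. $\bigoplus_n A_n$ is the $c_0$-direct sum, $\mathcal{Q}(A)=\mathcal{M}(A)/A$ with $\mathcal{M}(A)$ the multiplier algebra. Countably quantifier-free saturated: every countable set of quantifier-free conditions with parameters from the algebra that is finitely approximately satisfiable in it is realized in it. *)

(* Defs.v *)
From HB Require Import structures.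
From mathcomp Require Import all_boot all_order all_algebra.
From mathcomp Require Import interval_inference generic_quotient ring_quotient complex.
From mathcomp Require Import all_classical all_reals topology normedtype sequences.

Set Implicit Arguments.
Unset Strict Implicit.
Unset Printing Implicit Defensive.

Import Order.TTheory GRing.Theory Num.Theory.
Import numFieldNormedType.Exports.
Import Quotient.

Local Open Scope classical_set_scope.
Local Open Scope ring_scope.

Section RealNorm.
Context (R : realType).

(* The norm of a normedModType over R[i] takes its values in R[i]; [rnorm] is
   the same norm, read in R. *)
Definition rnorm (V : normedModType R[i]) (x : V) : R := complex.Re `|x|.

Context (V : normedModType R[i]).
Implicit Types x y : V.

Lemma normE x : `|x| = (rnorm x)%:C%C.
Proof. by rewrite /rnorm RRe_real// ger0_real. Qed.

Lemma rnorm_le x (e : R) : (`|x| <= e%:C%C) = (rnorm x <= e).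
Proof. by rewrite normE lecR. Qed.

Lemma rnorm_lt x (e : R) : (`|x| < e%:C%C) = (rnorm x < e).
Proof. by rewrite normE ltcR. Qed.

Lemma rnorm_ge0 x : 0 <= rnorm x.
Proof. by rewrite -ler0c -normE. Qed.

Lemma rnorm0 : rnorm (0 : V) = 0.
Proof. by rewrite /rnorm normr0. Qed.

Lemma rnorm0_eq0 x : rnorm x = 0 -> x = 0.
Proof. by move=> x0; apply/eqP; rewrite -normr_eq0 normE x0. Qed.

Lemma rnormN x : rnorm (- x) = rnorm x.
Proof. by rewrite /rnorm normrN. Qed.

Lemma rnormB x y : rnorm (x - y) = rnorm (y - x).
Proof. by rewrite /rnorm distrC. Qed.

Lemma rnormD x y : rnorm (x + y) <= rnorm x + rnorm y.
Proof. by rewrite -rnorm_le rmorphD/= -!normE ler_normD. Qed.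

Lemma rnormBD z x y : rnorm (x - y) <= rnorm (x - z) + rnorm (z - y).
Proof. by rewrite -rnorm_le rmorphD/= -!normE ler_distD. Qed.

Lemma rnormZ (k : R[i]) x : rnorm (k *: x) = Normc.normc k * rnorm x.
Proof.
by apply: complexI; rewrite rmorphM/= -!normE normrZ.
Qed.

Lemma rnorm_eq (K : R) x y : (forall e, 0 < e -> rnorm (x - y) <= K * e) -> x = y.
Proof.
move=> xy; apply/eqP; rewrite -subr_eq0; apply/eqP/rnorm0_eq0/eqP.
rewrite eq_le rnorm_ge0 andbT; apply/ler_addgt0Pl => e e0; rewrite addr0.
have K1 : 0 < `|K| + 1 by rewrite ltr_wpDl.
apply: (le_trans (xy (e / (`|K| + 1)) _)); first by rewrite divr_gt0.
rewrite mulrCA ler_piMr ?(ltW e0)// ler_pdivrMr// mul1r.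
by rewrite (le_trans (ler_norm K))// lerDl.
Qed.

End RealNorm.

Lemma gtc0E (R : realType) (e : R[i]) : 0 < e -> exists2 r : R, 0 < r & e = r%:C%C.
Proof.
move=> e0; have er : e \is Num.real by rewrite gtr0_real.
by exists (complex.Re e); rewrite ?RRe_real// -ltcR RRe_real.
Qed.

Lemma complete_ev (R : realType) (V : normedModType R[i]) (I : Type)
    (W : I -> completeNormedModType R[i]) (ev : forall i, V -> W i) (K : I -> R) :
  (forall i, 0 <= K i) ->
  (forall i x y, ev i (x - y) = ev i x - ev i y) ->
  (forall i x, rnorm (ev i x) <= K i * rnorm x) ->
  (forall x e, 0 <= e -> (forall i, rnorm (ev i x) <= K i * e) -> rnorm x <= e) ->
  (forall l : forall i, W i,
    (forall e, 0 < e -> exists x, forall i, rnorm (l i - ev i x) <= K i * e) ->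
    exists v, forall i, ev i v = l i) ->
  forall F : set_system V, ProperFilter F -> cauchy F -> cvg F.
Proof.
move=> K0 evB evb evn evc F FF Fc.
have Fx (e : R) : 0 < e -> exists x, F [set y | rnorm (x - y) < e].
  move=> e0; have e0C : 0 < e%:C%C by rewrite ltcR.
  have /cauchyP /(_ _ e0C)[x Fx] := Fc.
  exists x; apply: filterS Fx => y /=.
  by rewrite -ball_normE /= rnorm_lt.
have cv i : cvg (ev i @ F).
  apply: cauchy_cvg; apply/cauchyP => _ /gtc0E[e e0 ->].
  have K1 : 0 < K i + 1 by rewrite ltr_wpDl.
  have [|x Fxe] := Fx (e / (K i + 1)); first by rewrite divr_gt0.
  exists (ev i x); rewrite /nbhs/=; apply: filterS Fxe => y /= xy.
  rewrite -ball_normE /= rnorm_lt -evB (le_lt_trans (evb _ _))//.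
  rewrite (le_lt_trans (ler_wpM2l (K0 i) (ltW xy)))//.
  by rewrite mulrCA gtr_pMr// ltr_pdivrMr// mul1r ltrDl.
pose l i : W i := lim (ev i @ F).
have lx x (e : R) : F [set y | rnorm (x - y) < e] ->
    forall i, rnorm (l i - ev i x) <= K i * e.
  move=> Fxe i; apply/ler_addgt0Pl => d d0.
  have /cvgrPdist_lt/(_ d%:C%C) : ev i @ F --> l i by exact: cv.
  rewrite ltcR => /(_ d0) Fl.
  have [y [/= xy]] := filter_ex (filterI Fxe Fl).
  rewrite /= rnorm_lt => ly.
  rewrite (le_trans (rnormBD (ev i y) _ _))// lerD ?(ltW ly)//.
  rewrite -evB (le_trans (evb _ _))// ler_wpM2l// rnormB; exact: ltW.
have [v vl] : exists v, forall i, ev i v = l i.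
  apply: evc => e e0; have [x Fxe] := Fx _ e0.
  by exists x => i; exact: lx.
apply/cvg_ex; exists v; apply/cvgrPdist_lt => _ /gtc0E[e e0 ->].
have e20 : 0 < e / 2 by rewrite divr_gt0.
have [x Fxe] := Fx _ e20.
apply: filterS (Fxe) => y /= xy; rewrite rnorm_lt.
rewrite (le_lt_trans (rnormBD x _ _))// [e]splitr ler_ltD//.
apply: evn; first exact: ltW.
by move=> i; rewrite evB vl lx.
Qed.

Reserved Notation "x ** y" (at level 40, left associativity).

(* Algebras are not assumed to be unital, so GRing's algebra structures do not
   apply. *)
HB.mixin Record Lmodule_isStarAlgebra (R : realType) (A : Type)
    of GRing.Lmodule R[i] A := {
  smul : A -> A -> A;
  star : A -> A;
  smulA : associative smul;
  smulDl : left_distributive smul +%R;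
  smulDr : right_distributive smul +%R;
  smulZl : forall (k : R[i]) x y, smul (k *: x) y = k *: smul x y;
  smulZr : forall (k : R[i]) x y, smul x (k *: y) = k *: smul x y;
  starK : involutive star;
  starD : {morph star : x y / x + y};
  starZ : forall (k : R[i]) x, star (k *: x) = (k^*)%C *: star x;
  starM : forall x y, star (smul x y) = smul (star y) (star x)
}.

#[short(type="starAlgType")]
HB.structure Definition StarAlgebra (R : realType) :=
  {A of GRing.Lmodule R[i] A & Lmodule_isStarAlgebra R A}.

Notation "x ** y" := (smul x y) : ring_scope.

HB.mixin Record StarAlgebra_isNormed (R : realType) (A : Type)
    of NormedModule R[i] A & StarAlgebra R A := {
  normsM : forall x y : A, `|x ** y| <= `|x| * `|y|;
  norm_star : forall x : A, `|star x| = `|x|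
}.

#[short(type="normedStarAlgType")]
HB.structure Definition NormedStarAlgebra (R : realType) :=
  {A of NormedModule R[i] A & StarAlgebra R A & StarAlgebra_isNormed R A}.

HB.mixin Record NormedStarAlgebra_isCstar (R : realType) (A : Type)
    of NormedStarAlgebra R A := {
  cstar_identity : forall x : A, `|star x ** x| = `|x| ^+ 2
}.

#[short(type="cstarAlgType")]
HB.structure Definition CstarAlgebra (R : realType) :=
  {A of CompleteNormedModule R[i] A & NormedStarAlgebra R A
      & NormedStarAlgebra_isCstar R A}.

Section Theory.
Context (R : realType).

Section Star.
Context (A : starAlgType R).
Implicit Types x y : A.

Lemma smul0x x : 0 ** x = 0.
Proof. by rewrite -[X in X ** _](scale0r (0 : A)) smulZl scale0r. Qed.

Lemma smulx0 x : x ** 0 = 0.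
Proof. by rewrite -[X in _ ** X](scale0r (0 : A)) smulZr scale0r. Qed.

Lemma smulNl x y : (- x) ** y = - (x ** y).
Proof. by rewrite -scaleN1r smulZl scaleN1r. Qed.

Lemma smulNr x y : x ** (- y) = - (x ** y).
Proof. by rewrite -scaleN1r smulZr scaleN1r. Qed.

Lemma smulBl x y z : (x - y) ** z = x ** z - y ** z.
Proof. by rewrite smulDl smulNl. Qed.

Lemma smulBr x y z : x ** (y - z) = x ** y - x ** z.
Proof. by rewrite smulDr smulNr. Qed.

Lemma star0 : star (0 : A) = 0.
Proof. by rewrite -[X in star X](scale0r (0 : A)) starZ conjc0 scale0r. Qed.

Lemma starN x : star (- x) = - star x.
Proof. by rewrite -scaleN1r starZ rmorphN1 scaleN1r. Qed.

Lemma starB x y : star (x - y) = star x - star y.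
Proof. by rewrite starD starN. Qed.

End Star.

Lemma rnormM (A : normedStarAlgType R) (x y : A) :
  rnorm (x ** y) <= rnorm x * rnorm y.
Proof. by rewrite -rnorm_le rmorphM/= -!normE normsM. Qed.

Lemma rnorm_star (A : normedStarAlgType R) (x : A) : rnorm (star x) = rnorm x.
Proof. by rewrite /rnorm norm_star. Qed.

Lemma rnorm_cstar (A : cstarAlgType R) (x : A) :
  rnorm (star x ** x) = rnorm x ^+ 2.
Proof. by apply: complexI; rewrite -normE cstar_identity normE rmorphXn. Qed.

Lemma rnorm_le_mull (A : cstarAlgType R) (x : A) (e : R) : 0 <= e ->
  (forall b, rnorm (b ** x) <= rnorm b * e) -> rnorm x <= e.
Proof.
move=> e0 /(_ (star x)); rewrite rnorm_cstar rnorm_star expr2 => h.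
have := rnorm_ge0 x; rewrite le_eqVlt => /predU1P[<-//|x0].
by rewrite ler_pM2l in h.
Qed.

Lemma rnorm_le_mulr (A : cstarAlgType R) (x : A) (e : R) : 0 <= e ->
  (forall b, rnorm (x ** b) <= rnorm b * e) -> rnorm x <= e.
Proof.
move=> e0 h; rewrite -(rnorm_star x); apply: rnorm_le_mull => // b.
by rewrite -(starK b) -starM rnorm_star [in leRHS]rnorm_star h.
Qed.

End Theory.

Section C0Sum.
Context (R : realType) (A : nat -> cstarAlgType R).

Record c0_sum := C0Sum {
  c0_coord :> forall n, A n;
  c0_cvg : rnorm (c0_coord n) @[n --> \oo] --> (0 : R) }.

HB.instance Definition _ := gen_eqMixin c0_sum.
HB.instance Definition _ := gen_choiceMixin c0_sum.

Implicit Types x y z : c0_sum.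

Lemma c0_ext x y : (forall n, x n = y n) -> x = y.
Proof.
case: x y => [x px] [y py] /= xy.
have {}xy : x = y by apply: functional_extensionality_dep.
by rewrite -{y}xy in py *; rewrite (Prop_irrelevance px py).
Qed.

Lemma c0_dom (f : forall n, A n) (u : nat -> R) :
  u @ \oo --> (0 : R) -> (forall n, rnorm (f n) <= u n) ->
  rnorm (f n) @[n --> \oo] --> (0 : R).
Proof.
move=> u0 fu; apply: (squeeze_cvgr _ (cvg_cst 0) u0).
by near=> n; rewrite rnorm_ge0 fu.
Unshelve. all: by end_near. Qed.

Fact c0_zero_cvg : rnorm (0 : A n) @[n --> \oo] --> (0 : R).
Proof.
by apply: (@c0_dom _ (cst 0)) => [|n]; [exact: cvg_cst|rewrite rnorm0].
Qed.

Fact c0_opp_cvg x : rnorm (- x n) @[n --> \oo] --> (0 : R).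
Proof. by apply: c0_dom (c0_cvg x) _ => n; rewrite rnormN. Qed.

Fact c0_add_cvg x y : rnorm (x n + y n) @[n --> \oo] --> (0 : R).
Proof.
apply: (c0_dom (u := fun n => rnorm (x n) + rnorm (y n))) => [|n].
  by rewrite -[X in _ --> X]addr0; apply: cvgD; exact: c0_cvg.
exact: rnormD.
Qed.

Fact c0_scale_cvg (k : R[i]) x : rnorm (k *: x n) @[n --> \oo] --> (0 : R).
Proof.
apply: (c0_dom (u := fun n => Normc.normc k * rnorm (x n))) => [|n].
  by rewrite -[X in _ --> X](mulr0 (Normc.normc k)); apply: cvgMr; exact: c0_cvg.
by rewrite rnormZ.
Qed.

Fact c0_mul_cvg x y : rnorm (x n ** y n) @[n --> \oo] --> (0 : R).
Proof.
apply: (c0_dom (u := fun n => rnorm (x n) * rnorm (y n))) => [|n].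
  by rewrite -[X in _ --> X](mulr0 0); apply: cvgM; exact: c0_cvg.
exact: rnormM.
Qed.

Fact c0_star_cvg x : rnorm (star (x n)) @[n --> \oo] --> (0 : R).
Proof. by apply: c0_dom (c0_cvg x) _ => n; rewrite rnorm_star. Qed.

Definition c0_zero := C0Sum c0_zero_cvg.
Definition c0_opp x := C0Sum (c0_opp_cvg x).
Definition c0_add x y := C0Sum (c0_add_cvg x y).
Definition c0_scale (k : R[i]) x := C0Sum (c0_scale_cvg k x).
Definition c0_mul x y := C0Sum (c0_mul_cvg x y).
Definition c0_star x := C0Sum (c0_star_cvg x).

Fact c0_addA : associative c0_add.
Proof. by move=> x y z; apply: c0_ext => n /=; rewrite addrA. Qed.
Fact c0_addC : commutative c0_add.
Proof. by move=> x y; apply: c0_ext => n /=; rewrite addrC. Qed.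
Fact c0_add0 : left_id c0_zero c0_add.
Proof. by move=> x; apply: c0_ext => n /=; rewrite add0r. Qed.
Fact c0_addN : left_inverse c0_zero c0_opp c0_add.
Proof. by move=> x; apply: c0_ext => n /=; rewrite addNr. Qed.

HB.instance Definition _ :=
  GRing.isZmodule.Build c0_sum c0_addA c0_addC c0_add0 c0_addN.

Fact c0_scaleA (a b : R[i]) x : c0_scale a (c0_scale b x) = c0_scale (a * b) x.
Proof. by apply: c0_ext => n /=; rewrite scalerA. Qed.
Fact c0_scale1 : left_id 1 c0_scale.
Proof. by move=> x; apply: c0_ext => n /=; rewrite scale1r. Qed.
Fact c0_scaleDr : right_distributive c0_scale +%R.
Proof. by move=> k x y; apply: c0_ext => n /=; rewrite scalerDr. Qed.
Fact c0_scaleDl x : {morph c0_scale^~ x : a b / a + b}.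
Proof. by move=> a b; apply: c0_ext => n /=; rewrite scalerDl. Qed.

HB.instance Definition _ := GRing.Zmodule_isLmodule.Build R[i] c0_sum
  c0_scaleA c0_scale1 c0_scaleDr c0_scaleDl.

Fact c0_mulA : associative c0_mul.
Proof. by move=> x y z; apply: c0_ext => n /=; rewrite smulA. Qed.
Fact c0_mulDl : left_distributive c0_mul +%R.
Proof. by move=> x y z; apply: c0_ext => n /=; rewrite smulDl. Qed.
Fact c0_mulDr : right_distributive c0_mul +%R.
Proof. by move=> x y z; apply: c0_ext => n /=; rewrite smulDr. Qed.
Fact c0_mulZl (k : R[i]) x y : c0_mul (k *: x) y = k *: c0_mul x y.
Proof. by apply: c0_ext => n /=; rewrite smulZl. Qed.
Fact c0_mulZr (k : R[i]) x y : c0_mul x (k *: y) = k *: c0_mul x y.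
Proof. by apply: c0_ext => n /=; rewrite smulZr. Qed.
Fact c0_starK : involutive c0_star.
Proof. by move=> x; apply: c0_ext => n /=; rewrite starK. Qed.
Fact c0_starD : {morph c0_star : x y / x + y}.
Proof. by move=> x y; apply: c0_ext => n /=; rewrite starD. Qed.
Fact c0_starZ (k : R[i]) x : c0_star (k *: x) = (k^*)%C *: c0_star x.
Proof. by apply: c0_ext => n /=; rewrite starZ. Qed.
Fact c0_starM x y : c0_star (c0_mul x y) = c0_mul (c0_star y) (c0_star x).
Proof. by apply: c0_ext => n /=; rewrite starM. Qed.

HB.instance Definition _ := Lmodule_isStarAlgebra.Build R c0_sum
  c0_mulA c0_mulDl c0_mulDr c0_mulZl c0_mulZr c0_starK c0_starD c0_starZ c0_starM.

Definition c0_norm x : R := sup (range (fun n => rnorm (x n))).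

Lemma c0_norm_ub x : has_ubound (range (fun n => rnorm (x n))).
Proof.
have /cvg_seq_bounded : cvgn (fun n => rnorm (x n)) by apply/cvg_ex; exists 0; exact: c0_cvg.
move=> [M [_ /(_ (M + 1))]]; rewrite ltrDl => /(_ ltr01) h.
by exists (M + 1) => _ [n _ <-]; rewrite (le_trans (ler_norm _))// h.
Qed.

Lemma c0_norm_coord x n : rnorm (x n) <= c0_norm x.
Proof. by apply: ub_le_sup; [exact: c0_norm_ub|exists n]. Qed.

Lemma c0_norm_le x e : (forall n, rnorm (x n) <= e) -> c0_norm x <= e.
Proof.
by move=> h; apply: ge_sup => [|_ [n _ <-]//]; exists (rnorm (x 0%N)); exists 0%N.
Qed.

Lemma c0_norm_ge0 x : 0 <= c0_norm x.
Proof. exact: le_trans (rnorm_ge0 _) (c0_norm_coord x 0%N). Qed.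

Fact c0_normD x y : (c0_norm (x + y))%:C%C <= (c0_norm x)%:C%C + (c0_norm y)%:C%C.
Proof.
rewrite -rmorphD lecR; apply: c0_norm_le => n.
by rewrite (le_trans (rnormD _ _))// lerD// c0_norm_coord.
Qed.

Fact c0_normZ (k : R[i]) x : (c0_norm (k *: x))%:C%C = `|k| * (c0_norm x)%:C%C.
Proof.
have le (l : R[i]) z : c0_norm (l *: z) <= Normc.normc l * c0_norm z.
  apply: c0_norm_le => n /=; rewrite rnormZ ler_wpM2l ?c0_norm_coord//.
  by rewrite -ler0c -[leRHS]/(`|l|).
rewrite -[`|k|]/((Normc.normc k)%:C%C) -rmorphM; congr (_%:C%C).
apply/eqP; rewrite eq_le le/=.
have [->|k0] := eqVneq k 0.
  by rewrite Normc.normc0 mul0r c0_norm_ge0.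
have nk : 0 < Normc.normc k by rewrite -ltcR -[ltRHS]/(`|k|) normr_gt0.
rewrite mulrC -ler_pdivlMr// mulrC -[leLHS]/(c0_norm x) -[in leLHS](scale1r x) -(mulVf k0) -scalerA.
by rewrite -Normc.normcV le.
Qed.

Fact c0_norm0_eq0 x : (c0_norm x)%:C%C = 0 -> x = 0.
Proof.
move=> /complexI x0; apply: c0_ext => n /=; apply: rnorm0_eq0; apply/eqP.
by rewrite eq_le rnorm_ge0 andbT -x0 c0_norm_coord.
Qed.

HB.instance Definition _ := Lmodule_isNormed.Build R[i] c0_sum
  c0_normD c0_normZ c0_norm0_eq0.

Lemma c0_rnormE x : rnorm x = c0_norm x. Proof. by []. Qed.

Fact c0_normM x y : `|x ** y| <= `|x| * `|y|.
Proof.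
rewrite !normE -rmorphM lecR !c0_rnormE; apply: c0_norm_le => n.
rewrite (le_trans (rnormM _ _))// ler_pM ?rnorm_ge0 ?c0_norm_coord//.
Qed.

Fact c0_norm_star x : `|star x| = `|x|.
Proof.
rewrite !normE; congr (_%:C%C); congr (sup _); apply: eq_imagel => n _ /=.
by rewrite rnorm_star.
Qed.

HB.instance Definition _ :=
  StarAlgebra_isNormed.Build R c0_sum c0_normM c0_norm_star.

Fact c0_cstar x : `|star x ** x| = `|x| ^+ 2.
Proof.
apply/eqP; rewrite eq_le (le_trans (normsM _ _)) ?norm_star ?expr2//=.
rewrite -expr2 !normE -rmorphXn lecR !c0_rnormE.
rewrite -[leRHS]sqr_sqrtr ?c0_norm_ge0// ler_sqr ?nnegrE ?sqrtr_ge0 ?c0_norm_ge0//.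
apply: c0_norm_le => n; rewrite -ler_sqr ?nnegrE ?rnorm_ge0 ?sqrtr_ge0//.
by rewrite sqr_sqrtr ?c0_norm_ge0// -rnorm_cstar (c0_norm_coord (star x ** x) n).
Qed.

Fact c0_complete (F : set_system c0_sum) : ProperFilter F -> cauchy F -> cvg F.
Proof.
apply: (@complete_ev R c0_sum nat A (fun n x => x n) (cst 1)) => //=.
- by move=> n x; rewrite mul1r c0_norm_coord.
- move=> x e e0 h; apply: c0_norm_le => n; have := h n; by rewrite mul1r.
- move=> l h; suff lc : rnorm (l n) @[n --> \oo] --> (0 : R) by exists (C0Sum lc).
  apply/cvgrPdist_le => e e0; have e20 : 0 < e / 2 by rewrite divr_gt0.
  have [x xl] := h _ e20.
  have /cvgrPdist_le/(_ _ e20) := c0_cvg x.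
  apply: filterS => n; rewrite !sub0r !normrN !ger0_norm ?rnorm_ge0// => xn.
  have := xl n; rewrite mul1r => xln.
  rewrite -[l n](subrK (x n)) (le_trans (rnormD _ _))//.
  by rewrite [e]splitr lerD.
Qed.

HB.instance Definition _ := Uniform_isComplete.Build c0_sum c0_complete.
HB.instance Definition _ := NormedStarAlgebra_isCstar.Build R c0_sum c0_cstar.

End C0Sum.

#[local] Obligation Tactic := idtac.

Section Multiplier.
Context (R : realType) (A : cstarAlgType R).

(* The multiplier algebra, realized as the algebra of double centralizers. *)
Record multiplier := Multiplier {
  lmult : A -> A;
  rmult : A -> A;
  lmult_linear : linear lmult;
  rmult_linear : linear rmult;
  lmult_bounded : exists M : R, forall a, rnorm (lmult a) <= M * rnorm a;
  rmult_bounded : exists M : R, forall a, rnorm (rmult a) <= M * rnorm a;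
  lmultM : forall a b, lmult (a ** b) = lmult a ** b;
  rmultM : forall a b, rmult (a ** b) = a ** rmult b;
  multE : forall a b, rmult a ** b = a ** lmult b }.

HB.instance Definition _ := gen_eqMixin multiplier.
HB.instance Definition _ := gen_choiceMixin multiplier.

Implicit Types x y z : multiplier.

Lemma mult_ext x y : lmult x =1 lmult y -> rmult x =1 rmult y -> x = y.
Proof.
case: x y => [l r p1 p2 p3 p4 p5 p6 p7] [l' r' q1 q2 q3 q4 q5 q6 q7] /=.
move=> /funext el /funext er.
rewrite -{l'}el in q1 q3 q5 q7 *; rewrite -{r'}er in q2 q4 q6 q7 *.
by congr Multiplier; exact: Prop_irrelevance.
Qed.

Lemma linearPD (f : A -> A) : linear f -> {morph f : a b / a + b}.
Proof. by move=> lf a b; have := lf 1 a b; rewrite !scale1r. Qed.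

Lemma linearP0 (f : A -> A) : linear f -> f 0 = 0.
Proof.
by move=> lf; have /eqP := linearPD lf 0 0; rewrite addr0 addrC -subr_eq subrr eq_sym => /eqP.
Qed.

Lemma linearPZ (f : A -> A) (k : R[i]) a : linear f -> f (k *: a) = k *: f a.
Proof. by move=> lf; have := lf k a 0; rewrite !addr0 linearP0 ?addr0. Qed.

Lemma linearPB (f : A -> A) a b : linear f -> f (a - b) = f a - f b.
Proof. by move=> lf; rewrite -scaleN1r addrC lf scaleN1r addrC. Qed.

Lemma bounded_pos (f : A -> A) :
  (exists M : R, forall a, rnorm (f a) <= M * rnorm a) ->
  exists2 M : R, 0 <= M & forall a, rnorm (f a) <= M * rnorm a.
Proof.
move=> [M fM]; exists `|M| => // a; rewrite (le_trans (fM a))//.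
by rewrite ler_wpM2r ?rnorm_ge0 ?ler_norm.
Qed.

Program Definition mult_zero : multiplier :=
  @Multiplier (cst 0) (cst 0) _ _ _ _ _ _ _.
Next Obligation. by move=> k a b /=; rewrite scaler0 addr0. Qed.
Next Obligation. by move=> k a b /=; rewrite scaler0 addr0. Qed.
Next Obligation. by exists 0 => a; rewrite rnorm0 mul0r. Qed.
Next Obligation. by exists 0 => a; rewrite rnorm0 mul0r. Qed.
Next Obligation. by move=> a b /=; rewrite smul0x. Qed.
Next Obligation. by move=> a b /=; rewrite smulx0. Qed.
Next Obligation. by move=> a b /=; rewrite smul0x smulx0. Qed.

Lemma scaled_linear (k : R[i]) (f : A -> A) : linear f -> linear (fun a => k *: f a).
Proof. by move=> lf h a b; rewrite lf scalerDr !scalerA mulrC. Qed.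

Lemma scaled_bounded (k : R[i]) (f : A -> A) :
  (exists M : R, forall a, rnorm (f a) <= M * rnorm a) ->
  exists M : R, forall a, rnorm (k *: f a) <= M * rnorm a.
Proof.
move=> [M fM]; exists (Normc.normc k * M) => a; rewrite rnormZ -mulrA ler_wpM2l//.
by rewrite -ler0c -[leRHS]/(`|k|).
Qed.

Program Definition mult_scale (k : R[i]) x : multiplier :=
  @Multiplier (fun a => k *: lmult x a) (fun a => k *: rmult x a) _ _ _ _ _ _ _.
Next Obligation. by move=> k x; apply: scaled_linear; exact: lmult_linear. Qed.
Next Obligation. by move=> k x; apply: scaled_linear; exact: rmult_linear. Qed.
Next Obligation. by move=> k x; apply: scaled_bounded; exact: lmult_bounded. Qed.
Next Obligation. by move=> k x; apply: scaled_bounded; exact: rmult_bounded. Qed.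
Next Obligation. by move=> k x a b /=; rewrite lmultM smulZl. Qed.
Next Obligation. by move=> k x a b /=; rewrite rmultM smulZr. Qed.
Next Obligation. by move=> k x a b /=; rewrite smulZl smulZr multE. Qed.

Lemma add_linear (f g : A -> A) : linear f -> linear g -> linear (fun a => f a + g a).
Proof. by move=> lf lg h a b; rewrite lf lg scalerDr addrACA. Qed.

Lemma add_bounded (f g : A -> A) :
  (exists M : R, forall a, rnorm (f a) <= M * rnorm a) ->
  (exists M : R, forall a, rnorm (g a) <= M * rnorm a) ->
  exists M : R, forall a, rnorm (f a + g a) <= M * rnorm a.
Proof.
move=> [M fM] [N gN]; exists (M + N) => a.
by rewrite (le_trans (rnormD _ _))// mulrDl lerD.
Qed.

Program Definition mult_add x y : multiplier :=
  @Multiplier (fun a => lmult x a + lmult y a) (fun a => rmult x a + rmult y a)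
    _ _ _ _ _ _ _.
Next Obligation. by move=> x y; apply: add_linear; exact: lmult_linear. Qed.
Next Obligation. by move=> x y; apply: add_linear; exact: rmult_linear. Qed.
Next Obligation. by move=> x y; apply: add_bounded; exact: lmult_bounded. Qed.
Next Obligation. by move=> x y; apply: add_bounded; exact: rmult_bounded. Qed.
Next Obligation. by move=> x y a b /=; rewrite !lmultM smulDl. Qed.
Next Obligation. by move=> x y a b /=; rewrite !rmultM smulDr. Qed.
Next Obligation. by move=> x y a b /=; rewrite smulDl smulDr !multE. Qed.

Definition mult_opp x := mult_scale (-1) x.

Lemma comp_linear (f g : A -> A) : linear f -> linear g -> linear (f \o g).
Proof. by move=> lf lg h a b /=; rewrite lg lf. Qed.

Lemma comp_bounded (f g : A -> A) :
  (exists M : R, forall a, rnorm (f a) <= M * rnorm a) ->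
  (exists M : R, forall a, rnorm (g a) <= M * rnorm a) ->
  exists M : R, forall a, rnorm ((f \o g) a) <= M * rnorm a.
Proof.
move=> /bounded_pos[M M0 fM] [N gN]; exists (M * N) => a /=.
by rewrite (le_trans (fM _))// -mulrA ler_wpM2l.
Qed.

Program Definition mult_mul x y : multiplier :=
  @Multiplier (lmult x \o lmult y) (rmult y \o rmult x) _ _ _ _ _ _ _.
Next Obligation. by move=> x y; apply: comp_linear; exact: lmult_linear. Qed.
Next Obligation. by move=> x y; apply: comp_linear; exact: rmult_linear. Qed.
Next Obligation. by move=> x y; apply: comp_bounded; exact: lmult_bounded. Qed.
Next Obligation. by move=> x y; apply: comp_bounded; exact: rmult_bounded. Qed.
Next Obligation. by move=> x y a b /=; rewrite !lmultM. Qed.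
Next Obligation. by move=> x y a b /=; rewrite !rmultM. Qed.
Next Obligation. by move=> x y a b /=; rewrite !multE. Qed.

Lemma star_linear (f : A -> A) : linear f -> linear (fun a => star (f (star a))).
Proof. by move=> lf h a b; rewrite starD starZ lf starD starZ conjcK. Qed.

Lemma star_bounded (f : A -> A) :
  (exists M : R, forall a, rnorm (f a) <= M * rnorm a) ->
  exists M : R, forall a, rnorm (star (f (star a))) <= M * rnorm a.
Proof.
by move=> [M fM]; exists M => a; rewrite rnorm_star (le_trans (fM _))// rnorm_star.
Qed.

Program Definition mult_star x : multiplier :=
  @Multiplier (fun a => star (rmult x (star a))) (fun a => star (lmult x (star a)))
    _ _ _ _ _ _ _.
Next Obligation. by move=> x; apply: star_linear; exact: rmult_linear. Qed.
Next Obligation. by move=> x; apply: star_linear; exact: lmult_linear. Qed.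
Next Obligation. by move=> x; apply: star_bounded; exact: rmult_bounded. Qed.
Next Obligation. by move=> x; apply: star_bounded; exact: lmult_bounded. Qed.
Next Obligation. by move=> x a b /=; rewrite starM rmultM starM starK. Qed.
Next Obligation. by move=> x a b /=; rewrite starM lmultM starM starK. Qed.
Next Obligation.
by move=> x a b /=; rewrite -[b in LHS]starK -starM -multE starM starK.
Qed.

Fact mult_addA : associative mult_add.
Proof. by move=> x y z; apply: mult_ext => a /=; rewrite addrA. Qed.
Fact mult_addC : commutative mult_add.
Proof. by move=> x y; apply: mult_ext => a /=; rewrite addrC. Qed.
Fact mult_add0 : left_id mult_zero mult_add.
Proof. by move=> x; apply: mult_ext => a /=; rewrite add0r. Qed.
Fact mult_addN : left_inverse mult_zero mult_opp mult_add.
Proof. by move=> x; apply: mult_ext => a /=; rewrite scaleN1r addNr. Qed.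

HB.instance Definition _ :=
  GRing.isZmodule.Build multiplier mult_addA mult_addC mult_add0 mult_addN.

Fact mult_scaleA (a b : R[i]) x : mult_scale a (mult_scale b x) = mult_scale (a * b) x.
Proof. by apply: mult_ext => n /=; rewrite scalerA. Qed.
Fact mult_scale1 : left_id 1 mult_scale.
Proof. by move=> x; apply: mult_ext => n /=; rewrite scale1r. Qed.
Fact mult_scaleDr : right_distributive mult_scale +%R.
Proof. by move=> k x y; apply: mult_ext => n /=; rewrite scalerDr. Qed.
Fact mult_scaleDl x : {morph mult_scale^~ x : a b / a + b}.
Proof. by move=> a b; apply: mult_ext => n /=; rewrite scalerDl. Qed.

HB.instance Definition _ := GRing.Zmodule_isLmodule.Build R[i] multiplier
  mult_scaleA mult_scale1 mult_scaleDr mult_scaleDl.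

Fact mult_mulA : associative mult_mul.
Proof. by move=> x y z; exact: mult_ext. Qed.
Fact mult_mulDl : left_distributive mult_mul +%R.
Proof.
move=> x y z; apply: mult_ext => a //=; by rewrite linearPD//; exact: rmult_linear.
Qed.
Fact mult_mulDr : right_distributive mult_mul +%R.
Proof.
move=> x y z; apply: mult_ext => a //=; by rewrite linearPD//; exact: lmult_linear.
Qed.
Fact mult_mulZl (k : R[i]) x y : mult_mul (k *: x) y = k *: mult_mul x y.
Proof. apply: mult_ext => a //=; by rewrite linearPZ//; exact: rmult_linear. Qed.
Fact mult_mulZr (k : R[i]) x y : mult_mul x (k *: y) = k *: mult_mul x y.
Proof. apply: mult_ext => a //=; by rewrite linearPZ//; exact: lmult_linear. Qed.
Fact mult_starK : involutive mult_star.
Proof. by move=> x; apply: mult_ext => a /=; rewrite !starK. Qed.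
Fact mult_starD : {morph mult_star : x y / x + y}.
Proof. by move=> x y; apply: mult_ext => a /=; rewrite starD. Qed.
Fact mult_starZ (k : R[i]) x : mult_star (k *: x) = (k^*)%C *: mult_star x.
Proof. by apply: mult_ext => a /=; rewrite starZ. Qed.
Fact mult_starM x y : mult_star (mult_mul x y) = mult_mul (mult_star y) (mult_star x).
Proof. by apply: mult_ext => a /=; rewrite starK. Qed.

HB.instance Definition _ := Lmodule_isStarAlgebra.Build R multiplier
  mult_mulA mult_mulDl mult_mulDr mult_mulZl mult_mulZr
  mult_starK mult_starD mult_starZ mult_starM.

(* The operator norm of the left component; it equals that of the right one. *)
Definition mult_norm x : R :=
  sup [set rnorm (lmult x a) | a in [set a | rnorm a <= 1]].

Lemma mult_norm_ub x :
  has_ubound [set rnorm (lmult x a) | a in [set a | rnorm a <= 1]].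
Proof.
have [M M0 xM] := bounded_pos (lmult_bounded x).
by exists M => _ [a /= a1 <-]; rewrite (le_trans (xM a))// ler_piMr.
Qed.

Lemma mult_norm_ge0 x : 0 <= mult_norm x.
Proof.
apply: le_trans (rnorm_ge0 (lmult x 0)) _; apply: ub_le_sup (mult_norm_ub x) _ _.
by exists 0 => //=; rewrite rnorm0.
Qed.

Lemma normc_real (r : R) : 0 <= r -> Normc.normc (r%:C%C) = r.
Proof. by move=> r0; apply: complexI; rewrite -[LHS]/(`|r%:C%C|) ger0_norm ?ler0c. Qed.

Lemma mult_normP x a : rnorm (lmult x a) <= rnorm a * mult_norm x.
Proof.
have := rnorm_ge0 a; rewrite le_eqVlt => /predU1P[/esym a0|a0].
  by rewrite (rnorm0_eq0 a0) linearP0 ?rnorm0 ?mul0r//; exact: lmult_linear.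
rewrite mulrC -ler_pdivrMr// mulrC.
have ai : 0 <= (rnorm a)^-1 by rewrite invr_ge0 ltW.
rewrite -[X in X * _](normc_real ai) -rnormZ -linearPZ; last exact: lmult_linear.
apply: ub_le_sup (mult_norm_ub x) _ _; exists ((rnorm a)^-1%:C%C *: a) => //=.
by rewrite rnormZ normc_real// mulVf ?gt_eqF.
Qed.

Lemma mult_norm_le x e : 0 <= e ->
  (forall a, rnorm (lmult x a) <= rnorm a * e) -> mult_norm x <= e.
Proof.
move=> e0 xe; apply: ge_sup.
  by exists (rnorm (lmult x 0)); exists 0 => //=; rewrite rnorm0.
by move=> _ [a /= a1 <-]; rewrite (le_trans (xe a))// ler_piMl.
Qed.

Lemma mult_normPr x a : rnorm (rmult x a) <= rnorm a * mult_norm x.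
Proof.
apply: rnorm_le_mulr => [|b]; first by rewrite mulr_ge0 ?rnorm_ge0 ?mult_norm_ge0.
rewrite multE (le_trans (rnormM _ _))// mulrCA ler_wpM2l ?rnorm_ge0//.
exact: mult_normP.
Qed.

Fact mult_normD x y : (mult_norm (x + y))%:C%C <= (mult_norm x)%:C%C + (mult_norm y)%:C%C.
Proof.
rewrite -rmorphD lecR; apply: mult_norm_le => [|a].
  by rewrite addr_ge0 ?mult_norm_ge0.
by rewrite (le_trans (rnormD _ _))// mulrDr lerD// mult_normP.
Qed.

Fact mult_normZ (k : R[i]) x : (mult_norm (k *: x))%:C%C = `|k| * (mult_norm x)%:C%C.
Proof.
have n0 (l : R[i]) : 0 <= Normc.normc l by rewrite -ler0c -[leRHS]/(`|l|).
have le (l : R[i]) z : mult_norm (l *: z) <= Normc.normc l * mult_norm z.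
  apply: mult_norm_le => [|a /=]; first by rewrite mulr_ge0 ?mult_norm_ge0.
  by rewrite rnormZ mulrCA ler_wpM2l ?mult_normP.
rewrite -[`|k|]/((Normc.normc k)%:C%C) -rmorphM; congr (_%:C%C).
apply/eqP; rewrite eq_le le/=.
have [->|k0] := eqVneq k 0.
  by rewrite Normc.normc0 mul0r mult_norm_ge0.
have nk : 0 < Normc.normc k by rewrite -ltcR -[ltRHS]/(`|k|) normr_gt0.
rewrite mulrC -ler_pdivlMr// mulrC -[in leLHS](scale1r x) -(mulVf k0) -scalerA.
by rewrite -Normc.normcV le.
Qed.

Fact mult_norm0_eq0 x : (mult_norm x)%:C%C = 0 -> x = 0.
Proof.
move=> /complexI x0; apply: mult_ext => a /=; apply: rnorm0_eq0; apply/eqP.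
  by rewrite eq_le rnorm_ge0 andbT (le_trans (mult_normP _ _))// x0 mulr0.
by rewrite eq_le rnorm_ge0 andbT (le_trans (mult_normPr _ _))// x0 mulr0.
Qed.

HB.instance Definition _ := Lmodule_isNormed.Build R[i] multiplier
  mult_normD mult_normZ mult_norm0_eq0.

Lemma mult_rnormE x : rnorm x = mult_norm x. Proof. by []. Qed.

Fact mult_normM x y : `|x ** y| <= `|x| * `|y|.
Proof.
rewrite !normE -rmorphM lecR !mult_rnormE; apply: mult_norm_le => [|a /=].
  by rewrite mulr_ge0 ?mult_norm_ge0.
rewrite (le_trans (mult_normP _ _))// mulrCA [leRHS]mulrC.
by rewrite ler_wpM2r ?mult_norm_ge0 ?mult_normP.
Qed.

Fact mult_norm_star x : `|star x| = `|x|.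
Proof.
have le z : mult_norm (star z) <= mult_norm z.
  apply: mult_norm_le (mult_norm_ge0 z) _ => a /=.
  by rewrite rnorm_star (le_trans (mult_normPr _ _))// rnorm_star.
rewrite !normE; congr (_%:C%C); rewrite !mult_rnormE; apply/eqP.
by rewrite eq_le le -[in leLHS](starK x) le.
Qed.

HB.instance Definition _ :=
  StarAlgebra_isNormed.Build R multiplier mult_normM mult_norm_star.

Fact mult_cstar x : `|star x ** x| = `|x| ^+ 2.
Proof.
apply/eqP; rewrite eq_le (le_trans (normsM _ _)) ?norm_star ?expr2//=.
rewrite -expr2 !normE -rmorphXn lecR !mult_rnormE.
set N := mult_norm (star x ** x); have N0 : 0 <= N := mult_norm_ge0 _.
rewrite -[leRHS]sqr_sqrtr// ler_sqr ?nnegrE ?sqrtr_ge0 ?mult_norm_ge0//.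
apply: mult_norm_le; first exact: sqrtr_ge0.
move=> a; rewrite -ler_sqr ?nnegrE ?rnorm_ge0 ?mulr_ge0 ?rnorm_ge0 ?sqrtr_ge0//.
rewrite exprMn sqr_sqrtr// -rnorm_cstar.
have -> : star (lmult x a) ** lmult x a = star a ** lmult (star x ** x) a.
  by rewrite -[RHS]/(star a ** lmult (star x) (lmult x a)) -(multE (star x)) /= starK.
rewrite (le_trans (rnormM _ _))// rnorm_star expr2 -mulrA ler_wpM2l ?rnorm_ge0//.
exact: mult_normP.
Qed.

Fact mult_complete (F : set_system multiplier) : ProperFilter F -> cauchy F -> cvg F.
Proof.
pose ev (i : bool * A) (x : multiplier) := if i.1 then lmult x i.2 else rmult x i.2.
apply: (@complete_ev R multiplier (bool * A)%type (fun=> A) ev (fun i => rnorm i.2)).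
- by move=> i; exact: rnorm_ge0.
- by move=> [[] a] x y; rewrite /ev /= scaleN1r.
- by move=> [[] a] x; rewrite /ev /=; [exact: mult_normP|exact: mult_normPr].
- by move=> x e e0 h; apply: mult_norm_le => // a; exact: (h (true, a)).
move=> l h; pose L a := l (true, a); pose T a := l (false, a).
have hL e : 0 < e -> exists x, (forall a, rnorm (L a - lmult x a) <= rnorm a * e) /\
    (forall a, rnorm (T a - rmult x a) <= rnorm a * e).
  move=> /h[x hx]; exists x; split => a; first exact: (hx (true, a)).
  exact: (hx (false, a)).
have lin (f : A -> A) :
    (forall e, 0 < e -> exists2 g, linear g & forall a, rnorm (f a - g a) <= rnorm a * e) ->
    linear f.
  move=> hf k a b.
  apply: (@rnorm_eq _ _ (rnorm (k *: a + b) + rnorm (k *: a) + rnorm b)) => e e0.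
  have [g lg fg] := hf _ e0.
  rewrite (le_trans (rnormBD (g (k *: a + b)) _ _))// -addrA mulrDl lerD//.
  rewrite lg opprD addrACA -scalerBr (le_trans (rnormD _ _))// mulrDl lerD//.
    rewrite !rnormZ -mulrA ler_wpM2l 1?rnormB//.
    by rewrite -ler0c -[leRHS]/(`|k|).
  by rewrite rnormB.
have bnd (f : A -> A) :
    (forall e, 0 < e -> exists2 g,
      (exists M : R, forall a, rnorm (g a) <= M * rnorm a) &
      forall a, rnorm (f a - g a) <= rnorm a * e) ->
    exists M : R, forall a, rnorm (f a) <= M * rnorm a.
  move=> /(_ _ ltr01)[g [M gM] fg]; exists (1 + M) => a.
  rewrite -[f a](subrK (g a)) (le_trans (rnormD _ _))// mulrDl mul1r lerD//.
  by rewrite (le_trans (fg a))// mulr1.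
have p1 : linear L.
  apply: lin => e /hL[x [hx _]]; exists (lmult x) => //; exact: lmult_linear.
have p2 : linear T.
  apply: lin => e /hL[x [_ hx]]; exists (rmult x) => //; exact: rmult_linear.
have p3 : exists M : R, forall a, rnorm (L a) <= M * rnorm a.
  apply: bnd => e /hL[x [hx _]]; exists (lmult x) => //; exact: lmult_bounded.
have p4 : exists M : R, forall a, rnorm (T a) <= M * rnorm a.
  apply: bnd => e /hL[x [_ hx]]; exists (rmult x) => //; exact: rmult_bounded.
have p5 a b : L (a ** b) = L a ** b.
  apply: (@rnorm_eq _ _ (rnorm (a ** b) + rnorm a * rnorm b)) => e /hL[x [hx _]].
  rewrite (le_trans (rnormBD (lmult x (a ** b)) _ _))// mulrDl lerD//.
  rewrite lmultM -smulBl (le_trans (rnormM _ _))// mulrAC ler_wpM2r ?rnorm_ge0//.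
  by rewrite rnormB.
have p6 a b : T (a ** b) = a ** T b.
  apply: (@rnorm_eq _ _ (rnorm (a ** b) + rnorm a * rnorm b)) => e /hL[x [_ hx]].
  rewrite (le_trans (rnormBD (rmult x (a ** b)) _ _))// mulrDl lerD//.
  rewrite rmultM -smulBr (le_trans (rnormM _ _))// -mulrA ler_wpM2l ?rnorm_ge0//.
  by rewrite rnormB.
have p7 a b : T a ** b = a ** L b.
  apply: (@rnorm_eq _ _ (rnorm a * rnorm b + rnorm a * rnorm b)) => e /hL[x [hx hx']].
  rewrite (le_trans (rnormBD (rmult x a ** b) _ _))// mulrDl lerD//.
    rewrite -smulBl (le_trans (rnormM _ _))// mulrAC ler_wpM2r ?rnorm_ge0//.
  rewrite multE -smulBr (le_trans (rnormM _ _))// -mulrA ler_wpM2l ?rnorm_ge0//.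
  by rewrite rnormB.
by exists (Multiplier p1 p2 p3 p4 p5 p6 p7) => -[[] a].
Qed.

HB.instance Definition _ := Uniform_isComplete.Build multiplier mult_complete.
HB.instance Definition _ := NormedStarAlgebra_isCstar.Build R multiplier mult_cstar.

Program Definition mult_embed (a : A) : multiplier :=
  @Multiplier (fun b => a ** b) (fun b => b ** a) _ _ _ _ _ _ _.
Next Obligation. by move=> a k b c /=; rewrite smulDr smulZr. Qed.
Next Obligation. by move=> a k b c /=; rewrite smulDl smulZl. Qed.
Next Obligation. by move=> a; exists (rnorm a) => b /=; exact: rnormM. Qed.
Next Obligation. by move=> a; exists (rnorm a) => b /=; rewrite mulrC; exact: rnormM. Qed.
Next Obligation. by move=> a b c /=; rewrite smulA. Qed.
Next Obligation. by move=> a b c /=; rewrite smulA. Qed.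
Next Obligation. by move=> a b c /=; rewrite smulA. Qed.

End Multiplier.

Local Open Scope quotient_scope.

Section Corona.
Context (R : realType) (A : cstarAlgType R).

Lemma mult_embedD (a b : A) : mult_embed (a + b) = mult_embed a + mult_embed b.
Proof. by apply: mult_ext => c /=; rewrite (smulDl, smulDr). Qed.

Lemma mult_embedZ (k : R[i]) (a : A) : mult_embed (k *: a) = k *: mult_embed a.
Proof. by apply: mult_ext => c /=; rewrite (smulZl, smulZr). Qed.

Lemma mult_embedN (a : A) : mult_embed (- a) = - mult_embed a.
Proof. by rewrite -scaleN1r mult_embedZ scaleN1r. Qed.

Lemma mult_embedB (a b : A) : mult_embed (a - b) = mult_embed a - mult_embed b.
Proof. by rewrite mult_embedD mult_embedN. Qed.

Lemma mult_embed_star (a : A) : mult_embed (star a) = star (mult_embed a).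
Proof. by apply: mult_ext => c /=; rewrite starM starK. Qed.

Lemma mult_embedMl (x : multiplier A) (a : A) : x ** mult_embed a = mult_embed (lmult x a).
Proof. by apply: mult_ext => c /=; rewrite ?lmultM ?multE. Qed.

Lemma mult_embedMr (x : multiplier A) (a : A) : mult_embed a ** x = mult_embed (rmult x a).
Proof. by apply: mult_ext => c /=; rewrite ?rmultM ?multE. Qed.

Lemma rnorm_mult_embed (a : A) : rnorm (mult_embed a) = rnorm a.
Proof.
apply/eqP; rewrite eq_le; apply/andP; split.
  apply: mult_norm_le => [|b]; first exact: rnorm_ge0.
  by rewrite mulrC; exact: rnormM.
apply: rnorm_le_mulr (rnorm_ge0 _) _ => b; exact: (mult_normP (mult_embed a)).
Qed.

Definition in_mult_embed : {pred multiplier A} :=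
  fun x => `[< exists a, x = mult_embed a >].

Fact in_mult_embed_zmod : zmod_closed in_mult_embed.
Proof.
split; first by apply/asboolP; exists 0; apply: mult_ext => c /=; rewrite (smul0x, smulx0).
move=> x y /asboolP[a ->] /asboolP[b ->]; apply/asboolP; exists (a - b).
by rewrite mult_embedB.
Qed.

HB.instance Definition _ :=
  GRing.isZmodClosed.Build (multiplier A) in_mult_embed in_mult_embed_zmod.

(* Q(A) = M(A) / A with the quotient norm. The instances below stop at
   normedStarAlgType: completeness and the C*-identity of the quotient norm are
   not needed to interpret quantifier-free formulas. *)
Definition corona : Type := {quot in_mult_embed}.

HB.instance Definition _ := GRing.Zmodule.on corona.
HB.instance Definition _ := ZmodQuotient.on corona.

Implicit Types (x y z : multiplier A) (p q : corona).

Lemma corona_eqP x y : \pi_corona x = \pi_corona y <-> exists a, x = y + mult_embed a.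
Proof.
split.
  move=> /eqP; rewrite -idealrBE => /asboolP[a xy]; exists a.
  by rewrite -xy addrC subrK.
move=> [a ->]; apply/eqP; rewrite -idealrBE; apply/asboolP; exists a.
by rewrite addrC addKr.
Qed.

Lemma corona_ind (P : corona -> Prop) : (forall x, P (\pi_corona x)) -> forall q, P q.
Proof. by move=> h q; rewrite -[q]reprK. Qed.

Lemma corona_repr x : exists a, repr (\pi_corona x) = x + mult_embed a.
Proof. by apply/corona_eqP; rewrite reprK. Qed.

Definition corona_scale (k : R[i]) q : corona := \pi_corona (k *: repr q).
Definition corona_mul p q : corona := \pi_corona (repr p ** repr q).
Definition corona_star q : corona := \pi_corona (star (repr q)).

Lemma pi_coronaD x y : \pi_corona (x + y) = \pi_corona x + \pi_corona y.
Proof. exact: pi_addr. Qed.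

Lemma pi_coronaZ (k : R[i]) x : \pi_corona (k *: x) = corona_scale k (\pi_corona x).
Proof.
apply/esym/corona_eqP; have [a ->] := corona_repr x; exists (k *: a).
by rewrite scalerDr mult_embedZ.
Qed.

Lemma pi_coronaM x y : \pi_corona (x ** y) = corona_mul (\pi_corona x) (\pi_corona y).
Proof.
apply/esym/corona_eqP; have [a ->] := corona_repr x; have [b ->] := corona_repr y.
exists (lmult x b + (rmult y a + a ** b)).
by rewrite smulDl !smulDr !mult_embedMl mult_embedMr !mult_embedD !addrA.
Qed.

Lemma pi_corona_star x : \pi_corona (star x) = corona_star (\pi_corona x).
Proof.
apply/esym/corona_eqP; have [a ->] := corona_repr x; exists (star a).
by rewrite starD mult_embed_star.
Qed.

Fact corona_scaleA (a b : R[i]) q :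
  corona_scale a (corona_scale b q) = corona_scale (a * b) q.
Proof. by elim/corona_ind: q => x; rewrite -!pi_coronaZ scalerA. Qed.
Fact corona_scale1 : left_id 1 corona_scale.
Proof. by elim/corona_ind => x; rewrite -pi_coronaZ scale1r. Qed.
Fact corona_scaleDr : right_distributive corona_scale +%R.
Proof.
move=> k; elim/corona_ind => x; elim/corona_ind => y.
by rewrite -pi_coronaD -!pi_coronaZ -pi_coronaD scalerDr.
Qed.
Fact corona_scaleDl q : {morph corona_scale^~ q : a b / a + b}.
Proof.
elim/corona_ind: q => x a b.
by rewrite -!pi_coronaZ -pi_coronaD scalerDl.
Qed.

HB.instance Definition _ := GRing.Zmodule_isLmodule.Build R[i] corona
  corona_scaleA corona_scale1 corona_scaleDr corona_scaleDl.

Lemma pi_coronaZE (k : R[i]) x : \pi_corona (k *: x) = k *: \pi_corona x.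
Proof. exact: pi_coronaZ. Qed.

Fact corona_mulA : associative corona_mul.
Proof.
elim/corona_ind => x; elim/corona_ind => y; elim/corona_ind => z.
by rewrite -!pi_coronaM smulA.
Qed.
Fact corona_mulDl : left_distributive corona_mul +%R.
Proof.
elim/corona_ind => x; elim/corona_ind => y; elim/corona_ind => z.
by rewrite -pi_coronaD -!pi_coronaM -pi_coronaD smulDl.
Qed.
Fact corona_mulDr : right_distributive corona_mul +%R.
Proof.
elim/corona_ind => x; elim/corona_ind => y; elim/corona_ind => z.
by rewrite -pi_coronaD -!pi_coronaM -pi_coronaD smulDr.
Qed.
Fact corona_mulZl (k : R[i]) p q : corona_mul (k *: p) q = k *: corona_mul p q.
Proof.
elim/corona_ind: p => x; elim/corona_ind: q => y.
by rewrite -pi_coronaZE -!pi_coronaM -pi_coronaZE smulZl.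
Qed.
Fact corona_mulZr (k : R[i]) p q : corona_mul p (k *: q) = k *: corona_mul p q.
Proof.
elim/corona_ind: p => x; elim/corona_ind: q => y.
by rewrite -pi_coronaZE -!pi_coronaM -pi_coronaZE smulZr.
Qed.
Fact corona_starK : involutive corona_star.
Proof. by elim/corona_ind => x; rewrite -!pi_corona_star starK. Qed.
Fact corona_starD : {morph corona_star : p q / p + q}.
Proof.
elim/corona_ind => x; elim/corona_ind => y.
by rewrite -pi_coronaD -!pi_corona_star -pi_coronaD starD.
Qed.
Fact corona_starZ (k : R[i]) q : corona_star (k *: q) = (k^*)%C *: corona_star q.
Proof.
elim/corona_ind: q => x.
by rewrite -pi_coronaZE -!pi_corona_star -pi_coronaZE starZ.
Qed.
Fact corona_starM p q :
  corona_star (corona_mul p q) = corona_mul (corona_star q) (corona_star p).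
Proof.
elim/corona_ind: p => x; elim/corona_ind: q => y.
by rewrite -pi_coronaM -!pi_corona_star -pi_coronaM starM.
Qed.

HB.instance Definition _ := Lmodule_isStarAlgebra.Build R corona
  corona_mulA corona_mulDl corona_mulDr corona_mulZl corona_mulZr
  corona_starK corona_starD corona_starZ corona_starM.

Definition corona_norm q : R := inf [set rnorm x | x in [set x | \pi_corona x = q]].

Lemma corona_norm_lb q : has_lbound [set rnorm x | x in [set x | \pi_corona x = q]].
Proof. by exists 0 => _ [x _ <-]; exact: rnorm_ge0. Qed.

Lemma corona_norm_ne q : [set rnorm x | x in [set x | \pi_corona x = q]] !=set0.
Proof. by exists (rnorm (repr q)); exists (repr q) => //=; rewrite reprK. Qed.

Lemma corona_norm_pi x : corona_norm (\pi_corona x) <= rnorm x.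
Proof. by apply: ge_inf (corona_norm_lb _) _ _; exists x. Qed.

Lemma corona_norm_ge0 q : 0 <= corona_norm q.
Proof. by apply: lb_le_inf (corona_norm_ne q) _ => _ [x _ <-]; exact: rnorm_ge0. Qed.

Lemma corona_norm_adh q (e : R) : 0 < e ->
  exists2 x, \pi_corona x = q & rnorm x < corona_norm q + e.
Proof.
move=> e0; have [] := @inf_adherent _ [set rnorm x | x in [set x | \pi_corona x = q]] _ e0.
  by split; [exact: corona_norm_ne|exact: corona_norm_lb].
by move=> _ [x xq <-] xe; exists x.
Qed.

Fact corona_normD p q :
  (corona_norm (p + q))%:C%C <= (corona_norm p)%:C%C + (corona_norm q)%:C%C.
Proof.
rewrite -rmorphD lecR; apply/ler_addgt0Pr => e e0.
have e20 : 0 < e / 2 by rewrite divr_gt0.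
have [x xp xe] := corona_norm_adh p e20; have [y yq ye] := corona_norm_adh q e20.
rewrite -{1}xp -{1}yq -pi_coronaD (le_trans (corona_norm_pi _))//.
rewrite (le_trans (rnormD _ _))// (le_trans (lerD (ltW xe) (ltW ye)))//.
by rewrite addrACA -splitr.
Qed.

Fact corona_normZ (k : R[i]) q :
  (corona_norm (k *: q))%:C%C = `|k| * (corona_norm q)%:C%C.
Proof.
have n0 (l : R[i]) : 0 <= Normc.normc l by rewrite -ler0c -[leRHS]/(`|l|).
have le (l : R[i]) p : corona_norm (l *: p) <= Normc.normc l * corona_norm p.
  apply/ler_addgt0Pr => e e0.
  have n1 : 0 < Normc.normc l + 1 by rewrite ltr_wpDl.
  have [|x xp xe] := @corona_norm_adh p (e / (Normc.normc l + 1)).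
    by rewrite divr_gt0.
  rewrite -{1}xp -pi_coronaZE (le_trans (corona_norm_pi _))// rnormZ.
  rewrite (le_trans (ler_wpM2l (n0 l) (ltW xe)))// mulrDr lerD2l.
  by rewrite mulrCA ger_pMr// ler_pdivrMr// mul1r lerDl.
rewrite -[`|k|]/((Normc.normc k)%:C%C) -rmorphM; congr (_%:C%C).
apply/eqP; rewrite eq_le le/=.
have [->|k0] := eqVneq k 0.
  by rewrite Normc.normc0 mul0r corona_norm_ge0.
have nk : 0 < Normc.normc k by rewrite -ltcR -[ltRHS]/(`|k|) normr_gt0.
rewrite mulrC -ler_pdivlMr// mulrC -[in leLHS](scale1r q) -(mulVf k0) -scalerA.
by rewrite -Normc.normcV le.
Qed.

Fact corona_norm0_eq0 q : (corona_norm q)%:C%C = 0 -> q = 0.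
Proof.
move=> /complexI q0; rewrite -[q]reprK; set y := repr q.
have ya (n : nat) : exists a, rnorm (y - mult_embed a) < n.+1%:R^-1.
  have [|x xq xn] := @corona_norm_adh q n.+1%:R^-1; first by rewrite invr_gt0.
  have [|a ya] := (corona_eqP y x).1; first by rewrite xq reprK.
  by exists a; rewrite ya addrK; rewrite q0 add0r in xn.
have [a_ ha] := choice ya.
have small (e : R) : 0 < e -> \forall n \near \oo, rnorm (y - mult_embed (a_ n)) < e.
  move=> /posnumP[d]; near=> n; rewrite (lt_trans (ha n))//.
  by near: n; exact: near_infty_natSinv_lt.
have ac : cvg (a_ @ \oo).
  apply: cauchy_cvg; apply/cauchyP => _ /gtc0E[e e0 ->].
  have e20 : 0 < e / 2 by rewrite divr_gt0.
  have [N _ hN] := small _ e20.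
  exists (a_ N); exists N => // n /= Nn.
  rewrite -ball_normE /= rnorm_lt -rnorm_mult_embed mult_embedB.
  rewrite (le_lt_trans (rnormBD y _ _))// [e]splitr ltrD// ?hN//.
  by rewrite rnormB hN//=.
have -> : (0 : corona) = \pi_corona 0 by rewrite pi_zeror.
apply/corona_eqP; exists (lim (a_ @ \oo)); rewrite add0r.
apply: (@rnorm_eq _ _ 2) => e e0.
have /cvgrPdist_lt/(_ e%:C%C) := ac; rewrite ltcR => /(_ e0) al.
have [n [/= n1 n2]] := filter_ex (filterI (small _ e0) al).
rewrite (le_trans (rnormBD (mult_embed (a_ n)) _ _))// mulr_natl mulr2n lerD ?(ltW n1)//.
by rewrite -mult_embedB rnorm_mult_embed rnormB -rnorm_le ltW.
Unshelve. all: by end_near. Qed.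

HB.instance Definition _ := Lmodule_isNormed.Build R[i] corona
  corona_normD corona_normZ corona_norm0_eq0.

Lemma corona_rnormE q : rnorm q = corona_norm q. Proof. by []. Qed.

Fact corona_normM p q : `|p ** q| <= `|p| * `|q|.
Proof.
rewrite !normE -rmorphM lecR !corona_rnormE.
set P := corona_norm p; set Q := corona_norm q.
have P0 : 0 <= P := corona_norm_ge0 p; have Q0 : 0 <= Q := corona_norm_ge0 q.
apply/ler_addgt0Pr => e e0.
pose d := Num.min 1 (e / (P + Q + 1)).
have PQ : 0 < P + Q + 1 by rewrite ltr_wpDl ?addr_ge0.
have d0 : 0 < d by rewrite lt_min ltr01 divr_gt0.
have d1 : d <= 1 by rewrite ge_min lexx.
have de : d * (P + Q + 1) <= e by rewrite -ler_pdivlMr// ge_min lexx orbT.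
have [x xp xe] := corona_norm_adh p d0; have [y yq ye] := corona_norm_adh q d0.
have -> : p ** q = \pi_corona (x ** y) by rewrite pi_coronaM xp yq.
rewrite (le_trans (corona_norm_pi _))// (le_trans (rnormM _ _))//.
rewrite (le_trans (ler_pM (rnorm_ge0 _) (rnorm_ge0 _) (ltW xe) (ltW ye)))//.
rewrite -/P -/Q (_ : (P + d) * (Q + d) = P * Q + d * (P + Q + d)); last first.
  by rewrite mulrDl !mulrDr (mulrC P d) !addrA.
rewrite lerD2l (le_trans _ de)// ler_wpM2l ?(ltW d0)// lerD2l//.
Qed.

Fact corona_norm_star q : `|star q| = `|q|.
Proof.
have le p : corona_norm (star p) <= corona_norm p.
  apply/ler_addgt0Pr => e e0; have [x xp xe] := corona_norm_adh p e0.
  have -> : star p = \pi_corona (star x) by rewrite pi_corona_star xp.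
  by rewrite (le_trans (corona_norm_pi _))// rnorm_star ltW.
rewrite !normE; congr (_%:C%C); rewrite !corona_rnormE; apply/eqP.
by rewrite eq_le le -[in leLHS](starK q) le.
Qed.

HB.instance Definition _ :=
  StarAlgebra_isNormed.Build R corona corona_normM corona_norm_star.

End Corona.

Definition unital (R : realType) (A : starAlgType R) :=
  exists e : A, forall x, e ** x = x /\ x ** e = x.

Definition projection (R : realType) (A : starAlgType R) (p : A) :=
  p ** p = p /\ star p = p.

Definition projectionless (R : realType) (A : starAlgType R) :=
  forall p : A, projection p -> p = 0 \/ forall x, p ** x = x /\ x ** p = x.

Definition closed_ideal (R : realType) (A : cstarAlgType R) (I : set A) :=
  [/\ closed I, I 0, forall x y, I x -> I y -> I (x + y),
      forall (k : R[i]) x, I x -> I (k *: x)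
    & forall x a, I x -> I (a ** x) /\ I (x ** a)].

Definition simple_cstar (R : realType) (A : cstarAlgType R) :=
  (exists x : A, x != 0) /\
  forall I : set A, closed_ideal I -> I = [set 0] \/ I = [set: A].

Definition separable_space (T : topologicalType) :=
  exists2 D : set T, countable D & dense D.

Section Saturation.
Context (R : realType) (A : normedStarAlgType R).

(* *-polynomials with coefficients in A, in the variables x_0, x_1, ... *)
Inductive star_poly : Type :=
| SVar of nat
| SConst of A
| SAdd of star_poly & star_poly
| SScale of R[i] & star_poly
| SMul of star_poly & star_poly
| SStar of star_poly.

Fixpoint star_poly_eval (b : nat -> A) (P : star_poly) : A :=
  match P with
  | SVar i => b i
  | SConst a => a
  | SAdd P Q => star_poly_eval b P + star_poly_eval b Q
  | SScale k P => k *: star_poly_eval b P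
  | SMul P Q => star_poly_eval b P ** star_poly_eval b Q
  | SStar P => star (star_poly_eval b P)
  end.

(* Formulas of continuous logic without quantifiers: norms of *-polynomials,
   closed under continuous connectives R^n -> R. *)
Inductive qf_formula : Type :=
| QFNorm of star_poly
| QFConn n (f : 'rV[R]_n -> R) of continuous f & ('I_n -> qf_formula).

Fixpoint qf_eval (b : nat -> A) (phi : qf_formula) : R :=
  match phi with
  | QFNorm P => rnorm (star_poly_eval b P)
  | QFConn n f _ psi => f (\row_(i < n) qf_eval b (psi i))
  end.

(* The pair (phi, r) stands for the condition phi = r. *)
Definition qf_condition : Type := qf_formula * R.

(* As usual in the model theory of C*-algebras, the variables range over the
   unit ball. *)
Definition unit_ball_seq (b : nat -> A) := forall i, rnorm (b i) <= 1.

Definition realized (S : set qf_condition) :=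
  exists2 b, unit_ball_seq b & forall c, S c -> qf_eval b c.1 = c.2.

Definition finitely_approx_satisfiable (S : set qf_condition) :=
  forall F : set qf_condition, finite_set F -> F `<=` S ->
  forall e : R, 0 < e ->
  exists2 b, unit_ball_seq b & forall c, F c -> `|qf_eval b c.1 - c.2| <= e.

Definition countably_qf_saturated :=
  forall S : set qf_condition, countable S ->
  finitely_approx_satisfiable S -> realized S.

End Saturation.

(* Main.v *)
(** A condition [t(X) = 0] on an element [X] of the corona of [c0_sum A] can be met
    by multipliers and yet force a quantity [u(X)] to be small on elements of the
    summands [A n]. The type asking that [t(X) = 0], that [u(X)] have norm 1 on
    infinitely many coordinates, and that each single coordinate of [X] vanish in
    the corona is then finitely satisfiable, by a multiplier that is zero on the
    first coordinates. A realization would have coordinates [x n] in [A n] with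
    [t(x n)] tending to 0, so that [u(x n)] is eventually at most 3/4.

    If [A n] is nonunital and projectionless, take [t(x) = x^* x - x] and
    [u(x) = x]: the multiplier 1 satisfies the type, and a near-solution in [A n]
    is close to a projection, hence to 0.

    The compact operators on l2 have many projections, so there [t] says that
    [y = 1 + 2 x] is an isometry and [u(x) = 1 - y y^*]. The unilateral shift is an
    isometry which is not unitary, whereas [1 + compact] has index 0: up to a small
    error it is the identity plus a finite matrix, for which injectivity implies
    surjectivity. *)

Require Import Defs.
From HB Require Import structures.
From mathcomp Require Import all_boot all_order all_algebra.
From mathcomp Require Import interval_inference generic_quotient complex.
From mathcomp Require Import all_classical all_reals topology normedtype sequences.
From mathcomp Require Import ring lra.

Set Implicit Arguments.
Unset Strict Implicit.
Unset Printing Implicit Defensive.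

Import Order.TTheory GRing.Theory Num.Theory.
Import numFieldNormedType.Exports.

Local Open Scope classical_set_scope.
Local Open Scope ring_scope.
Local Open Scope quotient_scope.

#[local] Obligation Tactic := idtac.

(** The existence part asks for simple separable summands only. Simple nonunital algebras without
    projections exist but take considerable work to construct, while the compact operators are
    elementary; their projections then call for a second pair of polynomials. Hence one criterion,
    [corona_not_saturated], with [t] and [u] as parameters: a gap inside the summands against an
    exact solution in their multiplier algebras. The gap must hold with the same [delta] in all
    selected summands, because a realization only says that [t] tends to 0 along the coordinates.

    Two constraints shape the polynomials. The summands have no unit, so there are no constant
    terms, and the isometry has to be hidden in [y = 1 + 2 x]. The variables range over the unit
    ball, and the factor 2 makes [x = (s - 1) / 2] a contraction when [s] is the shift. The bound
    3/4 stands for any number below 1: it separates the norm of [u] at a realization from the value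
    1 that the type prescribes. *)

(** * Polynomials in one variable and its adjoint, without constant term *)

(** Without constants, the same polynomial can be evaluated in a summand, in its multiplier algebra
    and in the corona, and it vanishes at 0. *)
Inductive ncpoly (R : realType) : Type :=
| NCVar
| NCAdd of ncpoly R & ncpoly R
| NCScale of R[i] & ncpoly R
| NCMul of ncpoly R & ncpoly R
| NCStar of ncpoly R.
Arguments NCVar {R}.

Fixpoint nceval (R : realType) (A : starAlgType R) (x : A) (P : ncpoly R) : A :=
  match P with
  | NCVar => x
  | NCAdd P Q => nceval x P + nceval x Q
  | NCScale k P => k *: nceval x P
  | NCMul P Q => nceval x P ** nceval x Q
  | NCStar P => star (nceval x P)
  end.

Fixpoint poly_of_ncpoly (R : realType) (A : normedStarAlgType R) (P : ncpoly R) :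
    star_poly A :=
  match P with
  | NCVar => SVar A 0
  | NCAdd P Q => SAdd (poly_of_ncpoly A P) (poly_of_ncpoly A Q)
  | NCScale k P => SScale k (poly_of_ncpoly A P)
  | NCMul P Q => SMul (poly_of_ncpoly A P) (poly_of_ncpoly A Q)
  | NCStar P => SStar (poly_of_ncpoly A P)
  end.

Section NCPoly.
Context (R : realType).

Lemma poly_of_ncpolyE (A : normedStarAlgType R) (b : nat -> A) (P : ncpoly R) :
  star_poly_eval b (poly_of_ncpoly A P) = nceval (b 0%N) P.
Proof. by elim: P => //= [P -> Q ->|k P ->|P -> Q ->|P ->]. Qed.

Lemma nceval0 (A : starAlgType R) (P : ncpoly R) : nceval (0 : A) P = 0.
Proof.
elim: P => //= [P -> Q ->|k P ->|P -> Q ->|P ->].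
- by rewrite addr0.
- by rewrite scaler0.
- by rewrite smulx0.
- by rewrite star0.
Qed.

Context (A : cstarAlgType R).

Lemma nceval_mult_embed (a : A) (P : ncpoly R) :
  nceval (mult_embed a) P = mult_embed (nceval a P).
Proof.
elim: P => //= [P -> Q ->|k P ->|P -> Q ->|P ->].
- by rewrite mult_embedD.
- by rewrite mult_embedZ.
- by rewrite mult_embedMl.
- by rewrite mult_embed_star.
Qed.

Lemma nceval_corona (x : multiplier A) (P : ncpoly R) :
  nceval (\pi_(corona A) x) P = \pi_(corona A) (nceval x P).
Proof.
elim: P => //= [P -> Q ->|k P ->|P -> Q ->|P ->].
- by rewrite pi_coronaD.
- by rewrite pi_coronaZE.
- by rewrite pi_coronaM.
- by rewrite pi_corona_star.
Qed.

Lemma mult_embed_inj : injective (@mult_embed R A).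
Proof.
move=> a b ab; apply/eqP; rewrite -subr_eq0; apply/eqP/rnorm0_eq0.
by rewrite -rnorm_mult_embed mult_embedB ab subrr rnorm0.
Qed.

(** Nondegeneracy: by the C*-identity, the norm of [a - b] is controlled by its products with the
    elements of the algebra. *)
Lemma smul_inj (a b : A) : (forall c, a ** c = b ** c) -> a = b.
Proof.
move=> ab; apply: mult_embed_inj; apply: mult_ext => c /=; first exact: ab.
apply/eqP; rewrite -subr_eq0 -smulBr; apply/eqP; rewrite -[RHS](smulx0 c); congr smul.
apply/rnorm0_eq0/eqP; rewrite eq_le rnorm_ge0 andbT; apply: rnorm_le_mulr => // d.
by rewrite smulBl ab subrr rnorm0 mulr0.
Qed.

Definition mult_one : multiplier A.
Proof.
by refine (@Multiplier R A id id _ _ _ _ _ _ _) => //; exists 1 => a; rewrite mul1r.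
Defined.

Lemma mult_one_rnorm : rnorm mult_one <= 1.
Proof. by apply: mult_norm_le => // a /=; rewrite mulr1. Qed.

End NCPoly.

(** * Multipliers of a c0-sum, coordinate by coordinate *)

Section C0SumMultiplier.
Context (R : realType) (A : nat -> cstarAlgType R).
Let B := c0_sum A.
Implicit Types (b : B) (X : multiplier B) (P : ncpoly R).

(** A relation instead of a coordinate map from multipliers of the sum to multipliers of [A n]: it
    is compatible with all operations, so polynomials pass to coordinates by induction, and
    [acts_at_inj] makes the coordinate unique. *)
Definition acts_at X n (y : multiplier (A n)) :=
  forall b, lmult X b n = lmult y (b n) /\ rmult X b n = rmult y (b n).

Lemma acts_at_nceval X n (y : multiplier (A n)) P :
  acts_at X y -> acts_at (nceval X P) (nceval y P).
Proof.
move=> Xy; elim: P => //= [P hP Q hQ|k P hP|P hP Q hQ|P hP] b.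
- by have [/= -> ->] := hP b; have [-> ->] := hQ b.
- by have [/= -> ->] := hP b.
- split=> /=.
    by have [-> _] := hP (lmult (nceval X Q) b); have [-> _] := hQ b.
  by have [_ ->] := hQ (rmult (nceval X P) b); have [_ ->] := hP b.
- by have [/= -> ->] := hP (star b).
Qed.

Lemma acts_at_mult_embed b n : acts_at (mult_embed b) (mult_embed (b n)).
Proof. by []. Qed.

Lemma acts_atD X Y n (y z : multiplier (A n)) :
  acts_at X y -> acts_at Y z -> acts_at (X + Y) (y + z).
Proof. by move=> Xy Yz b; have [/= -> ->] := Xy b; have [-> ->] := Yz b. Qed.

Lemma acts_atN X n (y : multiplier (A n)) : acts_at X y -> acts_at (- X) (- y).
Proof. by move=> Xy b; have [/= -> ->] := Xy b. Qed.

Lemma acts_atM X Y n (y z : multiplier (A n)) :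
  acts_at X y -> acts_at Y z -> acts_at (X ** Y) (y ** z).
Proof.
move=> Xy Yz b; split=> /=.
  by have [-> _] := Xy (lmult Y b); have [-> _] := Yz b.
by have [_ ->] := Yz (rmult X b); have [_ ->] := Xy b.
Qed.

Lemma rnorm_le_acts_at X (M : R) : 0 <= M ->
  (forall n, exists2 y : multiplier (A n), acts_at X y & rnorm y <= M) ->
  rnorm X <= M.
Proof.
move=> M0 h; apply: mult_norm_le => // b; apply: c0_norm_le => n.
have [y Xy yM] := h n; have [-> _] := Xy b.
apply: le_trans (mult_normP _ _) _.
by apply: ler_pM; rewrite ?rnorm_ge0 ?mult_norm_ge0 ?c0_norm_coord.
Qed.

Fact c0_single_cvg n (a : A n) :
  rnorm (eqtype.dfwith (fun k => 0 : A k) a k) @[k --> \oo] --> (0 : R).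
Proof.
apply/cvgrPdist_le => e e0; exists n.+1 => // k /= nk.
rewrite eqtype.dfwith_out ?rnorm0 ?subr0 ?normr0 ?ltW//.
by apply: contraL nk => /eqP <-; rewrite -leqNgt.
Qed.

Definition c0_single n (a : A n) : B := C0Sum (c0_single_cvg a).

Lemma c0_single_in n (a : A n) : c0_single a n = a.
Proof. by rewrite /= eqtype.dfwith_in. Qed.

Lemma c0_single_rnorm n (a : A n) : rnorm (c0_single a) <= rnorm a.
Proof.
apply: c0_norm_le => k /=.
by case: eqtype.dfwithP => [//|j _]; rewrite rnorm0 rnorm_ge0.
Qed.

(** With [rnorm_le_acts_at], this makes the norm of a multiplier the supremum over its coordinates.
    Elements supported at [n] serve as test vectors. *)
Lemma acts_at_rnorm X n (y : multiplier (A n)) : acts_at X y -> rnorm y <= rnorm X.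
Proof.
move=> Xy; apply: mult_norm_le; first exact: rnorm_ge0.
move=> a; have [/esym] := Xy (c0_single a); rewrite c0_single_in => -> _.
apply: le_trans (c0_norm_coord _ _) _; rewrite -c0_rnormE.
apply: le_trans (mult_normP _ _) _.
by apply: ler_wpM2r; [exact: mult_norm_ge0|exact: c0_single_rnorm].
Qed.

Lemma acts_at_inj X n (y z : multiplier (A n)) : acts_at X y -> acts_at X z -> y = z.
Proof.
move=> Xy Xz; apply: mult_ext => a.
  have [h _] := Xy (c0_single a); have [g _] := Xz (c0_single a).
  by rewrite c0_single_in in h g; rewrite -h -g.
have [_ h] := Xy (c0_single a); have [_ g] := Xz (c0_single a).
by rewrite c0_single_in in h g; rewrite -h -g.
Qed.

Section Product.
Context (y : forall n, multiplier (A n)) (M : R) (yM : forall n, rnorm (y n) <= M).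

Fact c0_lprod_cvg b : rnorm (lmult (y n) (b n)) @[n --> \oo] --> (0 : R).
Proof.
apply: (c0_dom (u := fun n => rnorm (b n) * M)) => [|n].
  by rewrite -[X in _ --> X](mul0r M); apply: cvgMl; exact: c0_cvg.
by apply: le_trans (mult_normP _ _) _; rewrite ler_wpM2l ?rnorm_ge0 ?yM.
Qed.

Fact c0_rprod_cvg b : rnorm (rmult (y n) (b n)) @[n --> \oo] --> (0 : R).
Proof.
apply: (c0_dom (u := fun n => rnorm (b n) * M)) => [|n].
  by rewrite -[X in _ --> X](mul0r M); apply: cvgMl; exact: c0_cvg.
by apply: le_trans (mult_normPr _ _) _; rewrite ler_wpM2l ?rnorm_ge0 ?yM.
Qed.

(** One direction of the identification of the multiplier algebra of the sum with the bounded
    product of the multiplier algebras. The uniform bound [M] keeps the images in the c0-sum. *)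
Program Definition c0_mult : multiplier B :=
  @Multiplier R B (fun b => C0Sum (c0_lprod_cvg b)) (fun b => C0Sum (c0_rprod_cvg b))
    _ _ _ _ _ _ _.
Next Obligation. by move=> k b c; apply: c0_ext => n /=; exact: lmult_linear. Qed.
Next Obligation. by move=> k b c; apply: c0_ext => n /=; exact: rmult_linear. Qed.
Next Obligation.
have M0 : 0 <= M := le_trans (rnorm_ge0 _) (yM 0).
exists M => b; apply: c0_norm_le => n /=; apply: le_trans (mult_normP _ _) _.
by rewrite mulrC ler_pM ?rnorm_ge0 ?mult_norm_ge0 ?yM ?c0_norm_coord.
Qed.
Next Obligation.
have M0 : 0 <= M := le_trans (rnorm_ge0 _) (yM 0).
exists M => b; apply: c0_norm_le => n /=; apply: le_trans (mult_normPr _ _) _.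
by rewrite mulrC ler_pM ?rnorm_ge0 ?mult_norm_ge0 ?yM ?c0_norm_coord.
Qed.
Next Obligation. by move=> a b; apply: c0_ext => n /=; exact: lmultM. Qed.
Next Obligation. by move=> a b; apply: c0_ext => n /=; exact: rmultM. Qed.
Next Obligation. by move=> a b; apply: c0_ext => n; exact: Defs.multE. Qed.

Lemma c0_mult_acts n : acts_at c0_mult (y n).
Proof. by []. Qed.

End Product.

Definition mult_bool n (t : bool) : multiplier (A n) := if t then mult_one (A n) else 0.

Lemma mult_bool_rnorm (q : nat -> bool) n : rnorm (mult_bool n (q n)) <= 1.
Proof. by rewrite /mult_bool; case: ifP => _; rewrite ?mult_one_rnorm// rnorm0. Qed.

(** The central projection onto the summands selected by [q]; its class in the corona serves as a
    parameter of the type. *)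
Definition c0_cut (q : nat -> bool) : multiplier B := c0_mult (mult_bool_rnorm q).

Lemma c0_cut_acts (q : nat -> bool) X n (y : multiplier (A n)) :
  acts_at X y -> acts_at (c0_cut q ** X) (if q n then y else 0).
Proof.
move=> Xy.
have := acts_atM (c0_mult_acts (mult_bool_rnorm q) n) Xy.
by rewrite /mult_bool; case: ifP => _; [congr acts_at; exact: mult_ext|rewrite smul0x].
Qed.

Fact c0_patch_cvg (f : forall n, A n) (q : nat -> bool) N :
  (forall n, (N <= n)%N -> q n = false) ->
  rnorm (if q n then f n else 0) @[n --> \oo] --> (0 : R).
Proof.
move=> qN; apply/cvgrPdist_le => e e0; exists N => // n /= Nn.
by rewrite (qN _ Nn) rnorm0 subr0 normr0 ltW.
Qed.

End C0SumMultiplier.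

(** * The type that is finitely satisfiable but not realized *)

Lemma finite_set_nat_bound (D : set nat) : finite_set D -> exists N, D `<=` `I_N.
Proof.
move=> /finite_seqP[s ->]; exists (\max_(i <- s) i).+1 => n /= ns.
by rewrite ltnS (big_rem n ns) leq_maxl.
Qed.

Lemma finite_subset_range (T : Type) (fam : nat -> T) (F : set T) :
  finite_set F -> F `<=` range fam -> exists N, F `<=` fam @` `I_N.
Proof.
move=> Ff Fr.
have /choice[g gP] : forall c, exists k, F c -> c = fam k.
  move=> c; have [/Fr[k _ <-]|nF] := pselect (F c); first by exists k.
  by exists 0%N.
have [N hN] := finite_set_nat_bound (finite_image g Ff).
by exists N => c Fc; exists (g c); [apply: hN; exists c|rewrite -gP].
Qed.

Section Obstruction.
Context (R : realType) (A : nat -> cstarAlgType R) (t u : ncpoly R) (S : nat -> bool).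
Let Q := corona (c0_sum A).
Let M := multiplier (c0_sum A).

(** The cut by [S] confines the norm condition to the summands where the gap is assumed. The
    conditions from index 2 on force each coordinate of a lift of [X] to lie in [A n]; without them
    a multiplier such as 1 could be a realization. *)
Definition obstruction_type (k : nat) : qf_condition Q :=
  match k with
  | 0 => (QFNorm (poly_of_ncpoly Q t), 0)
  | 1 => (QFNorm (SMul (SConst (\pi_Q (c0_cut A S) : Q)) (poly_of_ncpoly Q u)), 1)
  | n.+2 => (QFNorm (SMul (SConst (\pi_Q (c0_cut A (pred1 n)) : Q)) (SVar Q 0)), 0)
  end.

Lemma pi_corona_eq0 (B : cstarAlgType R) (x : multiplier B) :
  \pi_(corona B) x = 0 -> exists a, x = mult_embed a.
Proof.
have -> : (0 : corona B) = \pi_(corona B) 0 by rewrite pi_zeror.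
by move=> /corona_eqP[a ->]; exists a; rewrite add0r.
Qed.

Lemma obstruction_type_not_realized (delta : R) : 0 < delta ->
  (forall n (a : A n), S n -> rnorm (nceval a t) <= delta -> rnorm (nceval a u) <= 3 / 4) ->
  ~ realized (range obstruction_type).
Proof.
move=> d0 H1 [b _ hb]; have [x xb] : exists x : M, \pi_Q x = b 0%N.
  by exists (repr (b 0%N)); rewrite reprK.
have /choice[a ha] n : exists a : c0_sum A, c0_cut A (pred1 n) ** x = mult_embed a.
  have /= := hb _ (ex_intro2 _ _ n.+2 I erefl) => /rnorm0_eq0.
  by rewrite -xb -[_ ** _]pi_coronaM; exact: pi_corona_eq0.
(* The cut at [n] is the identity on coordinate [n], so there [x] acts as the [n]-th entry of the
   element [a n] of the sum. *)
have xact n : acts_at x (mult_embed (a n n)).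
  have lx c : lmult x c n = a n n ** c n.
    rewrite -[RHS]/(lmult (mult_embed (a n)) c n) -ha /= /mult_bool eqxx//.
  (* The right component follows from the left one: the double centralizer identity is tested on
     elements supported at [n], and nondegeneracy cancels them. *)
  move=> c; split; first exact: lx.
  apply: smul_inj => d; rewrite -{1}[d]c0_single_in.
  have /(congr1 (fun b : c0_sum A => b n)) := Defs.multE x c (c0_single d).
  by move=> /= ->; rewrite lx c0_single_in smulA.
have [c hc] : exists c : c0_sum A, nceval x t = mult_embed c.
  have /= := hb _ (ex_intro2 _ _ 0%N I erefl) => /rnorm0_eq0.
  by rewrite poly_of_ncpolyE -xb nceval_corona; exact: pi_corona_eq0.
have cE n : c n = nceval (a n n) t.
  apply: mult_embed_inj; rewrite -nceval_mult_embed.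
  apply: acts_at_inj (acts_at_nceval t (xact n)); rewrite hc; exact: acts_at_mult_embed.
have [N _ hN] : \forall n \near \oo, rnorm (c n) <= delta.
  have /cvgrPdist_le/(_ _ d0) := c0_cvg c; apply: filterS => n.
  by rewrite sub0r normrN ger0_norm ?rnorm_ge0.
have qN n : (N <= n)%N -> (n < N)%N = false by rewrite leqNgt => /negbTE.
(* The gap is known only from [N] on. The earlier entries form a finitely supported sequence [v], an
   element of the sum, and subtracting it does not change the class in the corona. *)
pose v := C0Sum (@c0_patch_cvg _ _ (fun n => nceval (a n n) u : A n) (fun n => (n < N)%N && S n) N
   (fun n Nn => congr1 (andb^~ (S n)) (qN n Nn))).
have := hb _ (ex_intro2 _ _ 1%N I erefl) => /=.
rewrite poly_of_ncpolyE -xb nceval_corona -[_ ** _]pi_coronaM => u1.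
have : rnorm (\pi_Q (c0_cut A S ** nceval x u) : Q) <= 3 / 4.
  rewrite (_ : \pi_Q _ = \pi_Q (c0_cut A S ** nceval x u - mult_embed v)); last first.
    by apply/corona_eqP; exists v; rewrite subrK.
  apply: le_trans (corona_norm_pi _) _; apply: rnorm_le_acts_at => // n.
  have := acts_atD (c0_cut_acts S (acts_at_nceval u (xact n)))
    (acts_atN (acts_at_mult_embed v n)).
  move=> h; eexists; first exact: h.
  rewrite nceval_mult_embed /=; case: (ifPn (S n)) => Sn; rewrite ?andbT ?andbF.
    case: ltnP => nN; first by rewrite subrr rnorm0; lra.
    rewrite -mult_embedN -mult_embedD subr0 rnorm_mult_embed H1// -cE; exact: hN.
  by rewrite -mult_embedN oppr0 add0r rnorm_mult_embed rnorm0; lra.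
by rewrite u1; lra.
Qed.

Lemma obstruction_type_satisfiable :
  infinite_set [set n | S n] ->
  (forall n, S n -> exists x : multiplier (A n),
    [/\ rnorm x <= 1, nceval x t = 0 & rnorm (nceval x u) = 1]) ->
  finitely_approx_satisfiable (range obstruction_type).
Proof.
move=> Sinf H2 F Ff Fr e e0.
have yex : forall n, exists x : multiplier (A n), S n ->
    [/\ rnorm x <= 1, nceval x t = 0 & rnorm (nceval x u) = 1].
  by move=> n; case: (boolP (S n)) => [/H2[x xP]|_]; [exists x|exists 0].
pose y n := sval (cid (yex n)); have yP n := svalP (cid (yex n)).
(* Only cuts at coordinates below [N] occur in [F], so a multiplier that vanishes there satisfies
   them exactly. *)
have [N FN] := finite_subset_range Ff Fr.
pose z n : multiplier (A n) := if (N <= n)%N && S n then y n else 0.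
have z1 n : rnorm (z n) <= 1.
  by rewrite /z; case: ifP => [/andP[_ /yP[]]//|_]; rewrite rnorm0.
have zt n : nceval (z n) t = 0.
  by rewrite /z; case: ifP => [/andP[_ /yP[]]//|_]; rewrite nceval0.
have zu n : rnorm (nceval (z n) u) <= 1.
  by rewrite /z; case: ifP => [/andP[_ /yP[_ _ ->]]//|_]; rewrite nceval0 rnorm0.
pose X := c0_mult z1.
have Xact n : acts_at X (z n) by exact: c0_mult_acts.
have M0 (Y : M) : (forall n, acts_at Y (0 : multiplier (A n))) -> Y = 0.
  move=> Y0; apply: rnorm0_eq0; apply/eqP; rewrite eq_le rnorm_ge0 andbT.
  by apply: rnorm_le_acts_at => // n; exists 0; rewrite ?rnorm0.
exists (fun=> \pi_Q X).
  move=> _; apply: le_trans (corona_norm_pi _) _.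
  by apply: rnorm_le_acts_at => // n; exists (z n).
move=> c Fc; have [k kN <-] := FN _ Fc; apply: le_trans (ltW e0).
rewrite normr_le0 subr_eq0; apply/eqP.
case: k kN => [|[|k]] /= kN.
- rewrite poly_of_ncpolyE nceval_corona (M0 (nceval X t)) ?rnorm0//; last first.
    by move=> n; rewrite -(zt n); exact: acts_at_nceval.
  by rewrite pi_zeror rnorm0.
- rewrite poly_of_ncpolyE nceval_corona -[_ ** _]pi_coronaM.
  set Y := c0_cut A S ** _.
  have Yact n : acts_at Y (if S n then nceval (z n) u else 0).
    by apply: c0_cut_acts; exact: acts_at_nceval.
  apply/eqP; rewrite eq_le; apply/andP; split.
    apply: le_trans (corona_norm_pi _) _; apply: rnorm_le_acts_at => // n.
    exists (if S n then nceval (z n) u else 0); first exact: Yact.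
    by case: ifP; rewrite ?rnorm0.
  (* Every other lift differs by some [a] in the sum. As [a] tends to 0 and [S] is infinite, there
     is a coordinate in [S] beyond [N] where [a] has norm at most [d] and [u] has norm 1, so the
     lift has norm at least [1 - d]. *)
  apply: lb_le_inf (corona_norm_ne _) _ => _ [_ /corona_eqP[a ->] <-].
  apply/ler_addgt0Pr => d d0.
  have [K _ hK] : \forall n \near \oo, rnorm (a n) <= d.
    have /cvgrPdist_le/(_ _ d0) := c0_cvg a; apply: filterS => n.
    by rewrite sub0r normrN ger0_norm ?rnorm_ge0.
  have [n [Sn /= nNK]] : exists n, S n /\ (maxn K N <= n)%N.
    apply: contrapT => nS; apply: Sinf; apply: sub_finite_set (finite_II (maxn K N)) => n /= Sn.
    by rewrite ltnNge; apply/negP => h; apply: nS; exists n.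
  move: nNK; rewrite geq_max => /andP[Kn Nn].
  have := acts_at_rnorm (acts_atD (Yact n) (acts_at_mult_embed a n)).
  rewrite Sn /z Nn Sn /= => h; have [_ _ <-] := yP n Sn.
  have := rnormD (nceval (y n) u + mult_embed (a n)) (- mult_embed (a n)).
  rewrite addrK rnormN => /le_trans; apply.
  by rewrite lerD// rnorm_mult_embed; exact: hK.
rewrite -[_ ** _]pi_coronaM (M0 (_ ** X)) ?pi_zeror ?rnorm0// => n.
have := c0_cut_acts (pred1 k) (Xact n).
congr acts_at; rewrite /= /z; case: eqP => // ->.
by rewrite leqNgt (ltn_trans _ kN) ?ltnS ?leqnSn.
Qed.

Theorem corona_not_saturated (delta : R) : 0 < delta ->
  infinite_set [set n | S n] ->
  (forall n (a : A n), S n -> rnorm (nceval a t) <= delta -> rnorm (nceval a u) <= 3 / 4) ->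
  (forall n, S n -> exists x : multiplier (A n),
    [/\ rnorm x <= 1, nceval x t = 0 & rnorm (nceval x u) = 1]) ->
  ~ countably_qf_saturated Q.
Proof.
move=> d0 Sinf H1 H2 /(_ (range obstruction_type)) sat.
apply: (obstruction_type_not_realized d0 H1); apply: sat.
  exact: sub_countable (card_image_le _ _) (countableP _).
exact: obstruction_type_satisfiable.
Qed.

End Obstruction.

(** * Projections near almost idempotent self-adjoint elements *)

Section NearIdempotent.
Context (R : realType).

Section LinearCombination.
Context (V : lmodType R[i]) (x1 x2 x3 x4 x5 : V).

(** A normal form for linear identities: once the products are named by five letters, both sides
    become a [lin5] and [ring] compares the scalar coefficients. *)
Definition lin5 (k1 k2 k3 k4 k5 : R[i]) : V :=
  k1 *: x1 + k2 *: x2 + k3 *: x3 + k4 *: x4 + k5 *: x5.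

Lemma lin5D a1 a2 a3 a4 a5 b1 b2 b3 b4 b5 :
  lin5 a1 a2 a3 a4 a5 + lin5 b1 b2 b3 b4 b5 =
  lin5 (a1 + b1) (a2 + b2) (a3 + b3) (a4 + b4) (a5 + b5).
Proof. by rewrite /lin5 !scalerDl; do 4 (rewrite addrACA; congr (_ + _)). Qed.

Lemma lin5N a1 a2 a3 a4 a5 :
  - lin5 a1 a2 a3 a4 a5 = lin5 (- a1) (- a2) (- a3) (- a4) (- a5).
Proof. by rewrite /lin5 !opprD !scaleNr. Qed.

Lemma lin5E : [/\ x1 = lin5 1 0 0 0 0, x2 = lin5 0 1 0 0 0, x3 = lin5 0 0 1 0 0,
  x4 = lin5 0 0 0 1 0 & x5 = lin5 0 0 0 0 1].
Proof. by rewrite /lin5; split; rewrite scale1r !scale0r ?addr0 ?add0r. Qed.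

End LinearCombination.

Lemma cvg_geometric_steps (V : completeNormedModType R[i]) (b : nat -> V) (C : R) :
  0 <= C -> (forall n, rnorm (b n.+1 - b n) <= C / 2 ^+ n) ->
  exists l, forall n, rnorm (l - b n) <= 2 * C / 2 ^+ n.
Proof.
move=> C0 bC.
have p2 n : (0 : R) < 2 ^+ n by rewrite exprn_gt0.
(* The subtracted tail makes the induction close: a step of size [C / 2 ^+ k] is exactly the
   difference of two consecutive tails. *)
have bD n m : rnorm (b (n + m)%N - b n) <= 2 * C / 2 ^+ n - 2 * C / 2 ^+ (n + m).
  elim: m => [|m IH]; first by rewrite addn0 !subrr rnorm0.
  rewrite addnS (le_trans (rnormBD (b (n + m)%N) _ _))//.
  apply: le_trans (lerD (bC _) IH) _; rewrite exprS invfM.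
  have := p2 (n + m)%N; rewrite -invr_gt0.
  by set u := (_ ^+ (n + m))^-1; set w := (_ ^+ n)^-1; nra.
have bD' n m : (n <= m)%N -> rnorm (b m - b n) <= 2 * C / 2 ^+ n.
  move=> /subnKC <-; apply: le_trans (bD _ _) _.
  by rewrite gerBl divr_ge0 ?mulr_ge0// ltW.
have small (e : R) : 0 < e -> \forall n \near \oo, 2 * C / 2 ^+ n < e.
  move=> e0.
  have /cvgrPdist_lt/(_ _ e0) : 2 * C / 2 ^+ n @[n --> \oo] --> (0 : R).
    rewrite -[X in _ --> X](mulr0 (2 * C)); apply: cvgMr.
    under eq_fun do rewrite -exprVn; apply: cvg_expr.
    by rewrite ger0_norm ?invr_ge0// invf_lt1// ltr1n.
  by apply: filterS => n; rewrite sub0r normrN; exact/le_lt_trans/ler_norm.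
have bc : cvg (b @ \oo).
  apply: cauchy_cvg; apply/cauchyP => _ /gtc0E[e e0 ->].
  have [N _ hN] := small _ e0.
  exists (b N); exists N => // n /= Nn.
  rewrite -ball_normE /= rnorm_lt rnormB (le_lt_trans (bD' _ _ Nn))//.
  by apply: hN => /=.
exists (lim (b @ \oo)) => n; apply/ler_addgt0Pl => e e0.
have /cvgrPdist_lt/(_ e%:C%C) := bc; rewrite ltcR => /(_ e0) [N _ hN].
rewrite (le_trans (rnormBD (b (maxn N n)) _ _))// lerD ?bD' ?leq_maxr//.
by rewrite -rnorm_le ltW// hN//= leq_maxl.
Qed.

Definition newton_step (A : starAlgType R) (b : A) : A :=
  let c := b ** b - b in b + (c - b ** c - b ** c).

(* Newton's step [3 b^2 - 2 b^3] for [b^2 = b] squares the defect [c = b^2 - b]. *)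
Lemma newton_step_defect (A : starAlgType R) (b : A) (c := b ** b - b) :
  newton_step b ** newton_step b - newton_step b =
  c ** c ** c + c ** c ** c + c ** c ** c + c ** c ** c - c ** c - c ** c - c ** c.
Proof.
(* All products lie in the commutative algebra generated by [b]. With [b ** b = c + b] they reduce
   to [c], [d = b c], [h = c^2], [g = b c^2] and [k = c^3], and the defect is [4 k - 3 h]. *)
have bc : c ** b = b ** c by rewrite /c smulBl smulBr smulA.
rewrite /newton_step -/c; set f := c - _ - _.
have bb : b ** b = c + b by rewrite /c subrK.
clearbody c.
pose d := b ** c; pose h := c ** c; pose g := d ** c; pose k := c ** c ** c.
have bd : b ** d = h + d by rewrite /d smulA bb smulDl.
have db : d ** b = h + d by rewrite /d -smulA bc bd.
have cd : c ** d = g by rewrite /d smulA bc.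
have dd : d ** d = k + g by rewrite {1}/d -smulA cd /g smulA bd smulDl.
have -> : (b + f) ** (b + f) - (b + f) = c + (b ** f + f ** b + f ** f - f).
  clearbody f.
  apply/eqP; rewrite subr_eq addrACA subrK smulDl !smulDr bb.
  by rewrite !addrA.
rewrite /f -/d -/h -/k !(smulBl, smulBr) bc -/d -/h -/g bd db cd dd.
have := lin5E c d h g k; have := lin5N c d h g k; have := lin5D c d h g k.
move: (lin5 c d h g k) => L LD LN [E1 E2 E3 E4 E5].
by rewrite E1 E2 E3 E4 E5 !(LD, LN); congr L; ring.
Qed.

Section Projection.
Context (A : cstarAlgType R) (b : A) (e : R).
Context (bs : star b = b) (b2 : rnorm b <= 3 / 2) (e1 : e <= 1 / 100).
Context (be : rnorm (b ** b - b) <= e).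

Let bn n := iter n (@newton_step A) b.

Let e0 : 0 <= e. Proof. exact: le_trans (rnorm_ge0 _) be. Qed.

Lemma newton_step_star (x : A) : star x = x -> star (newton_step x) = newton_step x.
Proof.
move=> xs; rewrite /newton_step !(starD, starN, starM) xs.
by rewrite !(smulBr, smulBl) smulA.
Qed.

(** The four bounds feed each other. The new defect consists of seven terms of norm at most
    [rnorm c / 100], which more than halves it. A step [c - 2 b c] with [rnorm b <= 2] costs a
    factor [1 + 2 * 2 = 5]. The norm bound keeps [10 * e / 2 ^+ n] in reserve, the total length of
    the steps still to come; it starts from 3/2 because [10 * e <= 1 / 10]. *)
Lemma newton_iter n : [/\ star (bn n) = bn n,
  rnorm (bn n ** bn n - bn n) <= e / 2 ^+ n,
  rnorm (bn n.+1 - bn n) <= 5 * e / 2 ^+ n &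
  rnorm (bn n) <= 2 - 10 * e / 2 ^+ n].
Proof.
have p2 k : (0 : R) < (2 ^+ k)^-1 by rewrite invr_gt0 exprn_gt0.
have step x r : rnorm x <= 2 -> rnorm (x ** x - x) <= r ->
    rnorm (newton_step x - x) <= 5 * r.
  move=> x2 xr; rewrite /newton_step addrC addKr.
  have := rnorm_ge0 x; have := rnorm_ge0 (x ** x - x).
  have := rnormM x (x ** x - x); move: (x ** x - x) xr => c cr.
  have := rnormD (c - x ** c) (- (x ** c)); have := rnormD c (- (x ** c)).
  rewrite !rnormN; nra.
elim: n => [|n [IHs IHc IHd IHb]].
  rewrite /bn /= expr0 invr1 !mulr1; split => //; last first.
    by apply: le_trans b2 _; move: e1; lra.
  by apply: step => //; apply: le_trans b2 _; lra.
have sn : star (bn n.+1) = bn n.+1 by exact: newton_step_star.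
have := p2 n; have : (2 ^+ n)^-1 <= 1 :> R by rewrite invf_le1 ?exprn_gt0// exprn_ege1// ler1n.
move=> q1 q0.
have bc : rnorm (bn n.+1 ** bn n.+1 - bn n.+1) <= e / 2 ^+ n.+1.
  rewrite /= newton_step_defect exprS invfM.
  move: IHc; move: (bn n ** bn n - bn n) => c cr.
  have h1 := rnormM c c; have h2 := rnormM (c ** c) c.
  have c0 := rnorm_ge0 c; have cc0 := rnorm_ge0 (c ** c).
  move: (rnormD (c ** c ** c) (c ** c ** c)) (rnormD (c ** c ** c + c ** c ** c) (c ** c ** c))
    (rnormD (c ** c ** c + c ** c ** c + c ** c ** c) (c ** c ** c)).
  move: (c ** c ** c + c ** c ** c + c ** c ** c + c ** c ** c) => K.
  move: (rnormD K (- (c ** c))) (rnormD (K - c ** c) (- (c ** c))) (rnormD (K - c ** c - c ** c) (- (c ** c))).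
  rewrite !rnormN => *.
  have c1 : rnorm c <= 1 / 100.
    by apply: le_trans cr _; apply: le_trans e1; rewrite ler_piMr.
  have cc : rnorm (c ** c) <= rnorm c / 100.
    by apply: le_trans h1 _; rewrite ler_wpM2l//; lra.
  have ccc : rnorm (c ** c ** c) <= rnorm c / 100.
    by apply: le_trans h2 _; rewrite mulrC ler_wpM2l//; lra.
  lra.
have bb : rnorm (bn n.+1) <= 2 - 10 * e / 2 ^+ n.+1.
  rewrite -[bn n.+1](subrK (bn n)) (le_trans (rnormD _ _))// exprS invfM; lra.
split=> //; rewrite -mulrA; apply: step bc; apply: le_trans bb _.
by rewrite gerBl mulr_ge0 ?(ltW (p2 _))// mulr_ge0.
Qed.

Lemma projection_near : exists2 p : A, projection p & rnorm (p - b) <= 10 * e.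
Proof.
have [|n|p pP] := @cvg_geometric_steps A bn (5 * e).
- by rewrite mulr_ge0.
- by have [] := newton_iter n.
have p2 k : (0 : R) < (2 ^+ k)^-1 by rewrite invr_gt0 exprn_gt0.
have small (d : R) : 0 < d -> exists n, (2 ^+ n)^-1 <= d :> R.
  move=> d0; have /cvgrPdist_le/(_ _ d0)[N _ hN] : (2 ^+ n)^-1 @[n --> \oo] --> (0 : R).
    under eq_fun do rewrite -exprVn; apply: cvg_expr.
    by rewrite ger0_norm ?invr_ge0// invf_lt1// ltr1n.
  by exists N; have := hN N (leqnn _); rewrite sub0r normrN ger0_norm// ltW.
exists p; last by have := pP 0%N; rewrite expr0 divr1 mulrA -natrM.
(* With [p - bn n] of norm at most [10 e / 2^n], the three parts of [p ** p - p] cost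
   [10 e (rnorm p + 2)], [e] and [10 e], each over [2^n]. The same [K] covers the [20 e] needed for
   self-adjointness. *)
set K := 10 * e * (rnorm p + 3) + e.
have K0 : 20 * e <= K by rewrite /K; have := rnorm_ge0 p; have := e0; nra.
split; apply: (@rnorm_eq _ _ K) => d /small[n nd];
    apply: le_trans (_ : K * (2 ^+ n)^-1 <= _); rewrite ?ler_wpM2l//;
    try by apply: le_trans K0; rewrite mulr_ge0.
  have [_ bc _ bb] := newton_iter n.
  have bb2 : rnorm (bn n) <= 2.
    by apply: le_trans bb _; rewrite gerBl mulr_ge0 ?(ltW (p2 _))// mulr_ge0.
  have hp := pP n; have := p2 n; move: (2 ^+ n)^-1 => q in bc hp * => q0.
  have -> : p ** p - p = (p ** (p - bn n) + (p - bn n) ** bn n) +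
      (bn n ** bn n - bn n) + (bn n - p).
    by rewrite smulBl smulBr !subrKA.
  apply: le_trans (rnormD _ _) _; rewrite (rnormB (bn n)).
  apply: le_trans (lerD (rnormD _ _) (lexx _)) _.
  apply: le_trans (lerD (lerD (rnormD _ _) (lexx _)) (lexx _)) _.
  have h1 := rnormM p (p - bn n); have h2 := rnormM (p - bn n) (bn n).
  have h3 : rnorm p * rnorm (p - bn n) <= rnorm p * (2 * (5 * e) * q).
    by rewrite ler_wpM2l ?rnorm_ge0.
  have h4 : rnorm (p - bn n) * rnorm (bn n) <= (2 * (5 * e) * q) * 2.
    by rewrite ler_pM ?rnorm_ge0.
  by rewrite /K; lra.
have [bns _ _ _] := newton_iter n; have hp := pP n.
rewrite (le_trans (rnormBD (bn n) _ _))// (rnormB (bn n)) -{1}bns -starB rnorm_star.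
apply: le_trans (lerD hp hp) _.
by rewrite -mulrDl ler_wpM2r ?(ltW (p2 _))//; apply: le_trans K0; lra.
Qed.

End Projection.

(** * The projectionless case *)

(** The single relation [star a ** a = a] expresses both self-adjointness and idempotence. If it
    holds up to 1/1000, then [b = star a ** a] is self-adjoint with idempotency defect at most
    1/100, hence within 1/10 of a projection. That projection is 0, since otherwise it would be a
    unit, and so [rnorm a ^+ 2 = rnorm b <= 1 / 10]. *)
Lemma projectionless_gap (A : cstarAlgType R) (a : A) :
  ~ unital A -> projectionless A ->
  rnorm (star a ** a - a) <= 1 / 1000 -> rnorm a <= 3 / 4.
Proof.
move=> nu pl; set b := star a ** a => ba.
have bs : star b = b by rewrite /b starM starK.
have a0 := rnorm_ge0 a.
have bn : rnorm b = rnorm a ^+ 2 by rewrite rnorm_cstar.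
have a1 : rnorm a <= 101 / 100.
  have := rnormD (b - a) a; rewrite subrK bn; nra.
have bas : rnorm (b - star a) <= 1 / 1000 by rewrite -bs -starB rnorm_star.
have bb : rnorm (b ** b - b) <= 1 / 100.
  (* Both [a] and [star a] are within 1/1000 of [b], and [star a ** a] is [b] itself. *)
  have -> : b ** b - b = (b - star a) ** b + star a ** (b - a).
    by rewrite smulBl smulBr -/b addrA subrK.
  apply: le_trans (rnormD _ _) _.
  have := rnormM (b - star a) b; have := rnormM (star a) (b - a).
  rewrite rnorm_star bn; have := rnorm_ge0 (b - a); have := rnorm_ge0 (b - star a); nra.
have b32 : rnorm b <= 3 / 2 by rewrite bn; nra.
have [p pp pb] := projection_near bs b32 (lexx _) bb.
have [p0|p1] := pl p pp; last by case: nu; exists p.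
by move: pb; rewrite p0 sub0r rnormN bn; nra.
Qed.

End NearIdempotent.

Lemma mult_one_rnorm_eq1 (R : realType) (A : cstarAlgType R) (a : A) :
  a != 0 -> rnorm (mult_one A) = 1.
Proof.
move=> a0; apply/eqP; rewrite eq_le mult_one_rnorm/=.
have := mult_normP (mult_one A) a => /=; rewrite ler_pMr//.
rewrite lt_neqAle rnorm_ge0 andbT eq_sym.
by apply: contra a0 => /eqP/rnorm0_eq0 ->.
Qed.

Lemma projectionless_corona_not_saturated (R : realType) (A : nat -> cstarAlgType R) :
  (forall n, ~ unital (A n)) ->
  infinite_set [set n | projectionless (A n)] ->
  ~ countably_qf_saturated (corona (c0_sum A)).
Proof.
move=> nu pinf.
apply: (@corona_not_saturated R A
  (NCAdd (NCMul (NCStar NCVar) NCVar) (NCScale (-1) NCVar)) NCVar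
  (fun n => `[< projectionless (A n) >]) (1 / 1000)).
- by lra.
- by apply: contra_not pinf; apply: sub_finite_set => n /= pn; exact/asboolP.
- by move=> n a /asboolP pn /=; rewrite scaleN1r; exact: projectionless_gap.
move=> n _; exists (mult_one (A n)); split; first exact: mult_one_rnorm.
  by apply: mult_ext => a /=; rewrite starK scaleN1r subrr.
(* The zero algebra counts as unital, with unit 0. A nonzero element gives the multiplier 1 norm
   exactly 1. *)
have [a a0] : exists a : A n, a != 0.
  apply: contrapT => h; apply: (nu n); exists 0 => x.
  have -> : x = 0 by apply: contrapT => /eqP x0; apply: h; exists x.
  by rewrite smulx0.
exact: mult_one_rnorm_eq1 a0.
Qed.

(** * The Hilbert space l2 *)

Lemma discr_ge0 (R : realType) (a b c : R) :
  0 <= b -> (forall t, 0 <= a + 2 * t * c + t ^+ 2 * b) -> c ^+ 2 <= a * b.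
Proof.
move=> b0 h; have [b0'|bn0] := eqVneq b 0.
  have [->|c0] := eqVneq c 0; first by rewrite b0' expr0n mulr0.
  (* For [b = 0] the expression is affine in [t], and this choice gives it the value -1. *)
  have := h (- (a + 1) / (2 * c)); rewrite b0' mulr0 addr0.
  by rewrite (_ : 2 * _ * c = - (a + 1)); [lra|field].
have bp : 0 < b by rewrite lt_neqAle eq_sym bn0.
have := h (- c / b); rewrite -(pmulr_lge0 _ bp).
by rewrite (_ : (_ + _) * b = a * b - c ^+ 2); [lra|field].
Qed.

Section L2.
Context (R : realType).

(** The real part of [z] times the conjugate of [w]. The real inner product is enough, with complex
    scalars moved across it by conjugation as in [rdotZ]. *)
Definition rdot (z w : R[i]) : R :=
  complex.Re z * complex.Re w + complex.Im z * complex.Im w.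

Lemma rdotC z w : rdot z w = rdot w z.
Proof. by rewrite /rdot; ring. Qed.

Lemma rdotDl z z' w : rdot (z + z') w = rdot z w + rdot z' w.
Proof. by case: z z' => [a b] [a' b']; rewrite /rdot /=; ring. Qed.

Lemma rdotZ k z w : rdot (k * z) w = rdot z ((k^*)%C * w).
Proof. by case: k z w => [k l] [a b] [a' b']; rewrite /rdot /=; ring. Qed.

Lemma rdot_ge0 z : 0 <= rdot z z.
Proof. by rewrite /rdot addr_ge0// -expr2 sqr_ge0. Qed.

Lemma rdotZZ k z : rdot (k * z) (k * z) = Normc.normc k ^+ 2 * rdot z z.
Proof.
case: k z => [k l] [a b]; rewrite /rdot /= sqr_sqrtr ?addr_ge0 ?sqr_ge0//; ring.
Qed.

Definition qpart (x : nat -> R[i]) N : R := \sum_(i < N) rdot (x i) (x i).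

Lemma qpart_ge0 x N : 0 <= qpart x N.
Proof. by apply: sumr_ge0 => i _; exact: rdot_ge0. Qed.

Lemma qpart_nondecreasing x : nondecreasing_seq (qpart x).
Proof.
apply/nondecreasing_seqP => N; rewrite /qpart big_ord_recr/= lerDl; exact: rdot_ge0.
Qed.

Lemma qpart_add x y N : qpart (fun i => x i + y i) N <= 2 * qpart x N + 2 * qpart y N.
Proof.
rewrite /qpart !mulr_sumr -big_split/=; apply: ler_sum => i _.
have := rdot_ge0 (x i - y i); move: (x i) (y i) => [a b] [a' b'].
rewrite /rdot /=; nra.
Qed.

Lemma qpart_scale k x N :
  qpart (fun i => k * x i) N = Normc.normc k ^+ 2 * qpart x N.
Proof. by rewrite /qpart mulr_sumr; apply: eq_bigr => i _; exact: rdotZZ. Qed.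

Record l2 := L2 {
  l2_coord :> nat -> R[i];
  l2_bounded : exists M, forall N, qpart l2_coord N <= M }.

HB.instance Definition _ := gen_eqMixin l2.
HB.instance Definition _ := gen_choiceMixin l2.

Implicit Types x y z : l2.

Lemma l2_ext x y : (forall n, x n = y n) -> x = y.
Proof.
case: x y => [x px] [y py] /= /funext xy.
by rewrite -{y}xy in py *; rewrite (Prop_irrelevance px py).
Qed.

Fact l2_zero_bounded : exists M, forall N, qpart (fun=> 0) N <= M.
Proof.
by exists 0 => N; rewrite /qpart big1// => i _; rewrite /rdot /= mulr0 addr0.
Qed.

Fact l2_scale_bounded k x : exists M, forall N, qpart (fun i => k * x i) N <= M.
Proof.
have [M xM] := l2_bounded x; exists (Normc.normc k ^+ 2 * M) => N.
by rewrite qpart_scale ler_wpM2l ?sqr_ge0.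
Qed.

Fact l2_add_bounded x y : exists M, forall N, qpart (fun i => x i + y i) N <= M.
Proof.
have [M xM] := l2_bounded x; have [K yK] := l2_bounded y; exists (2 * M + 2 * K) => N.
by apply: le_trans (qpart_add _ _ _) _; rewrite lerD// ler_pM2l.
Qed.

Definition l2_zero := L2 l2_zero_bounded.
Definition l2_scale k x := L2 (l2_scale_bounded k x).
Definition l2_opp x := l2_scale (-1) x.
Definition l2_add x y := L2 (l2_add_bounded x y).

Fact l2_addA : associative l2_add.
Proof. by move=> x y z; apply: l2_ext => n /=; rewrite addrA. Qed.
Fact l2_addC : commutative l2_add.
Proof. by move=> x y; apply: l2_ext => n /=; rewrite addrC. Qed.
Fact l2_add0 : left_id l2_zero l2_add.
Proof. by move=> x; apply: l2_ext => n /=; rewrite add0r. Qed.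
Fact l2_addN : left_inverse l2_zero l2_opp l2_add.
Proof. by move=> x; apply: l2_ext => n /=; rewrite mulN1r addNr. Qed.

HB.instance Definition _ :=
  GRing.isZmodule.Build l2 l2_addA l2_addC l2_add0 l2_addN.

Fact l2_scaleA (a b : R[i]) x : l2_scale a (l2_scale b x) = l2_scale (a * b) x.
Proof. by apply: l2_ext => n /=; rewrite mulrA. Qed.
Fact l2_scale1 : left_id 1 l2_scale.
Proof. by move=> x; apply: l2_ext => n /=; rewrite mul1r. Qed.
Fact l2_scaleDr : right_distributive l2_scale +%R.
Proof. by move=> k x y; apply: l2_ext => n /=; rewrite mulrDr. Qed.
Fact l2_scaleDl x : {morph l2_scale^~ x : a b / a + b}.
Proof. by move=> a b; apply: l2_ext => n /=; rewrite mulrDl. Qed.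

HB.instance Definition _ := GRing.Zmodule_isLmodule.Build R[i] l2
  l2_scaleA l2_scale1 l2_scaleDr l2_scaleDl.

Lemma l2_coordD x y n : (x + y) n = x n + y n. Proof. by []. Qed.
Lemma l2_coordZ k x n : (k *: x) n = k * x n. Proof. by []. Qed.
Lemma l2_coordN x n : (- x) n = - x n. Proof. by rewrite -mulN1r. Qed.
Lemma l2_coordB x y n : (x - y) n = x n - y n.
Proof. by rewrite l2_coordD l2_coordN. Qed.

Definition l2_sq x : R := lim (qpart x @ \oo).

Lemma l2_sq_cvg x : qpart x @ \oo --> l2_sq x.
Proof.
apply: nondecreasing_is_cvgn; first exact: qpart_nondecreasing.
by have [M xM] := l2_bounded x; exists M => _ [N _ <-]; exact: xM.
Qed.

Lemma qpart_le_sq x N : qpart x N <= l2_sq x.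
Proof.
apply: nondecreasing_cvgn_le; first exact: qpart_nondecreasing.
by apply/cvg_ex; exists (l2_sq x); exact: l2_sq_cvg.
Qed.

Lemma l2_sq_le x M : (forall N, qpart x N <= M) -> l2_sq x <= M.
Proof.
move=> xM; apply: limr_le; first by apply/cvg_ex; exists (l2_sq x); exact: l2_sq_cvg.
by near=> N.
Unshelve. all: by end_near. Qed.

Lemma l2_sq_ge0 x : 0 <= l2_sq x.
Proof. exact: le_trans (qpart_ge0 x 0) (qpart_le_sq _ _). Qed.

(** Polarization yields the inner product from limits of nondecreasing sums. [rip_cvg] identifies it
    with the limit of partial sums, from which [rip_unique] derives the algebraic laws. *)
Definition rip x y : R := (l2_sq (x + y) - l2_sq x - l2_sq y) / 2.

Lemma rip_cvg x y : \sum_(i < N) rdot (x i) (y i) @[N --> \oo] --> rip x y.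
Proof.
have -> : (fun N => \sum_(i < N) rdot (x i) (y i)) =
    (fun N => (qpart (x + y) N - qpart x N - qpart y N) / 2).
  apply/funext => N; rewrite /qpart -!sumrB mulr_suml; apply: eq_bigr => i _.
  by rewrite l2_coordD !(rdotDl, rdotC _ (_ + _)) (rdotC (y i) (x i)); field.
by apply: cvgMl; apply: cvgB; [apply: cvgB|]; exact: l2_sq_cvg.
Qed.

Lemma rip_unique x y (u : nat -> R) l :
  (forall N, \sum_(i < N) rdot (x i) (y i) = u N) -> u @ \oo --> l -> rip x y = l.
Proof.
move=> /funext xyu /(cvg_lim (@Rhausdorff R)) <-.
by rewrite -xyu (cvg_lim (@Rhausdorff R) (@rip_cvg x y)).
Qed.

Lemma ripC x y : rip x y = rip y x.
Proof.
by apply: rip_unique (@rip_cvg y x) => N; apply: eq_bigr => i _; rewrite rdotC.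
Qed.

Lemma ripDl x y z : rip (x + y) z = rip x z + rip y z.
Proof.
apply: (@rip_unique _ _ (fun N => \sum_(i < N) rdot (x i) (z i) +
    \sum_(i < N) rdot (y i) (z i))) => [N|]; last by apply: cvgD; exact: rip_cvg.
by rewrite -big_split; apply: eq_bigr => i _; rewrite rdotDl.
Qed.

Lemma ripZ k x y : rip (k *: x) y = rip x ((k^*)%C *: y).
Proof.
by apply: rip_unique (@rip_cvg x ((k^*)%C *: y)) => N; apply: eq_bigr => i _; rewrite rdotZ.
Qed.

Lemma rip_sq x : rip x x = l2_sq x.
Proof. by apply: rip_unique (@l2_sq_cvg x). Qed.

Lemma ripDr x y z : rip z (x + y) = rip z x + rip z y.
Proof. by rewrite ripC ripDl !(ripC _ z). Qed.

Lemma ripNl x y : rip (- x) y = - rip x y.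
Proof.
apply/eqP; rewrite -subr_eq0 opprK -ripDl addNr; apply/eqP.
apply: rip_unique (cvg_cst 0) => N.
by rewrite big1// => i _; rewrite /rdot /= !mul0r addr0.
Qed.

Lemma ripNr x y : rip x (- y) = - rip x y.
Proof. by rewrite ripC ripNl ripC. Qed.

Lemma ripBl x y z : rip (x - y) z = rip x z - rip y z.
Proof. by rewrite ripDl ripNl. Qed.

Lemma ripBr x y z : rip z (x - y) = rip z x - rip z y.
Proof. by rewrite ripDr ripNr. Qed.

Lemma l2_sqZ k x : l2_sq (k *: x) = Normc.normc k ^+ 2 * l2_sq x.
Proof.
rewrite -rip_sq; apply: (@rip_unique _ _ (fun N => Normc.normc k ^+ 2 * qpart x N)) => [N|].
  by rewrite -qpart_scale.
by apply: cvgMr; exact: l2_sq_cvg.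
Qed.

Lemma l2_sqD x y : l2_sq (x + y) = l2_sq x + 2 * rip x y + l2_sq y.
Proof. by rewrite -!rip_sq ripDl !ripDr (ripC y x); ring. Qed.

Definition l2_norm x : R := Num.sqrt (l2_sq x).

Lemma l2_norm_ge0 x : 0 <= l2_norm x. Proof. exact: sqrtr_ge0. Qed.

Lemma l2_normK x : l2_norm x ^+ 2 = l2_sq x.
Proof. by rewrite sqr_sqrtr// l2_sq_ge0. Qed.

Lemma rip_le x y : rip x y <= l2_norm x * l2_norm y.
Proof.
apply: le_trans (ler_norm _) _; rewrite -ler_sqr ?nnegrE ?mulr_ge0 ?l2_norm_ge0//.
rewrite real_normK ?num_real// [leRHS]exprMn !l2_normK; apply: discr_ge0; first exact: l2_sq_ge0.
move=> t; have := l2_sq_ge0 (x + t%:C%C *: y).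
rewrite l2_sqD l2_sqZ ripC ripZ conjc_real.
have -> : rip y (t%:C%C *: x) = t * rip x y.
  apply: (@rip_unique _ _ (fun N => t * \sum_(i < N) rdot (x i) (y i))) => [N|]; last first.
    by apply: cvgMr; exact: rip_cvg.
  rewrite mulr_sumr; apply: eq_bigr => i _.
  by rewrite l2_coordZ; move: (x i) (y i) => [a b] [a' b']; rewrite /rdot /=; ring.
by rewrite /= expr0n addr0 sqr_sqrtr ?sqr_ge0// mulrA.
Qed.

Fact l2_normD x y : (l2_norm (x + y))%:C%C <= (l2_norm x)%:C%C + (l2_norm y)%:C%C.
Proof.
rewrite -rmorphD lecR -ler_sqr ?nnegrE ?addr_ge0 ?l2_norm_ge0//.
rewrite l2_normK l2_sqD sqrrD !l2_normK lerD2r lerD2l mulr_natl mulr2n -mulr2n lerMn2r.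
exact: rip_le.
Qed.

Fact l2_normZ (k : R[i]) x : (l2_norm (k *: x))%:C%C = `|k| * (l2_norm x)%:C%C.
Proof.
rewrite -[`|k|]/((Normc.normc k)%:C%C) -rmorphM; congr (_%:C%C).
rewrite /l2_norm l2_sqZ sqrtrM ?sqr_ge0// sqrtr_sqr ger0_norm//.
by rewrite -ler0c -[leRHS]/(`|k|).
Qed.

Lemma rdot_coord_le x n : rdot (x n) (x n) <= l2_sq x.
Proof.
apply: le_trans (qpart_le_sq x n.+1); rewrite /qpart big_ord_recr /= lerDr.
exact: qpart_ge0.
Qed.

Lemma rdot_eq0 (z : R[i]) : rdot z z <= 0 -> z = 0.
Proof.
case: z => a b; rewrite /rdot /= => h; have [a0 b0] : a = 0 /\ b = 0 by split; nra.
by rewrite a0 b0.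
Qed.

Fact l2_norm0_eq0 x : (l2_norm x)%:C%C = 0 -> x = 0.
Proof.
move=> /complexI x0; apply: l2_ext => n; apply: rdot_eq0.
by apply: le_trans (rdot_coord_le x n) _; rewrite -l2_normK x0 expr0n.
Qed.

HB.instance Definition _ := Lmodule_isNormed.Build R[i] l2
  l2_normD l2_normZ l2_norm0_eq0.

Lemma l2_rnormE x : rnorm x = l2_norm x. Proof. by []. Qed.

Lemma rip_rnorm x : rip x x = rnorm x ^+ 2.
Proof. by rewrite rip_sq l2_rnormE l2_normK. Qed.

Lemma rip_le_rnorm x y : rip x y <= rnorm x * rnorm y.
Proof. exact: rip_le. Qed.

Lemma rip_ext x y : (forall z, rip x z = rip y z) -> x = y.
Proof.
move=> xy; apply/eqP; rewrite -subr_eq0; apply/eqP/rnorm0_eq0/eqP.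
by rewrite -sqrf_eq0 -rip_rnorm ripBl xy subrr.
Qed.

Lemma l2_rnorm_le x (e : R) : 0 <= e -> (forall N, qpart x N <= e ^+ 2) -> rnorm x <= e.
Proof.
move=> e0 h; rewrite -ler_sqr ?nnegrE ?rnorm_ge0// l2_rnormE l2_normK.
exact: l2_sq_le.
Qed.

(** The norm is not a supremum over single coordinates, so [complete_ev] does not apply to them.
    Real and imaginary parts converge in each coordinate, and bounds on the finite sums [qpart] pass
    to the limit. *)
Fact l2_complete (F : set_system l2) : ProperFilter F -> cauchy F -> cvg F.
Proof.
move=> FF Fc.
have Fx (e : R) : 0 < e -> exists x, F [set y | rnorm (x - y) < e].
  move=> e0; have e0C : 0 < e%:C%C by rewrite ltcR.
  have /cauchyP /(_ _ e0C)[x Fx] := Fc.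
  exists x; apply: filterS Fx => y /=.
  by rewrite -ball_normE /= rnorm_lt.
have cv (f : R[i] -> R) : (forall a b, f (a - b) = f a - f b) ->
    (forall z : R[i], f z ^+ 2 <= rdot z z) -> forall i, cvg ((fun y : l2 => f (y i)) @ F).
  move=> fB fn i; apply: cauchy_cvg; apply/cauchyP => e e0.
  have [x Fxe] := Fx _ e0; exists (f (x i)); rewrite /nbhs/=.
  apply: filterS Fxe => y /= xy; rewrite -ball_normE /= -fB -l2_coordB.
  apply: le_lt_trans xy; rewrite -ler_sqr ?nnegrE ?rnorm_ge0// real_normK ?num_real//.
  by apply: le_trans (fn _) _; rewrite l2_rnormE l2_normK rdot_coord_le.
have cRe i : cvg ((fun y : l2 => complex.Re (y i)) @ F).
  apply: (cv (@complex.Re R)) => [[a b] [c d]//|[a b]]; rewrite /rdot /=; nra.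
have cIm i : cvg ((fun y : l2 => complex.Im (y i)) @ F).
  apply: (cv (@complex.Im R)) => [[a b] [c d]//|[a b]]; rewrite /rdot /=; nra.
pose l i : R[i] := (lim ((fun y : l2 => complex.Re (y i)) @ F) +i*
  lim ((fun y : l2 => complex.Im (y i)) @ F))%C.
have lx x (e : R) : F [set y | rnorm (x - y) < e] ->
    forall N, qpart (fun i => l i - x i) N <= e ^+ 2.
  move=> Fxe N.
  have cq : (fun y : l2 => qpart (fun i => y i - x i) N) @ F --> qpart (fun i => l i - x i) N.
    rewrite /qpart; elim: N => [|N IH].
      by under eq_fun do rewrite big_ord0; rewrite big_ord0; exact: cvg_cst.
    under eq_fun do rewrite big_ord_recr; rewrite big_ord_recr; apply: cvgD => //.
    rewrite /rdot /=; set i := N.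
    have hR : (fun y : l2 => complex.Re (y i - x i)) @ F --> complex.Re (l i - x i).
      under eq_fun do rewrite raddfB; rewrite raddfB; apply: cvgB (cvg_cst _); exact: cRe.
    have hI : (fun y : l2 => complex.Im (y i - x i)) @ F --> complex.Im (l i - x i).
      under eq_fun do rewrite raddfB; rewrite raddfB; apply: cvgB (cvg_cst _); exact: cIm.
    by apply: cvgD; apply: cvgM.
  rewrite -(cvg_lim (@Rhausdorff R) cq); apply: limr_le; first by apply/cvg_ex; eexists; exact: cq.
  apply: filterS Fxe => y /= xy; apply: (@le_trans _ _ (qpart (l2_coord (y - x)) N)).
    rewrite le_eqVlt; apply/orP; left; apply/eqP; apply: eq_bigr => i _.
    by rewrite l2_coordB.
  apply: le_trans (qpart_le_sq _ _) _; rewrite -l2_normK -l2_rnormE rnormB.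
  by apply: lerXn2r; rewrite ?nnegrE ?rnorm_ge0 ?(le_trans (rnorm_ge0 _) (ltW xy))// ltW.
(* The limit is square summable because it differs from a fixed element [x] by a sequence whose
   partial sums are at most 1. *)
have [v vl] : exists v : l2, forall i, v i = l i.
  have [x /lx hx] := Fx _ ltr01.
  have [w wl] : exists w : l2, forall i, w i = l i - x i.
    by unshelve eexists; [exists (fun i => l i - x i); exists (1 ^+ 2); exact: hx|].
  by exists (w + x) => i; rewrite l2_coordD wl subrK.
apply/cvg_ex; exists v; apply/cvgrPdist_lt => _ /gtc0E[e e0 ->].
have e20 : 0 < e / 2 by rewrite divr_gt0.
have [x Fxe] := Fx _ e20.
apply: filterS (Fxe) => y /= xy; rewrite rnorm_lt.
rewrite (le_lt_trans (rnormBD x _ _))// [e]splitr ler_ltD//.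
apply: l2_rnorm_le; first exact: ltW.
move=> N; apply: le_trans (lx _ _ Fxe N).
rewrite le_eqVlt; apply/orP; left; apply/eqP; apply: eq_bigr => i _.
by rewrite l2_coordB vl.
Qed.

HB.instance Definition _ := Uniform_isComplete.Build l2 l2_complete.

End L2.

(** * Bounded operators on l2 *)

Section Bop.
Context (R : realType).
Let H := l2 R.

(* The adjoint is taken for the real inner product [Re <x, y>]; homogeneity makes
   it the complex adjoint. *)
Record bop := Bop {
  bfun :> H -> H;
  badj : H -> H;
  bopP : forall x y, rip (bfun x) y = rip x (badj y);
  bopZ : forall (k : R[i]) x, bfun (k *: x) = k *: bfun x;
  bop_bounded : exists M : R, forall x, rnorm (bfun x) <= M * rnorm x }.

HB.instance Definition _ := gen_eqMixin bop.
HB.instance Definition _ := gen_choiceMixin bop.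

Implicit Types (f g h : bop) (x y z : H).

Lemma bop_ext f g : f =1 g -> f = g.
Proof.
case: f g => [f f' p1 p2 p3] [g g' q1 q2 q3] /= /funext fg.
rewrite -{g}fg in q1 q2 q3 *.
have fg' : f' = g'.
  by apply/funext => x; apply: rip_ext => z; rewrite !(ripC _ z) -p1 -q1.
by rewrite -{g'}fg' in q1 *; congr Bop; exact: Prop_irrelevance.
Qed.

(** A map with an adjoint is automatically additive: both sides pair equally with every [z]. *)
Lemma bopD f x y : f (x + y) = f x + f y.
Proof. by apply: rip_ext => z; rewrite ripDl !bopP ripDl. Qed.

Lemma bop0 f : f 0 = 0.
Proof. by rewrite -[X in f X](scale0r (0 : H)) bopZ scale0r. Qed.

Lemma bopN f x : f (- x) = - f x.
Proof. by rewrite -scaleN1r bopZ scaleN1r. Qed.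

Lemma bopB f x y : f (x - y) = f x - f y.
Proof. by rewrite bopD bopN. Qed.

Lemma bop_boundedP f : exists2 M : R, 0 <= M & forall x, rnorm (f x) <= M * rnorm x.
Proof.
have [M fM] := bop_bounded f; exists `|M| => // x; rewrite (le_trans (fM x))//.
by rewrite ler_wpM2r ?rnorm_ge0 ?ler_norm.
Qed.

(** Pairing [u (v x)] with [x] bounds the square of [rnorm (v x)] by [rnorm (v x) * M * rnorm x];
    one factor cancels. *)
Lemma badj_bound (u v : H -> H) (M : R) : 0 <= M ->
  (forall x y, rip (u x) y = rip x (v y)) ->
  (forall x, rnorm (u x) <= rnorm x * M) -> forall x, rnorm (v x) <= rnorm x * M.
Proof.
move=> M0 uv uM x; have := rip_le_rnorm (u (v x)) x; rewrite uv rip_rnorm expr2 => h.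
have := rnorm_ge0 (v x); rewrite le_eqVlt => /predU1P[<-|v0].
  by rewrite mulr_ge0 ?rnorm_ge0.
rewrite -(ler_pM2l v0); apply: le_trans h _; rewrite mulrCA mulrC.
by rewrite ler_wpM2l ?rnorm_ge0.
Qed.

Program Definition bop_zero : bop := @Bop (fun=> 0) (fun=> 0) _ _ _.
Next Obligation. by move=> x y; rewrite -(subrr 0) ripBl ripBr !subrr. Qed.
Next Obligation. by move=> k x; rewrite scaler0. Qed.
Next Obligation. by exists 0 => x; rewrite rnorm0 mul0r. Qed.

Program Definition bop_one : bop := @Bop id id _ _ _.
Next Obligation. by []. Qed.
Next Obligation. by []. Qed.
Next Obligation. by exists 1 => x; rewrite mul1r. Qed.

Program Definition bop_scale (k : R[i]) f : bop :=
  @Bop (fun x => k *: f x) (fun x => badj f ((k^*)%C *: x)) _ _ _.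
Next Obligation. by move=> k f x y; rewrite -bopP ripZ. Qed.
Next Obligation. by move=> k f l x /=; rewrite bopZ !scalerA mulrC. Qed.
Next Obligation.
move=> k f; have [M M0 fM] := bop_boundedP f; exists (Normc.normc k * M) => x.
rewrite rnormZ -mulrA ler_wpM2l//.
by rewrite -ler0c -[leRHS]/(`|k|).
Qed.

Program Definition bop_add f g : bop :=
  @Bop (fun x => f x + g x) (fun x => badj f x + badj g x) _ _ _.
Next Obligation. by move=> f g x y; rewrite ripDl ripDr !bopP. Qed.
Next Obligation. by move=> f g k x /=; rewrite !bopZ scalerDr. Qed.
Next Obligation.
move=> f g; have [M fM] := bop_bounded f; have [N gN] := bop_bounded g.
exists (M + N) => x; by rewrite (le_trans (rnormD _ _))// mulrDl lerD.
Qed.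

Definition bop_opp f := bop_scale (-1) f.

Program Definition bop_mul f g : bop :=
  @Bop (fun x => f (g x)) (fun x => badj g (badj f x)) _ _ _.
Next Obligation. by move=> f g x y; rewrite !bopP. Qed.
Next Obligation. by move=> f g k x /=; rewrite !bopZ. Qed.
Next Obligation.
move=> f g; have [M M0 fM] := bop_boundedP f; have [N gN] := bop_bounded g.
exists (M * N) => x; by rewrite (le_trans (fM _))// -mulrA ler_wpM2l.
Qed.

Program Definition bop_star f : bop := @Bop (badj f) f _ _ _.
Next Obligation. by move=> f x y; rewrite ripC -bopP ripC. Qed.
Next Obligation.
move=> f k x; apply: rip_ext => z.
by rewrite ripC -bopP ripC ripZ -bopZ ripC bopP ripC -ripZ.
Qed.
Next Obligation.
move=> f; have [M M0 fM] := bop_boundedP f; exists M => x; rewrite mulrC.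
by apply: (@badj_bound f) => // [y z|y]; [exact: bopP|rewrite mulrC].
Qed.

Fact bop_addA : associative bop_add.
Proof. by move=> x y z; apply: bop_ext => a /=; rewrite addrA. Qed.
Fact bop_addC : commutative bop_add.
Proof. by move=> x y; apply: bop_ext => a /=; rewrite addrC. Qed.
Fact bop_add0 : left_id bop_zero bop_add.
Proof. by move=> x; apply: bop_ext => a /=; rewrite add0r. Qed.
Fact bop_addN : left_inverse bop_zero bop_opp bop_add.
Proof. by move=> x; apply: bop_ext => a /=; rewrite scaleN1r addNr. Qed.

HB.instance Definition _ :=
  GRing.isZmodule.Build bop bop_addA bop_addC bop_add0 bop_addN.

Fact bop_scaleA (a b : R[i]) f : bop_scale a (bop_scale b f) = bop_scale (a * b) f.
Proof. by apply: bop_ext => n /=; rewrite scalerA. Qed.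
Fact bop_scale1 : left_id 1 bop_scale.
Proof. by move=> x; apply: bop_ext => n /=; rewrite scale1r. Qed.
Fact bop_scaleDr : right_distributive bop_scale +%R.
Proof. by move=> k x y; apply: bop_ext => n /=; rewrite scalerDr. Qed.
Fact bop_scaleDl f : {morph bop_scale^~ f : a b / a + b}.
Proof. by move=> a b; apply: bop_ext => n /=; rewrite scalerDl. Qed.

HB.instance Definition _ := GRing.Zmodule_isLmodule.Build R[i] bop
  bop_scaleA bop_scale1 bop_scaleDr bop_scaleDl.

Fact bop_mulA : associative bop_mul.
Proof. by move=> x y z; exact: bop_ext. Qed.
Fact bop_mulDl : left_distributive bop_mul +%R.
Proof. by move=> x y z; exact: bop_ext. Qed.
Fact bop_mulDr : right_distributive bop_mul +%R.
Proof. by move=> x y z; apply: bop_ext => a; exact: bopD. Qed.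
Fact bop_mulZl (k : R[i]) f g : bop_mul (k *: f) g = k *: bop_mul f g.
Proof. exact: bop_ext. Qed.
Fact bop_mulZr (k : R[i]) f g : bop_mul f (k *: g) = k *: bop_mul f g.
Proof. by apply: bop_ext => x; exact: bopZ. Qed.
Fact bop_starK : involutive bop_star.
Proof. by move=> f; exact: bop_ext. Qed.
Fact bop_starD : {morph bop_star : f g / f + g}.
Proof. by move=> f g; exact: bop_ext. Qed.
Fact bop_starZ (k : R[i]) f : bop_star (k *: f) = (k^*)%C *: bop_star f.
Proof. by apply: bop_ext => x; exact: (bopZ (bop_star f)). Qed.
Fact bop_starM f g : bop_star (bop_mul f g) = bop_mul (bop_star g) (bop_star f).
Proof. exact: bop_ext. Qed.

HB.instance Definition _ := Lmodule_isStarAlgebra.Build R bop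
  bop_mulA bop_mulDl bop_mulDr bop_mulZl bop_mulZr
  bop_starK bop_starD bop_starZ bop_starM.

Definition bop_norm f : R := sup [set rnorm (f x) | x in [set x | rnorm x <= 1]].

Lemma bop_norm_ub f : has_ubound [set rnorm (f x) | x in [set x | rnorm x <= 1]].
Proof.
have [M M0 fM] := bop_boundedP f.
by exists M => _ [a /= a1 <-]; rewrite (le_trans (fM a))// ler_piMr.
Qed.

Lemma bop_norm_ge0 f : 0 <= bop_norm f.
Proof.
apply: le_trans (rnorm_ge0 (f 0)) _; apply: ub_le_sup (bop_norm_ub f) _ _.
by exists 0 => //=; rewrite rnorm0.
Qed.

Lemma bop_normP f x : rnorm (f x) <= rnorm x * bop_norm f.
Proof.
have := rnorm_ge0 x; rewrite le_eqVlt => /predU1P[/esym a0|a0].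
  by rewrite (rnorm0_eq0 a0) bop0 rnorm0 mul0r.
rewrite mulrC -ler_pdivrMr// mulrC.
have ai : 0 <= (rnorm x)^-1 by rewrite invr_ge0 ltW.
rewrite -[X in X * _](normc_real ai) -rnormZ -bopZ.
apply: ub_le_sup (bop_norm_ub f) _ _; exists ((rnorm x)^-1%:C%C *: x) => //=.
by rewrite rnormZ normc_real// mulVf ?gt_eqF.
Qed.

Lemma bop_norm_le f e : 0 <= e ->
  (forall x, rnorm (f x) <= rnorm x * e) -> bop_norm f <= e.
Proof.
move=> e0 fe; apply: ge_sup.
  by exists (rnorm (f 0)); exists 0 => //=; rewrite rnorm0.
by move=> _ [a /= a1 <-]; rewrite (le_trans (fe a))// ler_piMl.
Qed.

Fact bop_normD f g : (bop_norm (f + g))%:C%C <= (bop_norm f)%:C%C + (bop_norm g)%:C%C.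
Proof.
rewrite -rmorphD lecR; apply: bop_norm_le => [|a].
  by rewrite addr_ge0 ?bop_norm_ge0.
by rewrite (le_trans (rnormD _ _))// mulrDr lerD// bop_normP.
Qed.

Fact bop_normZ (k : R[i]) f : (bop_norm (k *: f))%:C%C = `|k| * (bop_norm f)%:C%C.
Proof.
have n0 (l : R[i]) : 0 <= Normc.normc l by rewrite -ler0c -[leRHS]/(`|l|).
have le (l : R[i]) h : bop_norm (l *: h) <= Normc.normc l * bop_norm h.
  apply: bop_norm_le => [|a /=]; first by rewrite mulr_ge0 ?bop_norm_ge0.
  by rewrite rnormZ mulrCA ler_wpM2l ?bop_normP.
rewrite -[`|k|]/((Normc.normc k)%:C%C) -rmorphM; congr (_%:C%C).
apply/eqP; rewrite eq_le le/=.
have [->|k0] := eqVneq k 0.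
  by rewrite Normc.normc0 mul0r bop_norm_ge0.
have nk : 0 < Normc.normc k by rewrite -ltcR -[ltRHS]/(`|k|) normr_gt0.
rewrite mulrC -ler_pdivlMr// mulrC -[in leLHS](scale1r f) -(mulVf k0) -scalerA.
by rewrite -Normc.normcV le.
Qed.

Fact bop_norm0_eq0 f : (bop_norm f)%:C%C = 0 -> f = 0.
Proof.
move=> /complexI f0; apply: bop_ext => a; apply: rnorm0_eq0; apply/eqP.
by rewrite eq_le rnorm_ge0 andbT (le_trans (bop_normP _ _))// f0 mulr0.
Qed.

HB.instance Definition _ := Lmodule_isNormed.Build R[i] bop
  bop_normD bop_normZ bop_norm0_eq0.

Lemma bop_rnormE f : rnorm f = bop_norm f. Proof. by []. Qed.

Fact bop_normM f g : `|f ** g| <= `|f| * `|g|.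
Proof.
rewrite !normE -rmorphM lecR !bop_rnormE; apply: bop_norm_le => [|a /=].
  by rewrite mulr_ge0 ?bop_norm_ge0.
rewrite (le_trans (bop_normP _ _))// mulrCA [leRHS]mulrC.
by rewrite ler_wpM2r ?bop_norm_ge0 ?bop_normP.
Qed.

Fact bop_norm_star f : `|star f| = `|f|.
Proof.
have le h : bop_norm (star h) <= bop_norm h.
  apply: bop_norm_le (bop_norm_ge0 h) _ => a.
  exact: badj_bound (bop_norm_ge0 h) (bopP h) (bop_normP h) _.
rewrite !normE; congr (_%:C%C); rewrite !bop_rnormE; apply/eqP.
by rewrite eq_le le -[in leLHS](starK f) le.
Qed.

HB.instance Definition _ :=
  StarAlgebra_isNormed.Build R bop bop_normM bop_norm_star.

Fact bop_cstar f : `|star f ** f| = `|f| ^+ 2.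
Proof.
apply/eqP; rewrite eq_le (le_trans (normsM _ _)) ?norm_star ?expr2//=.
rewrite -expr2 !normE -rmorphXn lecR !bop_rnormE.
set N := bop_norm (star f ** f); have N0 : 0 <= N := bop_norm_ge0 _.
rewrite -[leRHS]sqr_sqrtr// ler_sqr ?nnegrE ?sqrtr_ge0 ?bop_norm_ge0//.
apply: bop_norm_le; first exact: sqrtr_ge0.
move=> a; rewrite -ler_sqr ?nnegrE ?rnorm_ge0 ?mulr_ge0 ?rnorm_ge0 ?sqrtr_ge0//.
rewrite -rip_rnorm bopP exprMn [X in _ * X]sqr_sqrtr// (le_trans (rip_le_rnorm _ _))//.
rewrite expr2 -mulrA ler_wpM2l ?rnorm_ge0//.
exact: (bop_normP (star f ** f)).
Qed.

Fact bop_complete (F : set_system bop) : ProperFilter F -> cauchy F -> cvg F.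
Proof.
pose ev (i : bool * H) f := if i.1 then f i.2 else badj f i.2.
apply: (@complete_ev R bop (bool * H)%type (fun=> H) ev (fun i => rnorm i.2)).
- by move=> i; exact: rnorm_ge0.
- move=> [[] a] f g; rewrite /ev /=; first by rewrite scaleN1r.
  by have /= := congr1 (fun h : bop => h a) (starB f g); rewrite scaleN1r.
- move=> [[] a] f; rewrite /ev /=; first exact: bop_normP.
  by rewrite -(rnorm_star f); exact: (bop_normP (star f)).
- by move=> f e e0 h; apply: bop_norm_le => // a; exact: (h (true, a)).
move=> l h; pose L a := l (true, a); pose T a := l (false, a).
have hL e : 0 < e -> exists f : bop, (forall a, rnorm (L a - f a) <= rnorm a * e) /\
    (forall a, rnorm (T a - badj f a) <= rnorm a * e).
  move=> /h[x hx]; exists x; split => a; first exact: (hx (true, a)).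
  exact: (hx (false, a)).
have pZ (k : R[i]) a : L (k *: a) = k *: L a.
  apply: (@rnorm_eq _ _ (rnorm (k *: a) + rnorm (k *: a))) => e e0.
  have [f [fL _]] := hL _ e0.
  rewrite (le_trans (rnormBD (f (k *: a)) _ _))// mulrDl lerD//.
  rewrite bopZ -scalerBr !rnormZ -mulrA ler_wpM2l 1?rnormB//.
  by rewrite -ler0c -[leRHS]/(`|k|).
have pB : exists M : R, forall a, rnorm (L a) <= M * rnorm a.
  have [f [fL _]] := hL _ ltr01; have [M fM] := bop_bounded f; exists (1 + M) => a.
  rewrite -[L a](subrK (f a)) (le_trans (rnormD _ _))// mulrDl mul1r lerD//.
  by rewrite (le_trans (fL a))// mulr1.
have pA a b : rip (L a) b = rip a (T b).
  apply/eqP; rewrite -subr_eq0 -normr_eq0 eq_le normr_ge0 andbT.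
  apply/ler_addgt0Pr => d d0; rewrite add0r.
  have K0 : 0 < 2 * (rnorm a * rnorm b) + 1 by rewrite ltr_wpDl// mulr_ge0// mulr_ge0 ?rnorm_ge0.
  have [|f [fL fT]] := hL (d / (2 * (rnorm a * rnorm b) + 1)); first by rewrite divr_gt0.
  set e := d / _ in fL fT.
  have de : d = e * (2 * (rnorm a * rnorm b) + 1) by rewrite divfK// gt_eqF.
  have e0 : 0 <= e by rewrite divr_ge0 ?ltW.
  have -> : rip (L a) b - rip a (T b) = rip (L a - f a) b - rip a (T b - badj f b).
    by rewrite ripBl ripBr bopP; ring.
  have nle (u v : H) : `|rip u v| <= rnorm u * rnorm v.
    rewrite ler_norml rip_le_rnorm andbT -rnormN lerNl -ripNl; exact: rip_le_rnorm.
  rewrite (le_trans (ler_normB _ _))// (le_trans (lerD (nle _ _) (nle _ _)))//.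
  have h1 : rnorm (L a - f a) * rnorm b <= rnorm a * e * rnorm b.
    by rewrite ler_wpM2r ?rnorm_ge0.
  have h2 : rnorm a * rnorm (T b - badj f b) <= rnorm a * (rnorm b * e).
    by rewrite ler_wpM2l ?rnorm_ge0.
  by rewrite de; lra.
by exists (Bop pA pZ pB) => -[[] a].
Qed.

HB.instance Definition _ := Uniform_isComplete.Build bop bop_complete.
HB.instance Definition _ := NormedStarAlgebra_isCstar.Build R bop bop_cstar.

End Bop.

(** * Finite matrices and compact operators *)

Section FiniteMatrices.
Context (R : realType).
Let H := l2 R.
Implicit Types (f g h : bop R) (x y z : H).

Fact trunc_bounded N x : exists M, forall n,
  qpart (fun i => if (i < N)%N then x i else 0) n <= M.
Proof.
exists (l2_sq x) => n; apply: le_trans (qpart_le_sq x n); apply: ler_sum => i _.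
by case: ifP => // _; rewrite /rdot /= mulr0 addr0; exact: rdot_ge0.
Qed.

Definition l2_trunc N x : H := L2 (trunc_bounded N x).

Lemma l2_trunc_le N x : rnorm (l2_trunc N x) <= rnorm x.
Proof.
apply: l2_rnorm_le => [|n]; first exact: rnorm_ge0.
rewrite l2_rnormE l2_normK; apply: le_trans (qpart_le_sq x n); apply: ler_sum => i _ /=.
by case: ifP => // _; rewrite /rdot /= mulr0 addr0; exact: rdot_ge0.
Qed.

Program Definition trunc N : bop R := @Bop R (l2_trunc N) (l2_trunc N) _ _ _.
Next Obligation.
move=> N x y; apply: rip_unique (@rip_cvg _ x (l2_trunc N y)) => n.
apply: eq_bigr => i _ /=; case: ifP => // _.
by rewrite /rdot /= !mul0r !mulr0.
Qed.
Next Obligation.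
by move=> N k x; apply: l2_ext => i /=; case: ifP; rewrite ?mulr0.
Qed.
Next Obligation. by move=> N; exists 1 => x; rewrite mul1r; exact: l2_trunc_le. Qed.

Lemma truncE N x i : trunc N x i = if (i < N)%N then x i else 0.
Proof. by []. Qed.

Lemma trunc_star N : star (trunc N) = trunc N.
Proof. exact: bop_ext. Qed.

Lemma truncM M N : (N <= M)%N -> trunc M ** trunc N = trunc N.
Proof.
move=> NM; apply: bop_ext => x; apply: l2_ext => i /=; case: ifPn => //.
by rewrite -leqNgt => Mi; rewrite ltnNge (leq_trans NM Mi).
Qed.

(** Matrices supported in the upper left corner of size [N]; the two-sided condition is stable under
    [star]. *)
Definition fin_op f := exists N, trunc N ** f = f /\ f ** trunc N = f.

Lemma fin_op_ge f : fin_op f ->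
  exists N, forall M, (N <= M)%N -> trunc M ** f = f /\ f ** trunc M = f.
Proof.
move=> [N [Nf fN]]; exists N => M NM; split; first by rewrite -Nf smulA truncM.
rewrite -fN -smulA; congr (_ ** _); apply: (can_inj (@starK R _)).
by rewrite starM !trunc_star truncM.
Qed.

Lemma fin_op0 : fin_op 0.
Proof. by exists 0%N; rewrite smulx0 smul0x. Qed.

Lemma fin_opD f g : fin_op f -> fin_op g -> fin_op (f + g).
Proof.
move=> /fin_op_ge[M hM] /fin_op_ge[N hN]; exists (maxn M N).
have [h1 h2] := hM _ (leq_maxl M N); have [h3 h4] := hN _ (leq_maxr M N).
by rewrite smulDr smulDl h1 h2 h3 h4.
Qed.

Lemma fin_opZ (k : R[i]) f : fin_op f -> fin_op (k *: f).
Proof. by move=> [N [Nf fN]]; exists N; rewrite smulZl smulZr Nf fN. Qed.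

Lemma fin_opM f g : fin_op f -> fin_op g -> fin_op (f ** g).
Proof.
move=> /fin_op_ge[M hM] /fin_op_ge[N hN]; exists (maxn M N).
have [h1 _] := hM _ (leq_maxl M N); have [_ h4] := hN _ (leq_maxr M N).
by rewrite smulA h1 -smulA h4.
Qed.

Lemma fin_op_star f : fin_op f -> fin_op (star f).
Proof.
move=> [N [Nf fN]]; exists N.
by split; rewrite -(trunc_star N) -starM ?Nf ?fN.
Qed.

Fact ebasis_bounded n : exists M, forall N, qpart (fun i => (i == n)%:R : R[i]) N <= M.
Proof.
exists 1 => N; rewrite /qpart.
case: (ltnP n N) => nN.
  rewrite (bigD1 (Ordinal nN))//= eqxx big1 ?addr0 => [|i ni]; first by rewrite /rdot /=; lra.
  by rewrite -val_eqE/= in ni; rewrite (negbTE ni) /rdot /=; lra.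
rewrite big1 ?ler01// => i _; rewrite ltn_eqF ?(leq_trans (ltn_ord i) nN)//.
by rewrite /rdot /=; lra.
Qed.

Definition ebasis n : H := L2 (ebasis_bounded n).

Lemma rip_ebasis (k : R[i]) n x : rip (k *: ebasis n) x = rdot k (x n).
Proof.
apply: (@rip_unique _ _ _ (fun N => if (n < N)%N then rdot k (x n) else 0)) => [N|].
  case: ltnP => nN.
    rewrite (bigD1 (Ordinal nN))//= eqxx mulr1 big1 ?addr0// => i ni.
    by rewrite -val_eqE/= in ni; rewrite (negbTE ni) mulr0 /rdot /= !mul0r addr0.
  rewrite big1// => i _; rewrite /= ltn_eqF ?(leq_trans (ltn_ord i) nN)//.
  by rewrite mulr0 /rdot /= !mul0r addr0.
apply/cvgrPdist_le => e e0; exists n.+1 => // N /= nN.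
by rewrite nN subrr normr0 ltW.
Qed.

Lemma rnorm_ebasis n : rnorm (ebasis n) = 1.
Proof.
apply/eqP; rewrite -(@eqrXn2 _ 2%N) ?rnorm_ge0// expr1n -rip_rnorm.
by rewrite -[X in rip X _]scale1r rip_ebasis /= eqxx /rdot /= !mulr1 mulr0 addr0.
Qed.

Lemma rip_coord_eq0 x : (forall (k : R[i]) n, rip (k *: ebasis n) x = 0) -> x = 0.
Proof.
move=> h; apply: l2_ext => n; apply: rdot_eq0.
by rewrite -rip_ebasis h.
Qed.

Lemma normc_rdot (z : R[i]) : Normc.normc z ^+ 2 = rdot z z.
Proof.
by case: z => a b; rewrite /rdot /= sqr_sqrtr ?addr_ge0 ?sqr_ge0// !expr2.
Qed.

Lemma normc_ge0 (z : R[i]) : 0 <= Normc.normc z.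
Proof. by rewrite -ler0c -[leRHS]/(`|z|). Qed.

Lemma normc_coord x n : Normc.normc (x n) <= rnorm x.
Proof.
rewrite -ler_sqr ?nnegrE ?rnorm_ge0 ?normc_ge0// normc_rdot l2_rnormE l2_normK.
exact: rdot_coord_le.
Qed.

Program Definition munit k l : bop R :=
  @Bop R (fun x => x l *: ebasis k) (fun x => x k *: ebasis l) _ _ _.
Next Obligation. by move=> k l x y; rewrite rip_ebasis ripC rip_ebasis rdotC. Qed.
Next Obligation. by move=> k l c x; rewrite scalerA. Qed.
Next Obligation.
by move=> k l; exists 1 => x; rewrite rnormZ rnorm_ebasis mulr1 mul1r normc_coord.
Qed.

Lemma munit_le k l : rnorm (munit k l) <= 1.
Proof.
by apply: bop_norm_le => // x /=; rewrite rnormZ rnorm_ebasis !mulr1 normc_coord.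
Qed.

Lemma fin_op_munit k l : fin_op (munit k l).
Proof.
exists (maxn k l).+1; split; apply: bop_ext => x; apply: l2_ext => i /=.
  case: ifPn => //; rewrite ltnS -ltnNge gtn_max => /andP[ki _].
  by rewrite gtn_eqF// mulr0.
by rewrite ltnS leq_maxr.
Qed.

(** Matrix units on both sides isolate one entry of [f]; this is what spreads a nonzero entry to all
    matrix units in [kop_simple]. *)
Lemma munitM f k i j l :
  munit k i ** f ** munit j l = (f (ebasis j) i) *: munit k l.
Proof. by apply: bop_ext => x; rewrite /= bopZ l2_coordZ scalerA mulrC. Qed.

Lemma bop_sumE (I : Type) (r : seq I) (P : pred I) (F : I -> bop R) x :
  (\sum_(i <- r | P i) F i) x = \sum_(i <- r | P i) F i x.
Proof. exact: (big_morph (fun f : bop R => f x)). Qed.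

Lemma bop_sum f (I : Type) (r : seq I) (P : pred I) (F : I -> H) :
  f (\sum_(i <- r | P i) F i) = \sum_(i <- r | P i) f (F i).
Proof. exact: (big_morph f (bopD f) (bop0 f)). Qed.

Lemma l2_sumE (I : Type) (r : seq I) (P : pred I) (F : I -> H) n :
  (\sum_(i <- r | P i) F i) n = \sum_(i <- r | P i) F i n.
Proof. exact: (big_morph (fun x : H => x n)). Qed.

Lemma sum_ebasis N (v : nat -> R[i]) n :
  (\sum_(l < N) v l *: ebasis l) n = if (n < N)%N then v n else 0.
Proof.
rewrite l2_sumE; case: ltnP => nN.
  rewrite (bigD1 (Ordinal nN))//= eqxx mulr1 big1 ?addr0// => i ni.
  by rewrite -val_eqE/= in ni; rewrite eq_sym (negbTE ni) mulr0.
by rewrite big1// => i _ /=; rewrite gtn_eqF ?mulr0// (leq_trans (ltn_ord i) nN).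
Qed.

Lemma trunc_sum N x : trunc N x = \sum_(l < N) x l *: ebasis l.
Proof. by apply: l2_ext => n; rewrite sum_ebasis. Qed.

Lemma fin_opE f : fin_op f -> exists N,
  f = \sum_(k < N) \sum_(l < N) f (ebasis l) k *: munit k l.
Proof.
move=> [N [Nf fN]]; exists N; apply: bop_ext => x.
rewrite -[in LHS]Nf -[in LHS]fN /= -/(l2_trunc N _) -[l2_trunc N _]/(trunc N _).
rewrite -[l2_trunc N _]/(trunc N _) trunc_sum bop_sumE.
apply: eq_bigr => k _; rewrite bop_sumE trunc_sum bop_sum l2_sumE scaler_suml.
by apply: eq_bigr => l _ /=; rewrite bopZ l2_coordZ scalerA mulrC.
Qed.

Lemma rip0l x : rip 0 x = 0.
Proof. by rewrite -(subrr x) ripBl subrr. Qed.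

(** A general vector is not a finite combination of basis vectors. Pairing with a basis vector moves
    the question to the adjoint, which vanishes on the basis because [f] does. *)
Lemma bop_eq0 f : (forall i j, f (ebasis j) i = 0) -> f = 0.
Proof.
move=> f0; apply: bop_ext => x; apply: rip_coord_eq0 => k n.
have fz : badj f (k *: ebasis n) = 0.
  apply: rip_coord_eq0 => l m; rewrite -bopP bopZ.
  have -> : f (ebasis m) = 0 by apply: l2_ext => p; exact: f0.
  by rewrite scaler0 rip0l.
by rewrite ripC bopP fz ripC rip0l.
Qed.

End FiniteMatrices.

Lemma smul_near (R : realType) (A : normedStarAlgType R) (x y : A) (e : R) : 0 < e ->
  exists2 d, 0 < d & forall x' y', rnorm (x - x') <= d -> rnorm (y - y') <= d ->
    rnorm (x ** y - x' ** y') <= e.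
Proof.
move=> e0; have K0 : 0 < rnorm x + rnorm y + 1 by rewrite ltr_wpDl ?addr_ge0 ?rnorm_ge0.
exists (Num.min 1 (e / (rnorm x + rnorm y + 1))); first by rewrite lt_min ltr01 divr_gt0.
set d := Num.min _ _ => x' y' xd yd.
have d1 : d <= 1 by rewrite ge_min lexx.
have de : d * (rnorm x + rnorm y + 1) <= e by rewrite -ler_pdivlMr// ge_min lexx orbT.
have d0 : 0 <= d := le_trans (rnorm_ge0 _) xd.
have -> : x ** y - x' ** y' = (x - x') ** y + x' ** (y - y').
  by rewrite smulBl smulBr subrKA.
have x'1 : rnorm x' <= rnorm x + d.
  by rewrite -[x'](subrK x) addrC (le_trans (rnormD _ _))// lerD2l rnormB.
have h1 : rnorm ((x - x') ** y) <= d * rnorm y.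
  by rewrite (le_trans (rnormM _ _))// ler_wpM2r ?rnorm_ge0.
have h2 : rnorm (x' ** (y - y')) <= (rnorm x + d) * d.
  by rewrite (le_trans (rnormM _ _))// ler_pM ?rnorm_ge0.
apply: le_trans (rnormD _ _) _; nra.
Qed.

(** * The C*-algebra of compact operators: simplicity and separability *)

Section Compact.
Context (R : realType).
Implicit Types f g h : bop R.

(** On l2 the norm limits of finite matrices are exactly the compact operators, since truncating on
    both sides approximates a compact operator in norm. *)
Definition compact_op f := forall e : R, 0 < e -> exists2 g, fin_op g & rnorm (f - g) <= e.

Record kop := Kop { kval :> bop R; kvalP : compact_op kval }.

HB.instance Definition _ := gen_eqMixin kop.
HB.instance Definition _ := gen_choiceMixin kop.

Implicit Types a b c : kop.

Lemma kop_ext a b : kval a = kval b -> a = b.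
Proof.
case: a b => [f p] [g q] /= fg; rewrite -{g}fg in q *.
by rewrite (Prop_irrelevance p q).
Qed.

Lemma fin_compact f : fin_op f -> compact_op f.
Proof. by move=> ff e e0; exists f; rewrite ?subrr ?rnorm0 ?ltW. Qed.

Lemma compactD f g : compact_op f -> compact_op g -> compact_op (f + g).
Proof.
move=> cf cg e e0; have e20 : 0 < e / 2 by rewrite divr_gt0.
have [f' ff' hf] := cf _ e20; have [g' fg' hg] := cg _ e20.
exists (f' + g'); first exact: fin_opD.
by rewrite opprD addrACA (le_trans (rnormD _ _))// [e]splitr lerD.
Qed.

Lemma compactZ (k : R[i]) f : compact_op f -> compact_op (k *: f).
Proof.
move=> cf e e0; have k0 : 0 < Normc.normc k + 1 by rewrite ltr_wpDl ?normc_ge0.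
have [|g fg hg] := cf (e / (Normc.normc k + 1)); first by rewrite divr_gt0.
exists (k *: g); first exact: fin_opZ.
rewrite -scalerBr rnormZ (le_trans (ler_wpM2l (normc_ge0 _) hg))//.
by rewrite mulrCA ger_pMr// ler_pdivrMr// mul1r lerDl.
Qed.

Lemma compactM f g : compact_op f -> compact_op g -> compact_op (f ** g).
Proof.
move=> cf cg e /(smul_near f g)[d d0 near].
have [f' ff' hf] := cf _ d0; have [g' fg' hg] := cg _ d0.
by exists (f' ** g'); [exact: fin_opM|exact: near].
Qed.

Lemma compact_star f : compact_op f -> compact_op (star f).
Proof.
move=> cf e /cf[g fg hg]; exists (star g); first exact: fin_op_star.
by rewrite -starB rnorm_star.
Qed.

Lemma compact_closed f :
  (forall e : R, 0 < e -> exists2 g, compact_op g & rnorm (f - g) <= e) -> compact_op f.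
Proof.
move=> h e e0; have e20 : 0 < e / 2 by rewrite divr_gt0.
have [g cg fg] := h _ e20; have [g' fg' gg'] := cg _ e20.
by exists g' => //; rewrite (le_trans (rnormBD g _ _))// [e]splitr lerD.
Qed.

Definition kop_zero := Kop (fin_compact (fin_op0 R)).
Definition kop_add a b := Kop (compactD (kvalP a) (kvalP b)).
Definition kop_scale (k : R[i]) a := Kop (compactZ k (kvalP a)).
Definition kop_opp a := kop_scale (-1) a.
Definition kop_mul a b := Kop (compactM (kvalP a) (kvalP b)).
Definition kop_star a := Kop (compact_star (kvalP a)).

Fact kop_addA : associative kop_add.
Proof. by move=> a b c; apply: kop_ext; exact: addrA. Qed.
Fact kop_addC : commutative kop_add.
Proof. by move=> a b; apply: kop_ext; exact: addrC. Qed.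
Fact kop_add0 : left_id kop_zero kop_add.
Proof. by move=> a; apply: kop_ext; exact: add0r. Qed.
Fact kop_addN : left_inverse kop_zero kop_opp kop_add.
Proof. by move=> a; apply: kop_ext; rewrite /= scaleN1r addNr. Qed.

HB.instance Definition _ :=
  GRing.isZmodule.Build kop kop_addA kop_addC kop_add0 kop_addN.

Fact kop_scaleA (k l : R[i]) a : kop_scale k (kop_scale l a) = kop_scale (k * l) a.
Proof. by apply: kop_ext; exact: scalerA. Qed.
Fact kop_scale1 : left_id 1 kop_scale.
Proof. by move=> a; apply: kop_ext; exact: scale1r. Qed.
Fact kop_scaleDr : right_distributive kop_scale +%R.
Proof. by move=> k a b; apply: kop_ext; exact: scalerDr. Qed.
Fact kop_scaleDl a : {morph kop_scale^~ a : k l / k + l}.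
Proof. by move=> k l; apply: kop_ext; exact: scalerDl. Qed.

HB.instance Definition _ := GRing.Zmodule_isLmodule.Build R[i] kop
  kop_scaleA kop_scale1 kop_scaleDr kop_scaleDl.

Fact kop_mulA : associative kop_mul.
Proof. by move=> a b c; apply: kop_ext; exact: smulA. Qed.
Fact kop_mulDl : left_distributive kop_mul +%R.
Proof. by move=> a b c; apply: kop_ext; exact: smulDl. Qed.
Fact kop_mulDr : right_distributive kop_mul +%R.
Proof. by move=> a b c; apply: kop_ext; exact: smulDr. Qed.
Fact kop_mulZl (k : R[i]) a b : kop_mul (k *: a) b = k *: kop_mul a b.
Proof. by apply: kop_ext; exact: smulZl. Qed.
Fact kop_mulZr (k : R[i]) a b : kop_mul a (k *: b) = k *: kop_mul a b.
Proof. by apply: kop_ext; exact: smulZr. Qed.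
Fact kop_starK : involutive kop_star.
Proof. by move=> a; apply: kop_ext; exact: starK. Qed.
Fact kop_starD : {morph kop_star : a b / a + b}.
Proof. by move=> a b; apply: kop_ext; exact: starD. Qed.
Fact kop_starZ (k : R[i]) a : kop_star (k *: a) = (k^*)%C *: kop_star a.
Proof. by apply: kop_ext; exact: starZ. Qed.
Fact kop_starM a b : kop_star (kop_mul a b) = kop_mul (kop_star b) (kop_star a).
Proof. by apply: kop_ext; exact: starM. Qed.

HB.instance Definition _ := Lmodule_isStarAlgebra.Build R kop
  kop_mulA kop_mulDl kop_mulDr kop_mulZl kop_mulZr
  kop_starK kop_starD kop_starZ kop_starM.

Lemma kvalD a b : kval (a + b) = kval a + kval b. Proof. by []. Qed.
Lemma kvalZ (k : R[i]) a : kval (k *: a) = k *: kval a. Proof. by []. Qed.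
Lemma kvalB a b : kval (a - b) = kval a - kval b.
Proof. by rewrite kvalD; congr (_ + _); exact: scaleN1r. Qed.
Lemma kvalM a b : kval (a ** b) = kval a ** kval b. Proof. by []. Qed.

Fact kop_normD a b : `|kval (a + b)| <= `|kval a| + `|kval b|.
Proof. exact: ler_normD. Qed.
Fact kop_normZ (k : R[i]) a : `|kval (k *: a)| = `|k| * `|kval a|.
Proof. exact: normrZ. Qed.
Fact kop_norm0_eq0 a : `|kval a| = 0 -> a = 0.
Proof. by move=> /eqP; rewrite normr_eq0 => /eqP a0; exact: kop_ext. Qed.

HB.instance Definition _ := @Lmodule_isNormed.Build R[i] kop (fun a => `|kval a|)
  kop_normD kop_normZ kop_norm0_eq0.

Lemma kop_rnormE a : rnorm a = rnorm (kval a). Proof. by []. Qed.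

Fact kop_normM a b : `|a ** b| <= `|a| * `|b|.
Proof. exact: (normsM (kval a) (kval b)). Qed.
Fact kop_norm_star a : `|star a| = `|a|.
Proof. exact: (norm_star (kval a)). Qed.

HB.instance Definition _ :=
  StarAlgebra_isNormed.Build R kop kop_normM kop_norm_star.

Fact kop_cstar a : `|star a ** a| = `|a| ^+ 2.
Proof. exact: (cstar_identity (kval a)). Qed.

Fact kop_complete (F : set_system kop) : ProperFilter F -> cauchy F -> cvg F.
Proof.
apply: (@complete_ev R kop unit (fun=> bop R) (fun=> kval) (fun=> 1)) => //=.
- by move=> _ a; rewrite mul1r.
- by move=> a e _ /(_ tt); rewrite mul1r.
move=> l h; have cl : compact_op (l tt).
  apply: compact_closed => e /h[a ha]; exists (kval a); first exact: kvalP.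
  by have := ha tt; rewrite mul1r.
by exists (Kop cl) => -[].
Qed.

HB.instance Definition _ := Uniform_isComplete.Build kop kop_complete.
HB.instance Definition _ := NormedStarAlgebra_isCstar.Build R kop kop_cstar.

Lemma kop_sumE (I : Type) (r : seq I) (P : pred I) (F : I -> kop) :
  kval (\sum_(i <- r | P i) F i) = \sum_(i <- r | P i) kval (F i).
Proof. exact: (big_morph kval kvalD). Qed.

Definition kunit k l : kop := Kop (fin_compact (fin_op_munit R k l)).

Lemma kop_near_finite a (e : R) : 0 < e -> exists N (c : nat -> nat -> R[i]),
  rnorm (a - \sum_(k < N) \sum_(l < N) c k l *: kunit k l) <= e.
Proof.
move=> /(kvalP a)[g /fin_opE[N gE] ag]; exists N, (fun k l => g (ebasis R l) k).
rewrite kop_rnormE kvalB kop_sumE; under eq_bigr do rewrite kop_sumE.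
by rewrite -gE.
Qed.

Lemma kop_open_ball (O : set kop) a : open O -> O a ->
  exists2 e : R, 0 < e & forall b, rnorm (a - b) <= e -> O b.
Proof.
move=> oO Oa; have /nbhs_ballP[_ /gtc0E[e e0 ->] eO] := open_nbhs_nbhs (conj oO Oa).
exists (e / 2); first by rewrite divr_gt0.
move=> b ab; apply: eO; rewrite -ball_normE /= rnorm_lt.
by apply: le_lt_trans ab _; rewrite ltr_pdivrMr// ltr_pMr// ltr1n.
Qed.

(** A nonzero element of the ideal has a nonzero entry, and compressing it between matrix units puts
    every matrix unit in the ideal. Their span is dense and the ideal is closed. *)
Lemma kop_simple : simple_cstar kop.
Proof.
split.
  exists (kunit 0 0); apply/eqP => /(congr1 (fun a : kop => kval a (ebasis R 0%N) 0%N)).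
  by rewrite /= mulr1 => /eqP; rewrite oner_eq0.
move=> I [Icl I0 ID IZ IM]; have [In|] := pselect (exists2 a, I a & a != 0); last first.
  move=> nI; left; apply/seteqP; split => [a Ia|a ->//].
  by apply: contrapT => /eqP a0; apply: nI; exists a.
right; apply/seteqP; split => // b _.
have [a Ia /eqP a0] := In.
have [i [j aij]] : exists i j, kval a (ebasis R j) i != 0.
  apply: contrapT => h; apply: a0; apply: kop_ext; apply: bop_eq0 => i j.
  by apply: contrapT => /eqP aij; apply: h; exists i, j.
have IE k l : I (kunit k l).
  have -> : kunit k l = (kval a (ebasis R j) i)^-1 *: (kunit k i ** a ** kunit j l).
    by apply: kop_ext; rewrite kvalZ !kvalM munitM scalerA mulVf// scale1r.
  by apply: IZ; apply: (IM _ _ _).2; apply: (IM _ _ _).1.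
have sumI (J : Type) (r : seq J) (F : J -> kop) : (forall j, I (F j)) -> I (\sum_(j <- r) F j).
  by move=> IF; elim/big_ind: _.
apply: Icl => B /nbhs_ballP[_ /gtc0E[e e0 ->] eB].
have e20 : 0 < e / 2 by rewrite divr_gt0.
have [N [c bc]] := kop_near_finite b e20.
exists (\sum_(k < N) \sum_(l < N) c k l *: kunit k l); split; last first.
  apply: eB; rewrite -ball_normE /= rnorm_lt; apply: le_lt_trans bc _.
  by rewrite ltr_pdivrMr// ltr_pMr// ltr1n.
by apply: (sumI _ _) => k; apply: (sumI _ _) => l; exact: IZ.
Qed.

Lemma complex_near_rat (z : R[i]) (e : R) : 0 < e ->
  exists q : rat * rat, Normc.normc (z - (ratr q.1 +i* ratr q.2)%C) <= e.
Proof.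
move=> e0; case: z => a b.
have e20 : 0 < e / 2 by rewrite divr_gt0.
have near_rat (c : R) : exists q : rat, `|c - ratr q| <= e / 2.
  have [q] := @rat_in_itvoo R (c - e / 2) (c + e / 2) ltac:(lra).
  rewrite in_itv/= => /andP[h1 h2]; exists q; rewrite ler_norml; lra.
have [p pa] := near_rat a; have [q qb] := near_rat b; exists (p, q).
rewrite -ler_sqr ?nnegrE ?normc_ge0 ?ltW// normc_rdot /rdot /=.
move: pa qb; rewrite !ler_norml => /andP[? ?] /andP[? ?]; nra.
Qed.

(** A size with a nested list of rational pairs ranges over a countable type; absent entries are
    read as 0. *)
Definition rat_kop (c : nat * seq (seq (rat * rat))) : kop :=
  \sum_(k < c.1) \sum_(l < c.1)
    (let q := nth (0, 0) (nth [::] c.2 k) l in (ratr q.1 +i* ratr q.2)%C) *: kunit k l.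

Lemma rnorm_sum (V : normedModType R[i]) N (F : 'I_N -> V) (e : R) :
  (forall i, rnorm (F i) <= e) -> rnorm (\sum_(i < N) F i) <= e *+ N.
Proof.
elim: N F => [|N IH] F Fe; first by rewrite big_ord0 rnorm0.
by rewrite big_ord_recr mulrSr (le_trans (rnormD _ _))// lerD// IH.
Qed.

Lemma kop_separable : separable_space kop.
Proof.
exists (range rat_kop); first exact: sub_countable (card_image_le _ _) (countableP _).
move=> O [a Oa] oO; have [e e0 eO] := kop_open_ball oO Oa.
have e20 : 0 < e / 2 by rewrite divr_gt0.
have [N [c ac]] := kop_near_finite a e20.
(* There are [N * N] entries, each with error at most [d]. The successor keeps the division
   meaningful for [N = 0]. *)
pose d := e / 2 / (N * N).+1%:R; have d0 : 0 < d by rewrite divr_gt0.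
have /choice[q qP] : forall kl : nat * nat, exists q : rat * rat,
    Normc.normc (c kl.1 kl.2 - (ratr q.1 +i* ratr q.2)%C) <= d.
  by move=> kl; exact: complex_near_rat.
pose b := rat_kop (N, mkseq (fun k => mkseq (fun l => q (k, l)) N) N).
exists b; split; last by eexists.
apply: eO; rewrite (le_trans (rnormBD (\sum_(k < N) \sum_(l < N) c k l *: kunit k l) _ _))//.
rewrite [e]splitr lerD//.
apply: (@le_trans _ _ (d *+ N *+ N)); last first.
  rewrite -mulrnA -(mulr_natr d) /d [leLHS]mulrAC ler_pdivrMr// ler_wpM2l ?ltW// ltr_nat.
  exact: ltnSn.
rewrite /b /rat_kop /= -sumrB; apply: rnorm_sum => k; rewrite -sumrB.
apply: rnorm_sum => l; rewrite !nth_mkseq// -scalerBl rnormZ.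
rewrite -[d]mulr1 ler_pM ?normc_ge0 ?rnorm_ge0 ?munit_le//.
exact: (qP (val k, val l)).
Qed.

End Compact.

(** * Index zero: near-isometries of the form identity plus compact *)

Lemma nceval_near (R : realType) (A : normedStarAlgType R) (P : ncpoly R) (x : A) (e : R) :
  0 < e -> exists2 d, 0 < d & forall y, rnorm (x - y) <= d ->
    rnorm (nceval x P - nceval y P) <= e.
Proof.
elim: P e => /= [|P hP Q hQ|k P hP|P hP Q hQ|P hP] e e0.
- by exists e.
- have e20 : 0 < e / 2 by rewrite divr_gt0.
  have [d d0 hd] := hP _ e20; have [d' d'0 hd'] := hQ _ e20.
  exists (Num.min d d'); first by rewrite lt_min d0.
  move=> y; rewrite le_min => /andP[yd yd'].
  by rewrite opprD addrACA (le_trans (rnormD _ _))// [e]splitr lerD ?hd ?hd'.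
- have k0 : 0 < Normc.normc k + 1 by rewrite ltr_wpDl ?normc_ge0.
  have [|d d0 hd] := hP (e / (Normc.normc k + 1)); first by rewrite divr_gt0.
  exists d => // y /hd hy; rewrite -scalerBr rnormZ.
  rewrite (le_trans (ler_wpM2l (normc_ge0 _) hy))//.
  by rewrite mulrCA ger_pMr// ler_pdivrMr// mul1r lerDl.
- have [c c0 hc] := smul_near (nceval x P) (nceval x Q) e0.
  have [d d0 hd] := hP _ c0; have [d' d'0 hd'] := hQ _ c0.
  exists (Num.min d d'); first by rewrite lt_min d0.
  by move=> y; rewrite le_min => /andP[yd yd']; apply: hc; [exact: hd|exact: hd'].
- have [d d0 hd] := hP _ e0; exists d => // y /hd.
  by rewrite -starB rnorm_star.
Qed.

(* With [y = 1 + 2 x]: the first is [(y^* y - 1) / 2], the second [1 - y y^*]. *)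
Definition isometry_defect (R : realType) : ncpoly R :=
  NCAdd (NCScale 2 (NCMul (NCStar NCVar) NCVar)) (NCAdd NCVar (NCStar NCVar)).

Definition coisometry_defect (R : realType) : ncpoly R :=
  NCScale (-2) (NCAdd (NCScale 2 (NCMul NCVar (NCStar NCVar))) (NCAdd NCVar (NCStar NCVar))).

Section FiniteIndex.
Context (R : realType).
Let H := l2 R.
Implicit Types (f g b : bop R) (x y z : H).

Lemma bop_rnormP f x : rnorm (f x) <= rnorm x * rnorm f.
Proof. exact: bop_normP. Qed.

(** The map [1 + 2 b] preserves the span of the first [N] basis vectors and is the identity on the
    remaining ones, where [b] vanishes. Only a square matrix has to be inverted. *)
Lemma fin_op_surjective b : fin_op b ->
  (forall x, x + 2 *: b x = 0 -> x = 0) -> forall z, exists x, x + 2 *: b x = z.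
Proof.
move=> [N [Nb bN]] inj z.
pose vec (v : 'rV[R[i]]_N) : H := \sum_(l < N) v 0 l *: ebasis R l.
pose M : 'M[R[i]]_N := \matrix_(l, k) (ebasis R l + 2 *: b (ebasis R l)) k.
have vecE v (n : 'I_N) : vec v n = v 0 n.
  rewrite /vec l2_sumE (bigD1 n)//= eqxx mulr1 big1 ?addr0// => i ni.
  by rewrite -val_eqE/= eq_sym in ni; rewrite (negbTE ni) mulr0.
have vec_out v n : (N <= n)%N -> vec v n = 0.
  move=> Nn; rewrite /vec l2_sumE big1// => i _ /=.
  by rewrite gtn_eqF ?mulr0// (leq_trans (ltn_ord i) Nn).
have b_out x n : (N <= n)%N -> b x n = 0.
  by move=> Nn; rewrite -Nb /= ltnNge Nn.
have vecM v : vec v + 2 *: b (vec v) = vec (v *m M).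
  apply: l2_ext => n; case: (ltnP n N) => nN; last first.
    by rewrite l2_coordD l2_coordZ !vec_out// b_out// mulr0 addr0.
  rewrite -[n]/(val (Ordinal nN)) vecE mxE l2_coordD l2_coordZ.
  rewrite /vec bop_sum !l2_sumE mulr_sumr -big_split/=; apply: eq_bigr => l _.
  by rewrite mxE /= bopZ l2_coordZ; ring.
have Mu : M \in unitmx.
  rewrite -row_free_unit -kermx_eq0; apply/rowV0P => v /sub_kermxP vM.
  have v0 : vec v = 0.
    apply: inj; rewrite vecM vM; apply: l2_ext => n.
    by rewrite /vec l2_sumE big1// => i _; rewrite mxE l2_coordZ mul0r.
  by apply/rowP => i; rewrite -vecE v0 mxE.
pose w : 'rV[R[i]]_N := \row_l z l.
(* The first [N] coordinates come from the inverse matrix, acting on rows; the tail of [z] is kept,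
   as [b] kills it. *)
exists (vec (w *m invmx M) + (z - trunc R N z)).
have -> : b (vec (w *m invmx M) + (z - trunc R N z)) = b (vec (w *m invmx M)).
  rewrite bopD bopB (_ : b (trunc R N z) = b z) ?subrr ?addr0//.
  by rewrite -[in RHS]bN.
rewrite addrAC vecM mulmxKV//; apply: l2_ext => n; rewrite l2_coordD l2_coordB truncE.
case: (ltnP n N) => nN; last by rewrite vec_out// add0r subr0.
by rewrite -[n]/(val (Ordinal nN)) vecE mxE subrr addr0.
Qed.

Section NearIsometry.
Context (b : bop R).
Let T := nceval b (isometry_defect R).
Let U := nceval b (coisometry_defect R).
Let Y : bop R := bop_one R + 2 *: b.

Let YE x : Y x = x + 2 *: b x. Proof. by []. Qed.

Let YsE x : badj Y x = x + 2 *: badj b x.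
Proof.
rewrite -[badj Y x]/(bfun (star Y) x) starD starZ conjc_nat.
by congr (_ + _).
Qed.

Lemma isometry_defectE x : badj Y (Y x) = x + 2 *: T x.
Proof.
rewrite YsE YE -[badj b _]/(bfun (star b) _) bopD bopZ; apply: l2_ext => n.
by rewrite !(l2_coordD, l2_coordZ); ring.
Qed.

Lemma coisometry_defectE x : U x = x - Y (badj Y x).
Proof.
rewrite YsE YE bopD bopZ; apply: l2_ext => n.
by rewrite l2_coordB /U /= ; ring.
Qed.

(** Since [star Y ** Y = 1 + 2 T], the map [Y] is bounded below, hence injective, hence surjective
    by [fin_op_surjective]. Writing [z = Y w] gives [U z = - 2 Y (T w)], which is small compared
    with [w], and [w] is comparable to [z]. *)
Lemma coisometry_defect_le : fin_op b -> rnorm T <= 1 / 16 -> rnorm U <= 1 / 2.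
Proof.
move=> fb T16.
have TP x : rnorm (T x) <= rnorm x / 16.
  by apply: le_trans (bop_rnormP _ _) _; rewrite ler_wpM2l ?rnorm_ge0//; lra.
have YY x : rnorm (Y x) ^+ 2 = rnorm x ^+ 2 + 2 * rip x (T x).
  rewrite -!rip_rnorm bopP isometry_defectE ripDr scaler_nat mulr2n ripDr.
  by rewrite mulr_natl mulr2n.
have Tle x : rip x (T x) <= rnorm x ^+ 2 / 16.
  apply: le_trans (rip_le_rnorm _ _) _; rewrite expr2 -mulrA.
  by rewrite ler_wpM2l ?rnorm_ge0.
have Tge x : - (rnorm x ^+ 2 / 16) <= rip x (T x).
  rewrite lerNl -ripNr; apply: le_trans (rip_le_rnorm _ _) _; rewrite rnormN expr2 -mulrA.
  by rewrite ler_wpM2l ?rnorm_ge0.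
have surj : forall z, exists x, Y x = z.
  apply: (fin_op_surjective fb) => x Yx; apply: rnorm0_eq0.
  have := YY x; rewrite YE Yx rnorm0 expr0n /= => h.
  by have := Tge x; have := rnorm_ge0 x; nra.
apply: bop_norm_le => [|z]; first by lra.
have [w wz] := surj z.
have -> : U z = - (2 *: Y (T w)).
  rewrite coisometry_defectE -wz isometry_defectE bopD bopZ opprD addrA subrr.
  by rewrite add0r.
have n0 : 0 <= rnorm z * (1 / 2) by rewrite mulr_ge0 ?rnorm_ge0 ?divr_ge0.
rewrite rnormN -ler_sqr ?nnegrE ?rnorm_ge0//.
rewrite scaler_nat mulr2n.
have n2 : rnorm (Y (T w) + Y (T w)) <= rnorm (Y (T w)) *+ 2.
  by rewrite mulr2n; exact: rnormD.
apply: (@le_trans _ _ ((rnorm (Y (T w)) *+ 2) ^+ 2)).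
  by rewrite ler_sqr ?nnegrE ?rnorm_ge0// mulrn_wge0// rnorm_ge0.
have := YY (T w); have := YY w; rewrite wz.
have := Tle (T w); have := Tge w; have := TP w.
have := rnorm_ge0 w; have := rnorm_ge0 (T w); clear.
move: (rnorm w) (rnorm (T w)) (rip w (T w)) (rip (T w) (T (T w))) (rnorm z) (rnorm (Y (T w))).
move=> p q r s n m q0 p0 qp r1 s1 nE mE.
(* With [p] and [q] the norms of [w] and [T w], the left side is at most [4 * (9 / 8) * q ^+ 2],
   while [rnorm z ^+ 2] is at least [7 / 8 * p ^+ 2]. *)
have q2 : q ^+ 2 <= p ^+ 2 / 256 by nra.
have -> : (m *+ 2) ^+ 2 = 4 * m ^+ 2 by ring.
have -> : (n * (1 / 2)) ^+ 2 = n ^+ 2 / 4 by field.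
by rewrite nE mE; have := sqr_ge0 p; lra.
Qed.

End NearIsometry.

Lemma kval_nceval (a : kop R) (P : ncpoly R) : kval (nceval a P) = nceval (kval a) P.
Proof. by elim: P => //= [P <- Q <-|k P <-|P <- Q <-|P <-]. Qed.

(** A finite matrix close to [a] changes the first defect by at most 1/32 and the second by at most
    1/4, so the bounds 1/16 and 1/2 for finite matrices become 1/32 and 3/4. *)
Lemma kop_gap (a : kop R) :
  rnorm (nceval a (isometry_defect R)) <= 1 / 32 ->
  rnorm (nceval a (coisometry_defect R)) <= 3 / 4.
Proof.
rewrite !kop_rnormE !kval_nceval; move: (kval a) (kvalP a) => f cf t32.
have [d d0 hd] : exists2 d : R, 0 < d & forall g, rnorm (f - g) <= d ->
    rnorm (nceval f (isometry_defect R) - nceval g (isometry_defect R)) <= 1 / 32.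
  by apply: nceval_near; lra.
have [c c0 hc] : exists2 d : R, 0 < d & forall g, rnorm (f - g) <= d ->
    rnorm (nceval f (coisometry_defect R) - nceval g (coisometry_defect R)) <= 1 / 4.
  by apply: nceval_near; lra.
have [|g fg] := cf (Num.min c d); first by rewrite lt_min c0.
rewrite le_min => /andP[/hc ug /hd tg].
have tg16 : rnorm (nceval g (isometry_defect R)) <= 1 / 16.
  rewrite -[nceval g _](subrK (nceval f (isometry_defect R))).
  rewrite (le_trans (rnormD _ _))// rnormB (le_trans (lerD tg t32))//; clear; lra.
rewrite -[nceval f _](subrK (nceval g (coisometry_defect R))).
rewrite (le_trans (rnormD _ _))// (le_trans (lerD ug (coisometry_defect_le fg tg16)))//.
by clear; lra.
Qed.

(** * The unilateral shift as a multiplier of the compact operators *)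

Definition shiftr (x : nat -> R[i]) n := if n is m.+1 then x m else 0.

Lemma qpart_shiftr (x : nat -> R[i]) N : qpart (shiftr x) N.+1 = qpart x N.
Proof.
rewrite /qpart big_ord_recl /= /rdot /= !mul0r !add0r.
by apply: eq_bigr.
Qed.

Fact shiftr_bounded x : exists M, forall N, qpart (shiftr x) N <= M.
Proof.
exists (l2_sq x) => -[|N]; last by rewrite qpart_shiftr qpart_le_sq.
by rewrite /qpart big_ord0 l2_sq_ge0.
Qed.

Fact shiftl_bounded x : exists M, forall N, qpart (fun n => x n.+1) N <= M.
Proof.
exists (l2_sq x) => N; apply: le_trans (qpart_le_sq x N.+1).
by rewrite /qpart [leRHS]big_ord_recl /= lerDr; exact: rdot_ge0.
Qed.

Definition l2_shiftr x : H := L2 (shiftr_bounded x).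
Definition l2_shiftl x : H := L2 (shiftl_bounded x).

Lemma l2_shiftr_le x : rnorm (l2_shiftr x) <= rnorm x.
Proof.
apply: l2_rnorm_le; first exact: rnorm_ge0.
rewrite l2_rnormE l2_normK => -[|N]; last by rewrite qpart_shiftr qpart_le_sq.
by rewrite /qpart big_ord0 l2_sq_ge0.
Qed.

Program Definition shift : bop R := @Bop R l2_shiftr l2_shiftl _ _ _.
Next Obligation.
move=> x y; apply/esym.
(* The entry 0 of the shifted sequence is zero, so [N] terms on one side match [N.+1] terms on the
   other. *)
apply: (@rip_unique _ _ _ (fun N => \sum_(i < N.+1) rdot (l2_shiftr x i) (y i))) => [N|].
  by rewrite big_ord_recl /= {2}/rdot /= !mul0r !add0r.
by rewrite (cvg_shiftS (fun N => \sum_(i < N) rdot (l2_shiftr x i) (y i))); exact: rip_cvg.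
Qed.
Next Obligation. by move=> k x; apply: l2_ext => -[|n] //=; rewrite mulr0. Qed.
Next Obligation. by exists 1 => x; rewrite mul1r; exact: l2_shiftr_le. Qed.

Lemma shift_le1 : rnorm shift <= 1.
Proof. by apply: bop_norm_le => // x; rewrite mulr1; exact: l2_shiftr_le. Qed.

(** The shift moves the rows of a block down by one, or its columns left by one; a corner of size
    [N.+1] holds both results. *)
Lemma fin_op_shift g : fin_op g -> fin_op (shift ** g) /\ fin_op (g ** shift).
Proof.
move=> /fin_op_ge[N hN]; have [h1 h2] := hN N.+1 (leqnSn N).
have [h3 h4] := hN N (leqnn N).
split; exists N.+1; split.
- rewrite -h3; apply: bop_ext => x; apply: l2_ext => -[|n] //=; rewrite ltnS.
  by case: ifP => // ->.
- by rewrite -smulA h2.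
- by rewrite smulA h1.
- rewrite -h4 -!smulA; congr (_ ** _).
  apply: bop_ext => x; apply: l2_ext => -[|n] //=; case: ifP => // nN.
  by rewrite (ltn_trans _ (ltnSn N)) // (ltn_trans (ltnSn n)).
Qed.

Lemma compact_shift f : compact_op f -> compact_op (shift ** f) /\ compact_op (f ** shift).
Proof.
move=> cf; split=> e /cf[g /fin_op_shift[fg fg'] hg].
  exists (shift ** g) => //; rewrite -smulBr (le_trans (rnormM _ _))//.
  by rewrite (le_trans _ hg)// ler_piMl ?rnorm_ge0 ?shift_le1.
exists (g ** shift) => //; rewrite -smulBl (le_trans (rnormM _ _))//.
by rewrite (le_trans _ hg)// ler_piMr ?rnorm_ge0 ?shift_le1.
Qed.

(** The solution of [1 + 2 x = shift], so its first defect is 0 and its second is the projection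
    onto the basis vector 0. *)
Definition half_shift : bop R := 2^-1 *: (shift - bop_one R).

Lemma half_real : (2^-1 : R[i]) = (2^-1 : R)%:C%C.
Proof. by rewrite fmorphV/= rmorph_nat. Qed.

Lemma half_shift_le1 : rnorm half_shift <= 1.
Proof.
rewrite rnormZ; have one1 : rnorm (bop_one R) <= 1.
  by apply: bop_norm_le => // x; rewrite mulr1.
have h : rnorm (shift - bop_one R) <= 2.
  by rewrite (le_trans (rnormD _ _))// rnormN (le_trans (lerD shift_le1 one1)).
by rewrite half_real normc_real ?invr_ge0// mulrC ler_pdivrMr// mul1r.
Qed.

Lemma half_shift_compactl f : compact_op f -> compact_op (half_shift ** f).
Proof.
move=> cf; rewrite smulZl smulBl; apply: compactZ; apply: compactD.
  by have [] := compact_shift cf.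
by rewrite -scaleN1r; apply: compactZ; rewrite (_ : bop_one R ** f = f)//; exact: bop_ext.
Qed.

Lemma half_shift_compactr f : compact_op f -> compact_op (f ** half_shift).
Proof.
move=> cf; rewrite smulZr smulBr; apply: compactZ; apply: compactD.
  by have [] := compact_shift cf.
by rewrite -scaleN1r; apply: compactZ; rewrite (_ : f ** bop_one R = f)//; exact: bop_ext.
Qed.

Lemma half_shift_starE x : badj half_shift x = 2^-1 *: (l2_shiftl x - x).
Proof.
have -> : badj half_shift x = star half_shift x by [].
rewrite starZ starB half_real conjc_real.
by congr (_ *: _); congr (_ + _).
Qed.

Lemma half_shiftE x : half_shift x = 2^-1 *: (l2_shiftr x - x).
Proof. by congr (_ *: _); congr (_ + _); exact: scaleN1r. Qed.

Lemma half_shift_isometry : nceval half_shift (isometry_defect R) = 0.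
Proof.
apply: bop_ext => x.
rewrite -[LHS]/(2 *: badj half_shift (half_shift x) + (half_shift x + badj half_shift x)).
rewrite !half_shift_starE !half_shiftE; apply: l2_ext => n.
rewrite !(l2_coordD, l2_coordZ, l2_coordN) /= ?(l2_coordD, l2_coordZ, l2_coordN) /=.
by field.
Qed.

Lemma half_shift_coisometry : nceval half_shift (coisometry_defect R) = munit R 0 0.
Proof.
apply: bop_ext => x.
rewrite -[LHS]/((-2) *: (2 *: half_shift (badj half_shift x) +
  (half_shift x + badj half_shift x))).
rewrite !half_shift_starE !half_shiftE; apply: l2_ext => -[|n];
rewrite !(l2_coordD, l2_coordZ, l2_coordN) /= ?(l2_coordD, l2_coordZ, l2_coordN) /=;
by field.
Qed.

Program Definition half_shift_mult : multiplier (kop R) :=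
  @Multiplier R (kop R) (fun a => Kop (half_shift_compactl (kvalP a)))
    (fun a => Kop (half_shift_compactr (kvalP a))) _ _ _ _ _ _ _.
Next Obligation. by move=> k a b; apply: kop_ext; rewrite /= smulDr smulZr. Qed.
Next Obligation. by move=> k a b; apply: kop_ext; rewrite /= smulDl smulZl. Qed.
Next Obligation. by exists (rnorm half_shift) => a; exact: (rnormM half_shift (kval a)). Qed.
Next Obligation. by exists (rnorm half_shift) => a; rewrite mulrC; exact: (rnormM (kval a)). Qed.
Next Obligation. by move=> a b; apply: kop_ext; exact: smulA. Qed.
Next Obligation. by move=> a b; apply: kop_ext; rewrite /= smulA. Qed.
Next Obligation. by move=> a b; apply: kop_ext; rewrite /= smulA. Qed.

(** The analogue of [acts_at] for operators on l2: polynomial identities checked for [X] carry over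
    to the multiplier. *)
Definition represents (m : multiplier (kop R)) (X : bop R) := forall a : kop R,
  kval (lmult m a) = X ** kval a /\ kval (rmult m a) = kval a ** X.

Lemma represents_nceval m X (P : ncpoly R) :
  represents m X -> represents (nceval m P) (nceval X P).
Proof.
move=> mX; elim: P => //= [P hP Q hQ|k P hP|P hP Q hQ|P hP] a.
- have [p1 p2] := hP a; have [q1 q2] := hQ a.
  by rewrite /= p1 p2 q1 q2 smulDl smulDr.
- by have [p1 p2] := hP a; rewrite /= p1 p2 smulZl smulZr.
- split=> /=.
    by have [-> _] := hP (lmult (nceval m Q) a); have [-> _] := hQ a; rewrite smulA.
  by have [_ ->] := hQ (rmult (nceval m P) a); have [_ ->] := hP a; rewrite smulA.
- by have [p1 p2] := hP (star a); rewrite /= p1 p2 !starM !starK.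
Qed.

Lemma kop_multiplier : exists m : multiplier (kop R),
  [/\ rnorm m <= 1, nceval m (isometry_defect R) = 0
    & rnorm (nceval m (coisometry_defect R)) = 1].
Proof.
have rep : represents half_shift_mult half_shift by [].
exists half_shift_mult; split.
- apply: mult_norm_le => // a; rewrite mulr1 kop_rnormE (le_trans (rnormM _ _))//.
  by rewrite ler_piMl ?rnorm_ge0 ?half_shift_le1.
- have h := represents_nceval (isometry_defect R) rep.
  by apply: mult_ext => a; apply: kop_ext; have [p1 p2] := h a;
    rewrite ?p1 ?p2 half_shift_isometry ?smul0x ?smulx0.
have h := represents_nceval (coisometry_defect R) rep.
apply/eqP; rewrite eq_le; apply/andP; split.
  apply: mult_norm_le => // a; rewrite mulr1 kop_rnormE (h a).1 half_shift_coisometry.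
  by rewrite (le_trans (rnormM _ _))// ler_piMl ?rnorm_ge0 ?munit_le.
(* The norm is bounded below by testing on the compact projection [munit R 0 0], which the defect
   fixes. *)
have := mult_normP (nceval half_shift_mult (coisometry_defect R)) (kunit R 0 0).
rewrite kop_rnormE (h _).1 half_shift_coisometry.
have -> : munit R 0 0 ** kval (kunit R 0 0) = munit R 0 0.
  by apply: bop_ext => x; apply: l2_ext => n /=; rewrite mulr1.
rewrite ler_pMr// lt_neqAle rnorm_ge0 andbT eq_sym; apply/eqP => /rnorm0_eq0.
move=> /(congr1 (fun f : bop R => f (ebasis R 0%N) 0%N)).
by rewrite /= mulr1 => /eqP; rewrite oner_eq0.
Qed.

End FiniteIndex.

Lemma infinite_nat_all : infinite_set [set n : nat | true].
Proof.
by rewrite (_ : [set n : nat | true] = setT); [exact: infinite_nat|apply/seteqP].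
Qed.

Lemma compact_corona_not_saturated (R : realType) :
  ~ countably_qf_saturated (corona (c0_sum (fun=> kop R : cstarAlgType R))).
Proof.
apply: (@corona_not_saturated R (fun=> kop R : cstarAlgType R)
  (isometry_defect R) (coisometry_defect R) (fun=> true) (1 / 32)).
- by lra.
- exact: infinite_nat_all.
- by move=> n a _; exact: kop_gap.
- by move=> n _; exact: kop_multiplier.
Qed.

Theorem theorem5p2 (R : realType) :
  (forall A : nat -> cstarAlgType R,
     (forall n, ~ unital (A n)) ->
     infinite_set [set n | projectionless (A n)] ->
     ~ countably_qf_saturated (corona (c0_sum A))) /\
  (exists A : nat -> cstarAlgType R,
     (forall n, simple_cstar (A n) /\ separable_space (A n)) /\
     ~ countably_qf_saturated (corona (c0_sum A))).
Proof.
split; first exact: projectionless_corona_not_saturated.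
exists (fun=> kop R : cstarAlgType R); split; last exact: compact_corona_not_saturated.
by move=> n; split; [exact: kop_simple|exact: kop_separable].
Qed.
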